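(* Let $d\ge1$, $n=n_1+\cdots+n_d$, write $\mathbb{R}^n=\mathbb{R}^{n_1}\times\cdots\times\mathbb{R}^{n_d}$, and let $\Delta=\Delta_1\times\cdots\times\Delta_d\subseteq\mathbb{R}^n$ where each $\Delta_j\subseteq\mathbb{R}^{n_j}$ is a non-degenerate simplex of $n_j$ points. (i) If $S\subseteq\mathbb{R}^n$ is measurable with positive upper Banach density, then there exists a threshold $\lambda_0=\lambda_0(S,\Delta)$ such that $S$ contains an isometric copy of $\lambda\Delta$ for all $\lambda\ge\lambda_0$. (ii) For any $0<\delta\le1$ there exists a constant $c=c(\delta,\Delta)>0$ such that any measurable $S\subseteq[0,1]^n$ with $|S|\ge\delta$ contains an isometric copy of $\lambda\Delta$ for all $\lambda$ in some interval of length at least $c$. Moreover, the isometric copies of $\lambda\Delta$ in both (i) and (ii) can all be realized in the special form $\Delta_1'\times\cdots\times\Delta_d'$ with each $\Delta_j'\subseteq\mathbb{R}^{n_j}$ an isometric copy of $\lambda\Delta_j$.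
   Context: A non-degenerate simplex of $m$ points in $\mathbb{R}^m$ is a set of $m$ affinely independent points (their affine span is $(m-1)$-dimensional). The upper Banach density of a measurable $S\subseteq\mathbb{R}^n$ is $\delta^*(S)=\lim_{N\to\infty}\sup_{t\in\mathbb{R}^n}|S\cap(t+Q(N))|/|Q(N)|$, with $|\cdot|$ Lebesgue measure and $Q(N)=[-N/2,N/2]^n$. A finite configuration $\Delta'$ is an isometric copy of $\lambda\Delta$ if there is a bijection $\phi:\Delta\to\Delta'$ with $|\phi(v)-\phi(w)|=\lambda|v-w|$ for all $v,w\in\Delta$. *)

(* Defs.v *)
From HB Require Import structures.
From mathcomp Require Import all_boot all_order all_algebra.
From mathcomp Require Import all_classical all_reals all_analysis.

Set Implicit Arguments.
Unset Strict Implicit.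
Unset Printing Implicit Defensive.

Import Order.TTheory GRing.Theory Num.Theory.
Import numFieldNormedType.Exports.

Local Open Scope classical_set_scope.
Local Open Scope ring_scope.

(* The library norm `|x| on 'rV_m is the maximum norm, whence this one. *)
Definition enorm (R : realType) (m : nat) (x : 'rV[R]_m) : R :=
  Num.sqrt (\sum_(i < m) x 0 i ^+ 2).

Definition box (R : realType) (m : nat) (a b : 'rV[R]_m) : set 'rV[R]_m :=
  [set x | forall i, a 0 i <= x 0 i <= b 0 i].

(* Lebesgue outer measure on R^m.  The side condition a <= b excludes empty
   boxes, for which the product of the b i - a i is not the volume. *)
Definition leb (R : realType) (m : nat) (A : set 'rV[R]_m) : \bar R :=
  ereal_inf [set V : \bar R | exists a b : nat -> 'rV[R]_m,
    [/\ forall k i, a k 0 i <= b k 0 i,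
        A `<=` \bigcup_k box (a k) (b k) &
        V = (\sum_(0 <= k <oo) (\prod_(i < m) (b k 0 i - a k 0 i))%:E)%E ]].

(* Lebesgue (not only Borel) measurability; on these sets [leb] is the
   Lebesgue measure. *)
Definition leb_measurable (R : realType) (m : nat) (A : set 'rV[R]_m) : Prop :=
  caratheodory_measurable (@leb R m) A.

Definition cube (R : realType) (m : nat) (N : R) : set 'rV[R]_m :=
  box (const_mx (- (N / 2))) (const_mx (N / 2)).

Definition translate (R : realType) (m : nat) (t : 'rV[R]_m)
  (A : set 'rV[R]_m) : set 'rV[R]_m := [set t + x | x in A].

Definition upper_banach_density (R : realType) (m : nat) (S : set 'rV[R]_m) :
    \bar R :=
  lim (ereal_sup [set (leb (S `&` translate t (cube N)) / leb (@cube R m N))%E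
                 | t in [set: 'rV[R]_m]] @[N --> +oo%R]).

Definition affinely_independent (R : realType) (m k : nat)
    (p : 'I_k -> 'rV[R]_m) : Prop :=
  forall c : 'I_k -> R, \sum_(i < k) c i = 0 -> \sum_(i < k) c i *: p i = 0 ->
    forall i, c i = 0.

(* An affinely independent family is injective, so D has exactly m points. *)
Definition nondegenerate_simplex (R : realType) (m : nat)
    (D : set 'rV[R]_m) : Prop :=
  exists p : 'I_m -> 'rV[R]_m, affinely_independent p /\ D = range p.

(* D' is an isometric copy of the dilate of D by l. *)
Definition isometric_copy (R : realType) (m : nat) (l : R)
    (D D' : set 'rV[R]_m) : Prop :=
  exists phi : 'rV[R]_m -> 'rV[R]_m, set_bij D D' phi /\
    forall v w, D v -> D w -> enorm (phi v - phi w) = l * enorm (v - w).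

(* R^(n_0 + ... + n_(d-1)) is split into its consecutive blocks of coordinates,
   [submxrow x j] being the j-th block of x. *)
Definition block_prod (R : realType) (d : nat) (n : 'I_d -> nat)
    (D : forall j, set 'rV[R]_(n j)) : set 'rV[R]_(\sum_(j < d) n j) :=
  [set x | forall j, D j (submxrow x j)].

(* S contains an isometric copy of the dilate by l of the product of the D j,
   and this copy is itself a product of isometric copies of the dilates of
   the D j. *)
Definition contains_product_copy (R : realType) (d : nat) (n : 'I_d -> nat)
    (D : forall j, set 'rV[R]_(n j)) (l : R)
    (S : set 'rV[R]_(\sum_(j < d) n j)) : Prop :=
  exists D' : forall j, set 'rV[R]_(n j),
    [/\ forall j, isometric_copy l (D j) (D' j),
        isometric_copy l (block_prod D) (block_prod D') &
        block_prod D' `<=` S].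

(* Main.v *)
(* Let f be the indicator function of a bounded part of S, and count, with
   multiplicity, the copies in S of the dilate of Delta by l which arise from a
   finite family sigma_j of isometric copies of each Delta_j.

   One simplex: all its vertices but one are fixed by the rotations in a plane, on
   which the remaining one runs along a circular arc.  Averaging the translates
   of f along the arc kills, up to a small error, the part of f which is orthogonal
   to the functions varying slowly at scale l in that plane; averaging moreover over
   finitely many reflections leaves only G = P_- f, the average of f over a grid much
   smaller than l.  Replacing the translates of G by G itself costs the square
   root of |P_- f|^2 - |P_+ P_- f|^2, with P_+ the average over a grid much larger
   than l.  Rotating the vertices one after the other replaces the whole simplex by
   small tuples of grid points, up to a multiple of the difference of the numbers of
   close pairs at a scale below l and at a scale above l.

   Several simplices: replacing the blocks one by one, the error is each time the
   same difference, the previous blocks being already replaced.  For l ranging over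
   a lacunary sequence these differences telescope, and all of them are small for
   some l of the sequence.  There the count is close to a count of small tuples of
   grid points in every block, which Jensen's inequality bounds below in terms of the
   density.  Hence S contains copies for some l of any lacunary sequence of
   bounded length, which gives both statements. *)

Require Import Defs.
From HB Require Import structures.
From mathcomp Require Import all_boot all_order all_algebra.
From mathcomp Require Import all_classical all_reals all_analysis.
From mathcomp Require Import measurable_realfun ring lra.

Set Implicit Arguments.
Unset Strict Implicit.
Unset Printing Implicit Defensive.

Import Order.TTheory GRing.Theory Num.Theory.
Import numFieldNormedType.Exports.

Local Open Scope classical_set_scope.
Local Open Scope ring_scope.

(** * Averages of translates in a Hilbert space *)

Section Means.
Variable R : realType.
Implicit Types I J : Type.

(** The order of the choices shapes the proof. [J0] and [C] in [many_scales] may depend only on the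
    simplices and on the density: the cube that cuts out a bounded part of S in (i) and the length c
    in (ii) are chosen from them. The finite families of copies may depend on an $L^2$ modulus of
    continuity [rho] of the indicator function, but not on the functions to which they are applied,
    since these are tuple functions of the other blocks. Hence the estimates for one simplex are
    uniform over the class [rclass mu rho], and in [circle_smoothing] the size [x] of the averaging
    grid is independent of [rho], on which only numbers of points and steps depend. Finite averages
    of translates stand for Fourier multipliers, and finitely many reflections for the invariant
    measure on rotations: any $2^m + 1$ of those used here send a given unit vector to a spanning
    set, with a uniform constant. Square roots of differences of counts would not telescope, so they
    are traded for the differences themselves. All errors are small multiples of [mu ^+ 2], in the
    end the measure of the set, because the main term is only a fixed multiple of it. *)

Definition rmean I (s : seq I) (g : I -> R) : R :=
  (size s)%:R^-1 * \sum_(i <- s) g i.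

Lemma rmean_le I (s : seq I) (g h : I -> R) :
  (forall i, g i <= h i) -> rmean s g <= rmean s h.
Proof. by move=> gh; rewrite ler_wpM2l ?invr_ge0 ?ler0n// ler_sum. Qed.

Lemma rmean_le_in (I : eqType) (s : seq I) (g h : I -> R) :
  (forall i, i \in s -> g i <= h i) -> rmean s g <= rmean s h.
Proof.
move=> gh; rewrite ler_wpM2l ?invr_ge0 ?ler0n//.
by rewrite big_seq [leRHS]big_seq ler_sum.
Qed.

Lemma rmean_ge0 I (s : seq I) (g : I -> R) :
  (forall i, 0 <= g i) -> 0 <= rmean s g.
Proof. by move=> g0; rewrite mulr_ge0 ?invr_ge0 ?ler0n// sumr_ge0. Qed.

Lemma rmeanD I (s : seq I) (g h : I -> R) :
  rmean s (fun i => g i + h i) = rmean s g + rmean s h.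
Proof. by rewrite /rmean big_split/= mulrDr. Qed.

Lemma rmeanN I (s : seq I) (g : I -> R) :
  rmean s (fun i => - g i) = - rmean s g.
Proof. by rewrite /rmean sumrN mulrN. Qed.

Lemma rmeanB I (s : seq I) (g h : I -> R) :
  rmean s (fun i => g i - h i) = rmean s g - rmean s h.
Proof. by rewrite rmeanD rmeanN. Qed.

Lemma rmeanZ I (s : seq I) (c : R) (g : I -> R) :
  rmean s (fun i => c * g i) = c * rmean s g.
Proof. by rewrite /rmean -mulr_sumr mulrCA. Qed.

Lemma rmean_cst I (s : seq I) (c : R) : (0 < size s)%N ->
  rmean s (fun=> c) = c.
Proof.
move=> s0; rewrite /rmean big_const_seq count_predT iter_addr addr0.
by rewrite -[c *+ _]mulr_natl mulrA mulVf ?mul1r// pnatr_eq0 -lt0n.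
Qed.

Lemma rmean_cst_le I (s : seq I) (c : R) : 0 <= c -> rmean s (fun=> c) <= c.
Proof.
move=> c0; have [|s0] := posnP (size s); last by rewrite rmean_cst.
by move/size0nil ->; rewrite /rmean big_nil mulr0.
Qed.

Lemma rmean_leC I (s : seq I) (g : I -> R) (c : R) : 0 <= c ->
  (forall i, g i <= c) -> rmean s g <= c.
Proof. by move=> c0 gc; apply: le_trans (rmean_cst_le s c0); exact: rmean_le. Qed.

Lemma eq_rmean I (s : seq I) (g h : I -> R) : g =1 h -> rmean s g = rmean s h.
Proof. by move=> gh; congr (_ * _); apply: eq_bigr => i _. Qed.

Lemma rmean_norm I (s : seq I) (g : I -> R) :
  `|rmean s g| <= rmean s (fun i => `|g i|).
Proof.
rewrite /rmean normrM ger0_norm ?invr_ge0 ?ler0n//.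
by rewrite ler_wpM2l ?invr_ge0 ?ler0n// ler_norm_sum.
Qed.

Lemma exchange_rmean I J (s : seq I) (t : seq J) (g : I -> J -> R) :
  rmean s (fun i => rmean t (g i)) = rmean t (fun j => rmean s (g^~ j)).
Proof.
rewrite /rmean -!mulr_sumr exchange_big/= !mulrA [X in X * _]mulrC.
by congr (_ * _); rewrite mulr_sumr.
Qed.

Lemma rmean_allpairs I J K (f : I -> J -> K) (s : seq I) (t : seq J)
    (g : K -> R) :
  rmean [seq f i j | i <- s, j <- t] g =
  rmean s (fun i => rmean t (fun j => g (f i j))).
Proof.
rewrite /rmean size_allpairs natrM invfM big_allpairs_dep/= -!mulrA.
by congr (_ * _); rewrite -mulr_sumr.
Qed.

Lemma rmean_map I J (f : I -> J) (s : seq I) (g : J -> R) :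
  rmean (map f s) g = rmean s (fun i => g (f i)).
Proof. by rewrite /rmean size_map big_map. Qed.

Lemma rmean_sqr I (s : seq I) (g : I -> R) :
  rmean s g ^+ 2 <= rmean s (fun i => g i ^+ 2).
Proof.
have [s0|s0] := posnP (size s).
  by rewrite /rmean s0 invr0 !mul0r expr0n.
set m := rmean s g.
have : 0 <= rmean s (fun i => (g i - m) ^+ 2).
  by apply: rmean_ge0 => i; exact: sqr_ge0.
rewrite (@eq_rmean _ _ _ (fun i => (g i ^+ 2 - (2 * m) * g i) + m ^+ 2)); last first.
  by move=> i; ring.
by rewrite rmeanD rmeanB rmeanZ rmean_cst// -/m => h; lra.
Qed.

End Means.

Lemma exists_nat_ge (R : realType) (c : R) : exists K : nat, (0 < K)%N /\ c <= K%:R.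
Proof.
exists (Num.bound c).+1; split => //.
by apply: le_trans (ler_norm c) _; rewrite -natr1; have := ltW (archi_boundP (normr_ge0 c)); rewrite /Num.bound normr_id; lra.
Qed.

Lemma exists_half_exp (R : realType) (c : R) : 0 < c -> exists s : nat, (2^-1) ^+ s <= c.
Proof.
move=> c0; have [K [K0 Kc]] := exists_nat_ge c^-1; exists K.
rewrite exprVn -[leRHS]invrK lef_pV2 ?posrE ?invr_gt0 ?exprn_gt0//.
by apply: le_trans Kc _; rewrite -natrX ler_nat ltnW// ltn_expl.
Qed.

(** The form is only positive semidefinite, so that functions equal almost everywhere need not be
    identified. *)
Record l2space (R : realType) (E : zmodType) := L2space {
  l2sort :> lmodType R;
  ip : l2sort -> l2sort -> R;
  sh : E -> l2sort -> l2sort;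
  ipC : forall F G, ip F G = ip G F;
  ipDl : forall F G K, ip (F + G) K = ip F K + ip G K;
  ipZl : forall c F K, ip (c *: F) K = c * ip F K;
  ip_ge0 : forall F, 0 <= ip F F;
  shD : forall w F G, sh w (F + G) = sh w F + sh w G;
  shZ : forall w c F, sh w (c *: F) = c *: sh w F;
  sh_add : forall v w F, sh (v + w) F = sh v (sh w F);
  sh0 : forall F, sh 0 F = F;
  ip_sh : forall w F G, ip (sh w F) (sh w G) = ip F G }.

Section L2.
Variables (R : realType) (E : normedModType R) (H : l2space R E).
Implicit Types (F G K : H) (v w : E) (D : seq E).

Lemma ipDr F G K : ip F (G + K) = ip F G + ip F K.
Proof. by rewrite ipC ipDl ipC [ip K F]ipC. Qed.

Lemma ipZr c F K : ip F (c *: K) = c * ip F K.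
Proof. by rewrite ipC ipZl ipC. Qed.

Lemma ip0l F : ip 0 F = 0 :> R.
Proof. by rewrite -(scale0r 0) ipZl mul0r. Qed.

Lemma ip0r F : ip F 0 = 0 :> R.
Proof. by rewrite ipC ip0l. Qed.

Lemma ipNl F G : ip (- F) G = - ip F G.
Proof. by rewrite -scaleN1r ipZl mulN1r. Qed.

Lemma ipNr F G : ip F (- G) = - ip F G.
Proof. by rewrite ipC ipNl ipC. Qed.

Lemma ip_suml I (s : seq I) (f : I -> H) G :
  ip (\sum_(i <- s) f i) G = \sum_(i <- s) ip (f i) G.
Proof. by rewrite (big_morph (fun F => ip F G) (fun F K => ipDl F K G) (ip0l G)). Qed.

Lemma ip_sumr I (s : seq I) (f : I -> H) G :
  ip G (\sum_(i <- s) f i) = \sum_(i <- s) ip G (f i).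
Proof. by rewrite (big_morph (ip G) (ipDr G) (ip0r G)). Qed.

Lemma shN w F : sh w (- F) = - sh w F.
Proof. by rewrite -scaleN1r shZ scaleN1r. Qed.

Lemma shB w F G : sh w (F - G) = sh w F - sh w G.
Proof. by rewrite shD shN. Qed.

Lemma sh_0 w : sh w (0 : H) = 0.
Proof. by rewrite -(scale0r 0) shZ !scale0r. Qed.

Lemma sh_sum I (s : seq I) (f : I -> H) w :
  sh w (\sum_(i <- s) f i) = \sum_(i <- s) sh w (f i).
Proof. by rewrite (big_morph (sh w) (shD w) (sh_0 w)). Qed.

Lemma shC v w F : sh v (sh w F) = sh w (sh v F).
Proof. by rewrite -!sh_add addrC. Qed.

Lemma ip_shN w F G : ip (sh w F) G = ip F (sh (- w) G).
Proof. by rewrite -(ip_sh (- w)) -sh_add addNr sh0. Qed.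

Lemma ip_cs F G : ip F G ^+ 2 <= ip F F * ip G G.
Proof.
(* A vector [G] of norm 0 may be non-zero; then [ip F F + 2 * t * ip F G] is nonnegative for all
   [t], hence constant in [t]. *)
have [G0|G0] := eqVneq (ip G G) 0.
  have h t : 0 <= ip F F + 2 * t * ip F G.
    have := ip_ge0 (F + t *: G).
    by rewrite ipDl !ipDr !ipZl !ipZr G0 [ip G F]ipC => h; lra.
  suff -> : ip F G = 0 by rewrite expr0n/= G0 mulr0.
  apply/eqP; apply: contraT => FG0.
  have := h (- (ip F F + 1) / (2 * ip F G)).
  rewrite (_ : 2 * _ * _ = - (ip F F + 1)); first by lra.
  by field; rewrite FG0.
have Gp : 0 < ip G G by rewrite lt_neqAle eq_sym G0 ip_ge0.
have := ip_ge0 (ip G G *: F - ip F G *: G).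
rewrite ipDl !ipDr !ipNl !ipNr !ipZl !ipZr [ip G F]ipC => h.
have {h} : 0 <= ip G G * (ip F F * ip G G - ip F G ^+ 2) by move: h; lra.
by rewrite pmulr_rge0// subr_ge0.
Qed.

Definition nrm F : R := Num.sqrt (ip F F).

Lemma nrm_ge0 F : 0 <= nrm F. Proof. exact: sqrtr_ge0. Qed.

Lemma nrm_sqr F : nrm F ^+ 2 = ip F F.
Proof. by rewrite sqr_sqrtr// ip_ge0. Qed.

Lemma ip_nrm F G : `|ip F G| <= nrm F * nrm G.
Proof.
rewrite -ler_sqr ?nnegrE ?mulr_ge0 ?nrm_ge0//.
by rewrite real_normK ?num_real// exprMn !nrm_sqr ip_cs.
Qed.

Lemma ip_le_nrm F G : ip F G <= nrm F * nrm G.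
Proof. exact: le_trans (ler_norm _) (ip_nrm F G). Qed.

Lemma nrmD F G : nrm (F + G) <= nrm F + nrm G.
Proof.
rewrite -ler_sqr ?nnegrE ?addr_ge0 ?nrm_ge0// nrm_sqr ipDl !ipDr [ip G F]ipC.
have := ip_le_nrm F G; rewrite -!nrm_sqr sqrrD; lra.
Qed.

Lemma nrm0 : nrm 0 = 0. Proof. by rewrite /nrm ip0l sqrtr0. Qed.

Lemma nrmZ c F : nrm (c *: F) = `|c| * nrm F.
Proof. by rewrite /nrm ipZl ipZr mulrA -expr2 sqrtrM ?sqr_ge0// sqrtr_sqr. Qed.

Lemma nrmN F : nrm (- F) = nrm F.
Proof. by rewrite -scaleN1r nrmZ normrN1 mul1r. Qed.

Lemma nrmB F G : nrm (F - G) <= nrm F + nrm G.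
Proof. by rewrite -(nrmN G) nrmD. Qed.

Lemma nrmBC F G : nrm (F - G) = nrm (G - F).
Proof. by rewrite -nrmN opprB. Qed.

Lemma nrm_dist G F K : nrm (F - K) <= nrm (F - G) + nrm (G - K).
Proof. by apply: le_trans (nrmD _ _); rewrite addrA subrK. Qed.

Lemma nrm_sum I (s : seq I) (f : I -> H) :
  nrm (\sum_(i <- s) f i) <= \sum_(i <- s) nrm (f i).
Proof.
elim: s => [|i s IH]; first by rewrite !big_nil nrm0.
by rewrite !big_cons (le_trans (nrmD _ _))// lerD2l.
Qed.

Lemma nrm_sh w F : nrm (sh w F) = nrm F.
Proof. by rewrite /nrm ip_sh. Qed.

Definition avg I (s : seq I) (f : I -> H) : H :=
  (size s)%:R^-1 *: \sum_(i <- s) f i.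

Lemma nrm_avg I (s : seq I) (f : I -> H) :
  nrm (avg s f) <= rmean s (fun i => nrm (f i)).
Proof.
rewrite nrmZ ger0_norm ?invr_ge0 ?ler0n//.
by rewrite ler_wpM2l ?invr_ge0 ?ler0n// nrm_sum.
Qed.

Lemma nrm_avg_le I (s : seq I) (f : I -> H) c : 0 <= c ->
  (forall i, nrm (f i) <= c) -> nrm (avg s f) <= c.
Proof. by move=> c0 fc; apply: le_trans (nrm_avg _ _) (rmean_leC _ c0 fc). Qed.

Lemma avgB I (s : seq I) (f g : I -> H) :
  avg s (fun i => f i - g i) = avg s f - avg s g.
Proof. by rewrite /avg big_split/= sumrN scalerBr. Qed.

Lemma avg_cst I (s : seq I) F : (0 < size s)%N -> avg s (fun=> F) = F.
Proof.
move=> s0; rewrite /avg big_const_seq count_predT iter_addr addr0.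
by rewrite -[F *+ _]scaler_nat scalerA mulVf ?scale1r// pnatr_eq0 -lt0n.
Qed.

Lemma eq_avg I (s : seq I) (f g : I -> H) : f =1 g -> avg s f = avg s g.
Proof. by move=> fg; congr (_ *: _); apply: eq_bigr => i _. Qed.

Lemma sh_avg I (s : seq I) (f : I -> H) w :
  sh w (avg s f) = avg s (fun i => sh w (f i)).
Proof. by rewrite shZ sh_sum. Qed.

Lemma ip_avgl I (s : seq I) (f : I -> H) G :
  ip (avg s f) G = rmean s (fun i => ip (f i) G).
Proof. by rewrite ipZl ip_suml. Qed.

Lemma ip_avgr I (s : seq I) (f : I -> H) G :
  ip G (avg s f) = rmean s (fun i => ip G (f i)).
Proof. by rewrite ipZr ip_sumr. Qed.

Lemma exchange_avg I J (s : seq I) (t : seq J) (f : I -> J -> H) :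
  avg s (fun i => avg t (f i)) = avg t (fun j => avg s (f^~ j)).
Proof.
rewrite /avg -!scaler_sumr exchange_big/= !scalerA mulrC; congr (_ *: _).
Qed.

Definition av D F : H := avg D (fun d => sh d F).

Lemma avB D F G : av D (F - G) = av D F - av D G.
Proof. by rewrite -avgB; apply: eq_avg => d; rewrite shB. Qed.

Lemma nrm_av D F : nrm (av D F) <= nrm F.
Proof. by apply: nrm_avg_le => [|i]; rewrite ?nrm_ge0// nrm_sh. Qed.

Lemma sh_av D w F : sh w (av D F) = av D (sh w F).
Proof. by rewrite sh_avg; apply: eq_avg => d; rewrite shC. Qed.

Lemma avg_av I (s : seq I) D (f : I -> H) :
  av D (avg s f) = avg s (fun i => av D (f i)).
Proof. by rewrite exchange_avg; apply: eq_avg => d; rewrite sh_avg. Qed.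

Lemma avC D D' F : av D (av D' F) = av D' (av D F).
Proof. by rewrite avg_av; apply: eq_avg => d; rewrite sh_av. Qed.

Lemma av_allpairs I J (f : I -> J -> E) (s : seq I) (t : seq J)
    (g : I -> E) (h : J -> E) F :
  (forall i j, f i j = g i + h j) ->
  av [seq f i j | i <- s, j <- t] F = av (map g s) (av (map h t) F).
Proof.
move=> fE; rewrite /av /avg size_allpairs natrM invfM big_allpairs_dep/=.
rewrite !size_map !big_map -scalerA; congr (_ *: _); rewrite scaler_sumr.
apply: eq_bigr => i _; rewrite shZ sh_sum; congr (_ *: _).
by apply: eq_bigr => j _; rewrite fE sh_add.
Qed.

Lemma ip_av D F G : ip (av D F) G = ip F (av (map -%R D) G).
Proof.
rewrite ip_avgl ip_avgr rmean_map; apply: eq_rmean => d.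
exact: ip_shN.
Qed.

(* Cauchy-Schwarz: averages over many sets A i are controlled by averages over the
   sums A i + A j. *)
Lemma av_cs (I : Type) (s : seq I) (A : I -> seq E) F :
  rmean s (fun i => nrm (av (A i) F) ^+ 2) ^+ 2 <=
  nrm F ^+ 2 * rmean s (fun i => rmean s (fun j =>
    nrm (av (A i) (av (A j) F)) ^+ 2)).
Proof.
pose S := avg s (fun i => av (map -%R (A i)) (av (A i) F)).
have avK i G : av (map -%R (map -%R (A i))) G = av (A i) G.
  by rewrite -map_comp (@eq_map _ _ _ id) ?map_id// => x /=; rewrite opprK.
have -> : rmean s (fun i => nrm (av (A i) F) ^+ 2) = ip F S.
  by rewrite ip_avgr; apply: eq_rmean => i; rewrite nrm_sqr ip_av.
rewrite nrm_sqr; apply: le_trans (ip_cs F S) _; rewrite ler_wpM2l ?ip_ge0//.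
rewrite {1}/S ip_avgl; apply: rmean_le => i.
rewrite ip_avgr; apply: rmean_le => j.
rewrite ip_av avK [av (A i) (av (map _ _) _)]avC -ip_av.
by rewrite [av (A j) (av (A i) F)]avC nrm_sqr.
Qed.

Definition prog1 (g : E) (n : nat) : seq E := [seq g *+ k | k <- iota 0 n].

(** A generalized arithmetic progression, listed with multiplicities so that averaging over it is
    the composite of the averages over its one-dimensional factors. *)
Fixpoint prog (gs : seq E) (n : nat) : seq E :=
  if gs is g :: gs' then [seq g *+ k + d | k <- iota 0 n, d <- prog gs' n]
  else [:: 0].

Lemma av_prog0 n F : av (prog [::] n) F = F.
Proof. by rewrite /av /avg/= big_seq1 invr1 scale1r sh0. Qed.

Lemma av_prog_cons g gs n F :
  av (prog (g :: gs) n) F = av (prog1 g n) (av (prog gs n) F).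
Proof. by rewrite (@av_allpairs _ _ _ _ _ (fun k => g *+ k) id)// map_id. Qed.

Lemma size_prog gs n : size (prog gs n) = (n ^ size gs)%N.
Proof. by elim: gs => // g gs IH; rewrite size_allpairs size_iota IH expnS. Qed.

Lemma shift_sum (a : nat -> H) n j (B : R) : (forall k, nrm (a k) <= B) ->
  nrm (\sum_(k <- iota 0 n) a (k + j)%N - \sum_(k <- iota 0 n) a k) <= 2 * j%:R * B.
Proof.
move=> aB; elim: j => [|j IH].
  under eq_bigr do rewrite addn0.
  by rewrite subrr nrm0 mulr0 mul0r.
apply: le_trans (nrm_dist (\sum_(k <- iota 0 n) a (k + j)%N) _ _) _.
suff : nrm (\sum_(k <- iota 0 n) a (k + j.+1)%N - \sum_(k <- iota 0 n) a (k + j)%N)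
    <= 2 * B by move: IH; rewrite -natr1; lra.
rewrite -sumrB.
suff -> : \sum_(k <- iota 0 n) (a (k + j.+1)%N - a (k + j)%N) = a (n + j)%N - a j.
  by apply: le_trans (nrmB _ _) _; have := aB (n + j)%N; have := aB j; lra.
clear IH; elim: n => [|n IHn]; first by rewrite big_nil add0n subrr.
by rewrite -addn1 iotaD big_cat/= IHn big_seq1 add0n addn1 addnS addSn addrC addrA subrK.
Qed.

Lemma shift_avg (a : nat -> H) n j (B : R) : 0 <= B -> (forall k, nrm (a k) <= B) ->
  nrm (avg (iota 0 n) (fun k => a (k + j)%N) - avg (iota 0 n) a)
    <= 2 * j%:R * B / n%:R.
Proof.
move=> B0 aB; rewrite -scalerBr nrmZ size_iota ger0_norm ?invr_ge0 ?ler0n//.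
by rewrite mulrC ler_wpM2r ?invr_ge0 ?ler0n// shift_sum.
Qed.

Lemma sh_prog1 g n j F :
  nrm (sh (g *+ j) (av (prog1 g n) F) - av (prog1 g n) F) <= 2 * j%:R / n%:R * nrm F.
Proof.
have avE G : av (prog1 g n) G = avg (iota 0 n) (fun k => sh (g *+ k) G).
  by rewrite /av /avg size_map big_map.
rewrite avE sh_avg mulrAC.
have := @shift_avg (fun k => sh (g *+ k) F) n j (nrm F) (nrm_ge0 F) (fun k => _).
rewrite (@eq_avg _ _ (fun k => sh (g *+ j) (sh (g *+ k) F))
  (fun k => sh (g *+ (k + j)) F)); last first.
  by move=> k; rewrite -sh_add addnC mulrnDr.
by apply=> k; rewrite nrm_sh.
Qed.

Lemma sh_prog1_int g n (z : int) F :
  nrm (sh (g *~ z) (av (prog1 g n) F) - av (prog1 g n) F)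
    <= 2 * `|z%:~R : R| / n%:R * nrm F.
Proof.
case: z => j; first by rewrite -!pmulrn normr_nat; exact: sh_prog1.
rewrite NegzE !mulrNz -!pmulrn normrN normr_nat -(nrm_sh (g *+ j.+1)) shB -sh_add.
by rewrite subrr sh0 nrmBC; exact: sh_prog1.
Qed.

Lemma sh_prog_int (zg : seq (int * E)) n F :
  nrm (sh (\sum_(x <- zg) x.2 *~ x.1) (av (prog (unzip2 zg) n) F)
       - av (prog (unzip2 zg) n) F)
    <= \sum_(x <- zg) (2 * `|x.1%:~R : R| / n%:R * nrm F).
Proof.
elim: zg => [|[z g] zg IH]; first by rewrite !big_nil sh0 subrr nrm0.
rewrite !big_cons/=; move: IH; set w := \sum_(x <- zg) _; set P := av _ F.
move=> IH; rewrite -/(prog (g :: unzip2 zg) n) av_prog_cons -/P sh_add.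
apply: le_trans (nrm_dist (av (prog1 g n) (sh w P)) _ _) _.
apply: lerD; last by rewrite -avB; apply: le_trans (nrm_av _ _) IH.
rewrite sh_av; apply: le_trans (sh_prog1_int _ _ _ _) _.
rewrite ler_wpM2l ?mulr_ge0 ?invr_ge0 ?ler0n// nrm_sh; exact: nrm_av.
Qed.

(** The integer parts of the coefficients shift the progression by few steps compared with [n]. The
    fractional parts amount to a translation no longer than the sum of the steps, which the
    continuity of [F] absorbs. *)
Lemma sh_prog (cg : seq (R * E)) n F (c b : R) :
  (forall x, x \in cg -> `|x.1| <= c) ->
  (forall w, `|w| <= \sum_(x <- cg) `|x.2| -> nrm (sh w F - F) <= b) ->
  nrm (sh (\sum_(x <- cg) x.1 *: x.2) (av (prog (unzip2 cg) n) F)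
       - av (prog (unzip2 cg) n) F)
    <= (size cg)%:R * (2 * (c + 1) / n%:R) * nrm F + b.
Proof.
move=> cgc Fb.
pose zg := [seq (Num.floor x.1, x.2) | x : R * E <- cg].
have zg2 : unzip2 zg = unzip2 cg by rewrite /unzip2 -map_comp.
pose r := \sum_(x <- cg) (x.1 - (Num.floor x.1)%:~R) *: x.2.
pose z := \sum_(x <- zg) x.2 *~ x.1.
have -> : \sum_(x <- cg) x.1 *: x.2 = z + r.
  rewrite /z big_map -big_split/=; apply: eq_bigr => x _.
  by rewrite -scaler_int -scalerDl addrC subrK.
rewrite sh_add sh_av -zg2.
apply: le_trans (nrm_dist (sh z (av (prog (unzip2 zg) n) F)) _ _) _.
rewrite [leRHS]addrC; apply: lerD.
  rewrite -shB nrm_sh -avB; apply: le_trans (nrm_av _ _) (Fb _ _).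
  rewrite /r; apply: le_trans (ler_norm_sum _ _ _) _; apply: ler_sum => x _.
  rewrite normrZ ler_piMl// ger0_norm ?subr_ge0 ?floor_le//.
  by rewrite lerBlDl ltW// -intrD1 floorD1_gt.
apply: le_trans (sh_prog_int _ _ _) _; rewrite -mulr_suml ler_wpM2r ?nrm_ge0//.
rewrite /zg big_map mulr_natl; apply: (@le_trans _ _ (\sum_(x <- cg) (2 * (c + 1) / n%:R))).
  rewrite big_seq [leRHS]big_seq; apply: ler_sum => x /cgc xc /=.
  rewrite ler_wpM2r ?invr_ge0 ?ler0n// ler_wpM2l//.
  have := floor_le x.1; have := floorD1_gt x.1; rewrite intrD1.
  by move: xc; rewrite !ler_norml => /andP[h1 h2] h3 h4; apply/andP; split; lra.
by rewrite big_const_seq count_predT iter_addr addr0.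
Qed.

(** * Composites of averages at distinct indices *)

Fixpoint avs (D : nat -> seq E) (l : seq nat) F : H :=
  if l is i :: l' then av (D i) (avs D l' F) else F.

Lemma nrm_avs (D : nat -> seq E) l F : nrm (avs D l F) <= nrm F.
Proof. by elim: l => //= i l; apply: le_trans; exact: nrm_av. Qed.

(** The density left after [k] steps of [greedy]: [av_cs] squares it, and the factor 4 pays for
    selecting one index and for excluding those already chosen. *)
Fixpoint eps_iter (e : R) (k : nat) : R :=
  if k is k'.+1 then eps_iter e k' ^+ 2 / 4 else e.

Lemma eps_iter_gt0 e k : 0 < e -> 0 < eps_iter e k.
Proof. by move=> e0; elim: k => //= k IH; rewrite divr_gt0 ?exprn_gt0. Qed.

Lemma eps_iter_le1 e k : 0 < e <= 1 -> eps_iter e k <= 1.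
Proof.
move=> /andP[e0 e1]; elim: k => //= k IH; have := eps_iter_gt0 k e0; nra.
Qed.

Lemma eps_iter_le e j k : 0 < e <= 1 -> (j <= k)%N -> eps_iter e k <= eps_iter e j.
Proof.
move=> e01 /subnK <-; elim: (k - j)%N => //= i IH; apply: le_trans IH.
have := eps_iter_le1 (i + j) e01; case/andP: e01 => /(eps_iter_gt0 (i + j)); nra.
Qed.

(* If the averages over the D i were large on a set of density e of indices, one
   could compose them successively at distinct indices, losing a controlled
   factor each time. *)
Lemma greedy (D : nat -> seq E) r F (mu e : R) p k : 0 < mu -> nrm F <= mu ->
  0 < e <= 1 -> p%:R <= eps_iter e p * r%:R -> (0 < r)%N -> (k <= p)%N ->
  e * mu ^+ 2 <= rmean (iota 0 r) (fun i => nrm (av (D i) F) ^+ 2) ->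
  exists l, [/\ uniq l, size l = k, forall i, i \in l -> (i < r)%N &
    eps_iter e k * mu ^+ 2 <=
      rmean (iota 0 r) (fun i => nrm (av (D i) (avs D l F)) ^+ 2)].
Proof.
move=> mu0 Fmu e01 pr r0 + eF; elim: k => [_|k IH kp]; first by exists [::].
have [l [ul sl lr el]] := IH (ltnW kp).
set G := avs D l F in el *.
have Gmu : nrm G <= mu by apply: le_trans (nrm_avs _ _ _) Fmu.
have Gmu2 : nrm G ^+ 2 <= mu ^+ 2 by rewrite ler_sqr ?nnegrE ?nrm_ge0// ltW.
pose f i := rmean (iota 0 r) (fun j => nrm (av (D j) (av (D i) G)) ^+ 2).
set ek := eps_iter e k in el.
have ek0 : 0 < ek by apply: eps_iter_gt0; case/andP: e01.
have mu20 : 0 < mu ^+ 2 by rewrite exprn_gt0.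
have ef : ek ^+ 2 * mu ^+ 2 <= rmean (iota 0 r) f.
  have := av_cs (iota 0 r) D G.
  set m1 := rmean _ _ in el *; rewrite exchange_rmean -/f => h.
  have f0 : 0 <= rmean (iota 0 r) f.
    by apply: rmean_ge0 => i; apply: rmean_ge0 => j; exact: sqr_ge0.
  have h1 : (ek * mu ^+ 2) ^+ 2 <= m1 ^+ 2.
    have c0 : 0 <= ek * mu ^+ 2 by rewrite mulr_ge0 ?sqr_ge0 ?(ltW ek0).
    by rewrite ler_sqr ?nnegrE// (le_trans c0 el).
  have h2 : m1 ^+ 2 <= mu ^+ 2 * rmean (iota 0 r) f by apply: le_trans h _; rewrite ler_wpM2r.
  rewrite -(ler_pM2l mu20); apply: le_trans h2; apply: le_trans h1.
  by rewrite exprMn; lra.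
have fmu i : f i <= mu ^+ 2.
  apply: rmean_leC => [|j]; first exact: sqr_ge0.
  rewrite ler_sqr ?nnegrE ?nrm_ge0 ?(ltW mu0)//.
  by apply: le_trans (nrm_av _ _) _; apply: le_trans (nrm_av _ _) _.
have [[i [ir il fi]]|nex] := pselect (exists i, [/\ (i < r)%N, i \notin l &
    ek ^+ 2 / 4 * mu ^+ 2 <= f i]).
  exists (i :: l); split => //=; first by rewrite il.
  - by rewrite sl.
  - by move=> j; rewrite inE => /predU1P[->//|/lr].
exfalso; have rk : k%:R <= ek ^+ 2 / 4 * r%:R.
  apply: le_trans (_ : p%:R <= _); first by rewrite ler_nat ltnW.
  by apply: le_trans pr _; rewrite ler_wpM2r// (@eps_iter_le _ k.+1).
suff : rmean (iota 0 r) f <= ek ^+ 2 / 2 * mu ^+ 2.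
  move=> h; have : 0 < ek ^+ 2 * mu ^+ 2 by rewrite mulr_gt0 ?exprn_gt0.
  by move: (le_trans ef h); lra.
have r0' : 0 < r%:R :> R by rewrite ltr0n.
rewrite /rmean size_iota mulrC ler_pdivrMr//.
apply: (@le_trans _ _ (\sum_(i <- iota 0 r) ((i \in l)%:R * mu ^+ 2 + ek ^+ 2 / 4 * mu ^+ 2))).
  rewrite big_seq [leRHS]big_seq; apply: ler_sum => i; rewrite mem_iota/= add0n => ir.
  have [il|il] := boolP (i \in l).
    rewrite mul1r; apply: (le_trans (fmu i)).
    by rewrite lerDl mulr_ge0 ?divr_ge0 ?sqr_ge0.
  rewrite mul0r add0r leNgt; apply/negP => fi; apply: nex; exists i.
  by split=> //; exact: ltW.
rewrite big_split/= -mulr_suml big_const_seq count_predT size_iota iter_addr addr0.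
have -> : \sum_(i <- iota 0 r) (i \in l)%:R = (count (mem l) (iota 0 r))%:R :> R.
  elim: (iota 0 r) => [|j s IHs]; first by rewrite big_nil.
  by rewrite big_cons/= IHs natrD.
have cl : (count (mem l) (iota 0 r))%:R <= k%:R :> R.
  rewrite ler_nat -sl -size_filter; apply: uniq_leq_size; first by rewrite filter_uniq ?iota_uniq.
  by move=> j; rewrite mem_filter => /andP[].
rewrite -mulr_natl; move: rk cl; set c := (count _ _)%:R; nra.
Qed.

(** The contrapositive of [greedy]: a single average is small for most indices as soon as the
    composite of any [p] of them, an average over a much richer set, is small. *)
Lemma mean_av_le (D : nat -> seq E) r F (mu e : R) p : 0 < mu -> nrm F <= mu ->
  0 < e <= 1 -> p%:R <= eps_iter e p * r%:R -> (0 < r)%N ->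
  (forall l, uniq l -> size l = p -> (forall i, i \in l -> (i < r)%N) ->
     nrm (avs D l F) ^+ 2 < eps_iter e p * mu ^+ 2) ->
  rmean (iota 0 r) (fun i => nrm (av (D i) F) ^+ 2) <= e * mu ^+ 2.
Proof.
move=> mu0 Fmu e01 pr r0 h; rewrite leNgt; apply/negP => /ltW /(greedy mu0 Fmu e01 pr r0 (leqnn p)).
move=> [l [ul sl lr]]; have := h l ul sl lr => h1.
rewrite leNgt => /negP; apply; apply: le_lt_trans h1.
apply: rmean_leC => [|i]; first exact: sqr_ge0.
by rewrite ler_sqr ?nnegrE ?nrm_ge0// nrm_av.
Qed.

End L2.

(** * Averages along a circular arc *)

Section CircleParam.
Variable R : realType.
Implicit Types t u : R.

(* The rational parametrization makes the Taylor estimates elementary; t ranges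
   over [0, 1], a quarter of the circle. *)
Definition ccos t : R := (1 - t ^+ 2) / (1 + t ^+ 2).
Definition csin t : R := 2 * t / (1 + t ^+ 2).
Definition dcos t : R := - (4 * t) / (1 + t ^+ 2) ^+ 2.
Definition dsin t : R := 2 * (1 - t ^+ 2) / (1 + t ^+ 2) ^+ 2.

Lemma one_sqr_gt0 t : 0 < 1 + t ^+ 2.
Proof. by have := sqr_ge0 t; lra. Qed.

Lemma one_sqr_neq0 t : 1 + t ^+ 2 != 0.
Proof. by rewrite gt_eqF ?one_sqr_gt0. Qed.

Lemma one_sqr_inv_le1 t k : ((1 + t ^+ 2) ^+ k)^-1 <= 1.
Proof.
by rewrite invf_le1 ?exprn_gt0 ?one_sqr_gt0// exprn_ege1// lerDl sqr_ge0.
Qed.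

Lemma ccos_csin t : ccos t ^+ 2 + csin t ^+ 2 = 1.
Proof. by rewrite /ccos /csin; field; rewrite one_sqr_neq0. Qed.

Lemma div_one_sqr_le t k x c : `|x| <= c -> `|x / (1 + t ^+ 2) ^+ k| <= c.
Proof.
move=> xc; rewrite normrM [`|_^-1|]ger0_norm ?invr_ge0 ?exprn_ge0 ?(ltW (one_sqr_gt0 _))//.
have := one_sqr_inv_le1 t k; have : 0 <= ((1 + t ^+ 2) ^+ k)^-1.
  by rewrite invr_ge0 exprn_ge0 ?(ltW (one_sqr_gt0 _)).
by have := normr_ge0 x; nra.
Qed.

Lemma dcos_le t : 0 <= t <= 1 -> `|dcos t| <= 4.
Proof.
move=> /andP[t0 t1]; apply: div_one_sqr_le.
by rewrite ler_norml; apply/andP; split; lra.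
Qed.

Lemma dsin_le t : 0 <= t <= 1 -> `|dsin t| <= 2.
Proof.
move=> /andP[t0 t1]; apply: div_one_sqr_le.
by rewrite ler_norml; apply/andP; split; nra.
Qed.

(** The remainder is an explicit rational function, divisible by [u ^+ 2], whose denominators are at
    least 1. *)
Lemma ccos_taylor t u : 0 <= t <= 1 -> 0 <= u <= 1 ->
  `|ccos (t + u) - ccos t - u * dcos t| <= 10 * u ^+ 2.
Proof.
move=> /andP[t0 t1] /andP[u0 u1].
have -> : ccos (t + u) - ccos t - u * dcos t =
    (u ^+ 2 * (12 * t ^+ 2 + 8 * t * u - 4) / 2 / (1 + t ^+ 2) ^+ 2)
    / (1 + (t + u) ^+ 2) ^+ 1 * 1.
  by rewrite /ccos /dcos; field; rewrite !one_sqr_neq0.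
rewrite mulr1; apply: div_one_sqr_le; apply: div_one_sqr_le.
rewrite -mulrA normrM ger0_norm ?sqr_ge0// mulrC ler_wpM2r ?sqr_ge0//.
by rewrite ler_norml; apply/andP; split; nra.
Qed.

Lemma csin_taylor t u : 0 <= t <= 1 -> 0 <= u <= 1 ->
  `|csin (t + u) - csin t - u * dsin t| <= 10 * u ^+ 2.
Proof.
move=> /andP[t0 t1] /andP[u0 u1].
have -> : csin (t + u) - csin t - u * dsin t =
    (u ^+ 2 * - (2 * t * (1 + t ^+ 2) + 2 * (1 - t ^+ 2) * (2 * t + u)) / (1 + t ^+ 2) ^+ 2)
    / (1 + (t + u) ^+ 2) ^+ 1.
  by rewrite /csin /dsin; field; rewrite !one_sqr_neq0.
apply: div_one_sqr_le; apply: div_one_sqr_le.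
rewrite normrM ger0_norm ?sqr_ge0// mulrC ler_wpM2r ?sqr_ge0// normrN.
have h1 : 0 <= t * (1 + t ^+ 2) <= 2 by apply/andP; split; nra.
have h2 : 0 <= (1 - t ^+ 2) * (2 * t + u) <= 3.
  have h3 : 0 <= 1 - t ^+ 2 <= 1 by apply/andP; split; nra.
  have h4 : 0 <= 2 * t + u <= 3 by apply/andP; split; lra.
  case/andP: h3 => h3 h3'; case/andP: h4 => h4 h4'; rewrite mulr_ge0//=.
  by rewrite -[3]mul1r ler_pM.
by rewrite ler_norml; apply/andP; split; lra.
Qed.

(** Transversality of the tangents at [t] and [u]: the determinant is [u - t] times a factor which
    is at least 8 / 16 on the quarter of circle. *)
Lemma dcos_dsin_det t u : 0 <= t <= 1 -> 0 <= u <= 1 ->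
  `|u - t| / 2 <= `|dcos t * dsin u - dsin t * dcos u|.
Proof.
move=> /andP[t0 t1] /andP[u0 u1].
have -> : dcos t * dsin u - dsin t * dcos u =
    (u - t) * (8 * (1 + t * u) / ((1 + t ^+ 2) ^+ 2 * (1 + u ^+ 2) ^+ 2)).
  by rewrite /dcos /dsin; field; rewrite !one_sqr_neq0.
rewrite normrM ler_wpM2l// ger0_norm; last first.
  by rewrite divr_ge0 ?mulr_ge0 ?exprn_ge0 ?(ltW (one_sqr_gt0 _))// addr_ge0 ?mulr_ge0.
rewrite ler_pdivlMr ?mulr_gt0 ?exprn_gt0 ?one_sqr_gt0//.
have h (v : R) : 0 <= v -> v <= 1 -> 0 <= (1 + v ^+ 2) ^+ 2 <= 4.
  by move=> v0 v1; rewrite sqr_ge0/=; have : 0 <= v ^+ 2 <= 1; [apply/andP; split; nra|move=> /andP[]; nra].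
have /andP[a0 a4] := h t t0 t1; have /andP[b0 b4] := h u u0 u1.
have tu : 0 <= t * u by rewrite mulr_ge0.
have ab : (1 + t ^+ 2) ^+ 2 * (1 + u ^+ 2) ^+ 2 <= 4 * 4 by rewrite ler_pM.
by lra.
Qed.

End CircleParam.

Section Circle.
Variables (R : realType) (E : normedModType R) (H : l2space R E).
Implicit Types (F G : H) (p q w : E).

Definition cur (a : R) p q (t : R) : E := (a * ccos t) *: p + (a * csin t) *: q.
Definition dcur (a : R) p q (t : R) : E := (a * dcos t) *: p + (a * dsin t) *: q.

Definition grid2 (eta : R) p q (n : nat) : seq E := prog [:: eta *: p; eta *: q] n.

Definition tang (a : R) p q (N n : nat) (t : R) : seq E :=
  prog1 (N%:R^-1 *: dcur a p q t) n.

Lemma mem_prog_cons g gs n w : w \in prog (g :: gs) n ->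
  exists k d, [/\ (k < n)%N, d \in prog gs n & w = g *+ k + d].
Proof.
by case/allpairsP => -[k d] /= []; rewrite mem_iota add0n => kn dp ->; exists k, d.
Qed.

Lemma lin_comb2 (x y m c1 s1 c2 s2 : R) p q :
  x *: (m *: (c1 *: p + s1 *: q)) + y *: (m *: (c2 *: p + s2 *: q)) =
  (x * m * c1 + y * m * c2) *: p + (x * m * s1 + y * m * s2) *: q.
Proof. by rewrite !scalerDr !scalerA addrACA -!scalerDl. Qed.

Lemma lin_combB (u c1 s1 c2 s2 c3 s3 : R) p q :
  c1 *: p + s1 *: q - (c2 *: p + s2 *: q) - u *: (c3 *: p + s3 *: q) =
  (c1 - c2 - u * c3) *: p + (s1 - s2 - u * s3) *: q.
Proof.
rewrite scalerDr !scalerA !opprD (addrACA (c1 *: p)) (addrACA (c1 *: p - _)).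
by rewrite !scalerBl.
Qed.

Lemma sub_addK2 (V : zmodType) (x a b : V) : x = a + b + (x - a - b).
Proof. by rewrite addrC -[x - a - b]addrA -opprD subrK. Qed.

Lemma mem_grid2 (eta : R) p q n w : w \in grid2 eta p q n ->
  exists k k', [/\ (k < n)%N, (k' < n)%N & w = (eta *: p) *+ k + (eta *: q) *+ k'].
Proof.
rewrite /grid2 => wp; have [k [d [kn]]] := mem_prog_cons wp.
move=> dp; have [k' [d' [kn']]] := mem_prog_cons dp.
rewrite inE => /eqP -> -> ->; exists k, k'; split => //.
by rewrite addr0.
Qed.

Lemma sh_grid2 (eta x y c rho b : R) p q n F : 0 < eta -> `|p| <= 1 -> `|q| <= 1 ->
  `|x| <= c * eta -> `|y| <= c * eta -> 2 * eta <= rho ->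
  (forall w, `|w| <= rho -> nrm (sh w F - F) <= b) ->
  nrm (sh (x *: p + y *: q) (av (grid2 eta p q n) F) - av (grid2 eta p q n) F)
    <= 4 * (c + 1) / n%:R * nrm F + b.
Proof.
move=> eta0 p1 q1 xc yc etar Fb.
have := @sh_prog R E H [:: (x / eta, eta *: p); (y / eta, eta *: q)] n F c b.
rewrite /= !big_cons !big_nil/= !addr0 !scalerA !divfK ?gt_eqF// -/(grid2 _ _ _ _).
have -> : 2 * (2 * (c + 1) / n%:R) = 4 * (c + 1) / n%:R by ring.
apply.
- move=> z; rewrite !inE => /orP[]/eqP -> /=;
  by rewrite normrM normfV [`|eta|]gtr0_norm// ler_pdivrMr.
- move=> w wr; apply: Fb; apply: le_trans wr _; apply: le_trans etar.
  by rewrite !normrZ gtr0_norm//; nra.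
Qed.

Lemma sh_grid2_small (eta rho b : R) p q n F : 0 < eta -> `|p| <= 1 -> `|q| <= 1 ->
  0 <= b ->
  2 * (n%:R * eta) <= rho -> (forall w, `|w| <= rho -> nrm (sh w F - F) <= b) ->
  (0 < n)%N ->
  nrm (F - av (grid2 eta p q n) F) <= b.
Proof.
move=> eta0 p1 q1 b0 nr Fb n0.
have s0 : (0 < size (grid2 eta p q n))%N by rewrite size_prog expn_gt0 n0.
have h (k : nat) : (k < n)%N -> k%:R * eta <= n%:R * eta.
  by move=> kn; rewrite ler_pM2r// ler_nat ltnW.
have kk (z : E) k : `|z| <= 1 -> (k < n)%N -> `|(eta *: z) *+ k| <= n%:R * eta.
  move=> z1 /h kn; rewrite -scaler_nat !normrZ ger0_norm// gtr0_norm//.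
  by apply: le_trans kn; rewrite mulrA ler_piMr// mulr_ge0// ltW.
rewrite -[X in X - _](avg_cst F s0) -avgB.
apply: le_trans (nrm_avg _ _) _.
apply: (@le_trans _ _ (rmean (grid2 eta p q n) (fun=> b))); last exact: rmean_cst_le.
apply: rmean_le_in => d /mem_grid2[k [k' [kn kn' ->]]].
rewrite nrmBC; apply: Fb.
apply: le_trans (ler_normD _ _) _; apply: le_trans nr; rewrite mulr_natl mulr2n.
by apply: lerD; exact: kk.
Qed.

(* For w in a box of side n2 eta, Cramer's rule writes w as a combination of two
   tangent steps; n2 eta N / (a tau) bounds the coefficients. *)
Lemma tangent_pair (a eta rho b : R) p q N n n2 (t u tau : R) F :
  0 < a -> 0 < eta -> (0 < N)%N -> (0 < n2)%N -> 0 <= b ->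
  `|p| <= 1 -> `|q| <= 1 ->
  0 <= t <= 1 -> 0 <= u <= 1 -> 0 < tau -> tau <= `|u - t| ->
  12 * (a / N%:R) <= rho ->
  (forall w, `|w| <= rho -> nrm (sh w F - F) <= b) ->
  nrm (av (tang a p q N n t) (av (tang a p q N n u)
    (F - av (grid2 eta p q n2) F))) <=
    4 * (12 * (n2%:R * eta * N%:R / (a * tau)) + 1) / n%:R * nrm F + b.
Proof.
move=> a0 eta0 N0 n20 b0 p1 q1 t01 u01 tau0 taut aN Fb.
have N0' : 0 < N%:R :> R by rewrite ltr0n.
set gt := N%:R^-1 *: dcur a p q t; set gu := N%:R^-1 *: dcur a p q u.
set C := 12 * (n2%:R * eta * N%:R / (a * tau)).
have s0 : (0 < size (grid2 eta p q n2))%N by rewrite size_prog expn_gt0 n20.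
have LE G : av (tang a p q N n t) (av (tang a p q N n u) G) = av (prog [:: gt; gu] n) G.
  by rewrite !av_prog_cons av_prog0.
rewrite LE -[X in X - _](avg_cst F s0) -avgB avg_av.
apply: le_trans (nrm_avg _ _) _.
set B := (X in _ <= X).
have B0 : 0 <= B.
  rewrite addr_ge0// mulr_ge0 ?nrm_ge0// divr_ge0// mulr_ge0// addr_ge0//.
  by rewrite mulr_ge0// divr_ge0 ?mulr_ge0// ltW.
apply: (@le_trans _ _ (rmean (grid2 eta p q n2) (fun=> B))); last exact: rmean_cst_le.
apply: rmean_le_in => d /mem_grid2[k [k' [kn kn' ->]]].
rewrite avB nrmBC -sh_av.
set det := dcos t * dsin u - dsin t * dcos u.
have detn : tau / 2 <= `|det|.
  by apply: le_trans (dcos_dsin_det t01 u01); rewrite ler_pM2r ?invr_gt0.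
have det0 : det != 0 by rewrite -normr_gt0; apply: lt_le_trans detn; rewrite divr_gt0.
pose x := N%:R / a * (k%:R * eta * dsin u - k'%:R * eta * dcos u) / det.
pose y := N%:R / a * (k'%:R * eta * dcos t - k%:R * eta * dsin t) / det.
have wE : (eta *: p) *+ k + (eta *: q) *+ k' = x *: gt + y *: gu.
  have D : dcos t * dsin u - dsin t * dcos u != 0 := det0.
  rewrite lin_comb2 -[(eta *: p) *+ k]scaler_nat -[(eta *: q) *+ k']scaler_nat 2!scalerA.
  by congr (_ *: _ + _ *: _); rewrite /x /y /det; field; rewrite (gt_eqF a0) (gt_eqF N0') D.
have coef (c1 c2 : R) (k1 k2 : nat) : `|c1| <= 4 -> `|c2| <= 2 -> (k1 < n2)%N -> (k2 < n2)%N ->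
    forall z, `|z| = `|k1%:R * eta * c1 - k2%:R * eta * c2| ->
    `|N%:R / a * z / det| <= C.
  move=> h1 h2 h3 h4 z zE; rewrite !normrM !normfV zE (gtr0_norm a0) (gtr0_norm N0').
  have -> : C = N%:R / a * (6 * (n2%:R * eta)) / (tau / 2).
    by rewrite /C; field; rewrite !gt_eqF.
  apply: ler_pM; rewrite ?mulr_ge0 ?invr_ge0 ?(ltW a0)// ?(ltW N0')//.
    rewrite ler_wpM2l ?divr_ge0 ?(ltW a0) ?(ltW N0')//.
    apply: le_trans (ler_normB _ _) _; rewrite !normrM (gtr0_norm eta0) !normr_nat.
    have e1 : k1%:R * eta <= n2%:R * eta by rewrite ler_pM2r// ler_nat ltnW.
    have e2 : k2%:R * eta <= n2%:R * eta by rewrite ler_pM2r// ler_nat ltnW.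
    have : k1%:R * eta * `|c1| <= n2%:R * eta * 4 by rewrite ler_pM// mulr_ge0// ltW.
    have : k2%:R * eta * `|c2| <= n2%:R * eta * 2 by rewrite ler_pM// mulr_ge0// ltW.
    by lra.
  by rewrite lef_pV2 ?posrE ?divr_gt0// normr_gt0.
have := @sh_prog R E H [:: (x, gt); (y, gu)] n F C b.
rewrite /= !big_cons !big_nil/= !addr0 -wE.
have -> : 2 * (2 * (C + 1) / n%:R) = 4 * (C + 1) / n%:R by ring.
apply.
- move=> z; rewrite !inE => /orP[]/eqP -> /=.
    by apply: (coef (dcos u) (dsin u) k' k) => //; rewrite ?dcos_le ?dsin_le// distrC.
  by apply: (coef (dcos t) (dsin t) k' k) => //; rewrite ?dcos_le ?dsin_le.
- move=> w wr; apply: Fb; apply: le_trans wr _; apply: le_trans aN.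
  have hd (v : R) : 0 <= v <= 1 -> `|N%:R^-1 *: dcur a p q v| <= 6 * (a / N%:R).
    move=> v01; rewrite normrZ gtr0_norm ?invr_gt0// mulrC mulrA ler_pM2r ?invr_gt0//.
    rewrite /dcur; have := dcos_le v01; have := dsin_le v01.
    move: (dcos v) (dsin v) => c s h1 h2.
    apply: le_trans (ler_normD _ _) _; rewrite !normrZ ?normrM (gtr0_norm a0).
    have : a * `|c| * `|p| <= a * 4 * 1 by rewrite !ler_pM// ?mulr_ge0// ?(ltW a0)// ler_pM2l.
    have : a * `|s| * `|q| <= a * 2 * 1 by rewrite !ler_pM// ?mulr_ge0// ?(ltW a0)// ler_pM2l.
    by lra.
  by have := hd _ t01; have := hd _ u01; rewrite -/gt -/gu; lra.
Qed.


Definition carc (a : R) p q N F : H :=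
  avg (iota 0 N) (fun i => sh (cur a p q (i%:R / N%:R)) F).

Lemma nrm_carc a p q N F : nrm (carc a p q N F) <= nrm F.
Proof. by apply: nrm_avg_le => [|i]; rewrite ?nrm_ge0// nrm_sh. Qed.

Lemma carcB a p q N F G : carc a p q N (F - G) = carc a p q N F - carc a p q N G.
Proof. by rewrite -avgB; apply: eq_avg => i; rewrite shB. Qed.

(** Shifting the [N] points by [k < n] steps changes the average by a multiple of [n / N]. After
    averaging over [k], the point [i + k] of the curve is replaced by its first order expansion at
    [i], at the cost [e], and the average over [k] becomes one over a progression on the tangent. *)
Lemma carc_arcs (a e : R) p q N n F : (0 < N)%N -> (0 < n)%N -> (n <= N)%N -> 0 <= e ->
  (forall t u, 0 <= t <= 1 -> 0 <= u <= n%:R / N%:R ->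
     nrm (sh (cur a p q (t + u) - cur a p q t - u *: dcur a p q t) F - F) <= e) ->
  nrm (carc a p q N F) <= 2 * (n%:R / N%:R) * nrm F + e +
    rmean (iota 0 N) (fun i => nrm (av (tang a p q N n (i%:R / N%:R)) F)).
Proof.
move=> N0 n0 nN e0 he; have N0' : 0 < N%:R :> R by rewrite ltr0n.
pose A k := avg (iota 0 N) (fun i => sh (cur a p q ((i + k)%:R / N%:R)) F).
pose B k := avg (iota 0 N) (fun i => sh (cur a p q (i%:R / N%:R) +
  (N%:R^-1 *: dcur a p q (i%:R / N%:R)) *+ k) F).
pose C := avg (iota 0 N) (fun i => sh (cur a p q (i%:R / N%:R))
    (av (tang a p q N n (i%:R / N%:R)) F)).
have s0 : (0 < size (iota 0 n))%N by rewrite size_iota.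
have h1 : nrm (carc a p q N F - avg (iota 0 n) A) <= 2 * (n%:R / N%:R) * nrm F.
  rewrite -[X in X - _](avg_cst _ s0) -avgB.
  apply: le_trans (nrm_avg _ _) _.
  set c := 2 * _ * _.
  have c0 : 0 <= c by rewrite !mulr_ge0 ?nrm_ge0 ?invr_ge0.
  apply: (@le_trans _ _ (rmean (iota 0 n) (fun=> c))); last exact: rmean_cst_le.
  apply: rmean_le_in => k; rewrite mem_iota add0n => /andP[_ kn].
  rewrite nrmBC.
  have := @shift_avg R E H (fun i => sh (cur a p q (i%:R / N%:R)) F) N k (nrm F) (nrm_ge0 F).
  move=> /(_ (fun i => _)); rewrite -/(carc _ _ _ _ _) => h.
  apply: le_trans (h _) _; first by move=> i; rewrite nrm_sh.
  have -> : 2 * k%:R * nrm F / N%:R = k%:R * (2 * nrm F / N%:R) by ring.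
  have -> : c = n%:R * (2 * nrm F / N%:R) by rewrite /c; ring.
  rewrite ler_wpM2r ?divr_ge0 ?mulr_ge0 ?nrm_ge0//.
  by rewrite ler_nat ltnW.
have h2 : nrm (avg (iota 0 n) A - avg (iota 0 n) B) <= e.
  rewrite -avgB; apply: le_trans (nrm_avg _ _) _.
  apply: (@le_trans _ _ (rmean (iota 0 n) (fun=> e))); last exact: rmean_cst_le.
  apply: rmean_le_in => k; rewrite mem_iota add0n => /andP[_ kn].
  rewrite -avgB; apply: le_trans (nrm_avg _ _) _.
  apply: (@le_trans _ _ (rmean (iota 0 N) (fun=> e))); last exact: rmean_cst_le.
  apply: rmean_le_in => i; rewrite mem_iota add0n => /andP[_ iN].
  set t := i%:R / N%:R; set v := cur a p q t + _.
  have -> : cur a p q ((i + k)%:R / N%:R) = v +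
     (cur a p q (t + k%:R / N%:R) - cur a p q t - (k%:R / N%:R) *: dcur a p q t).
    rewrite /v /t natrD mulrDl -scaler_nat scalerA.
    exact: sub_addK2.
  rewrite sh_add -shB nrm_sh; apply: he.
    by rewrite /t divr_ge0//= ler_pdivrMr// mul1r ler_nat ltnW.
  by rewrite divr_ge0//= ler_pM2r ?invr_gt0// ler_nat ltnW.
have h3 : avg (iota 0 n) B = C.
  rewrite exchange_avg; apply: eq_avg => i; rewrite /av sh_avg /tang.
  rewrite /avg size_map big_map size_iota; congr (_ *: _); apply: eq_bigr => k _.
  by rewrite -sh_add.
have h4 : nrm C <= rmean (iota 0 N) (fun i => nrm (av (tang a p q N n (i%:R / N%:R)) F)).
  by apply: le_trans (nrm_avg _ _) _; apply: rmean_le => i; rewrite nrm_sh.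
rewrite h3 in h2.
have := nrmD (carc a p q N F - C) C; rewrite subrK.
have := nrm_dist (avg (iota 0 n) A) (carc a p q N F) C.
by lra.
Qed.

(* The curve is cut into arcs of n points, each close to a chord, so that av_cs
   reduces to pairs of chords; at parameters t0 steps apart these are transversal and
   tangent_pair applies. *)
Lemma stage (a eta rho b y B mu : R) p q N n t0 n1 n2 F :
  0 < a -> 0 < eta -> (0 < N)%N -> (0 < n)%N -> (n <= N)%N -> (0 < t0)%N ->
  (0 < n1)%N -> (n1 <= n2)%N -> `|p| <= 1 -> `|q| <= 1 -> 0 < y <= 1 -> 1 <= B ->
  n%:R / N%:R = (y ^+ 4) ^+ 6 -> t0%:R / N%:R = y ^+ 4 ->
  n2%:R * eta = a * (y ^+ 4) ^+ 8 -> n2%:R * eta <= B * (n1%:R * eta) ->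
  n1%:R^-1 <= y ^+ 4 -> n%:R^-1 <= y ^+ 4 -> 2 * eta <= rho -> 12 * (a / N%:R) <= rho ->
  0 <= b <= y ^+ 4 * mu -> 0 < mu -> nrm F <= mu ->
  (forall w, `|w| <= rho -> nrm (sh w F - F) <= b) ->
  nrm (carc a p q N (av (grid2 eta p q n1) F - av (grid2 eta p q n2) F))
    <= (80 * B + 123) * y * mu.
Proof.
move=> a0 eta0 N0 n0 nN t00 n10 n12 p1 q1 /andP[y0 y1] B1 nz tz n2z n21 n1z nz' etar aN
  /andP[b0 bz] mu0 Fmu Fb.
(* In units of [a]: arcs of length about [z ^+ 6] leave their tangents by about [z ^+ 12],
   negligible for grids of side about [z ^+ 8]; two tangents at parameters [z] apart reach about
   [z ^+ 7] in every direction of the plane, which is [z^-1] times that side. The fourth power is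
   there because [av_cs] and [rmean_sqr] each cost a square root. *)
have [z zE] : {z | z = y ^+ 4} by exists (y ^+ 4).
rewrite -zE in nz tz n2z n1z nz' bz.
have B0 : 0 <= B by apply: le_trans B1.
have z0 : 0 < z by rewrite zE exprn_gt0.
have z1 : z <= 1 by rewrite zE exprn_ile1// ltW.
have zk k : z ^+ k <= 1 by rewrite exprn_ile1// ltW.
have zy : z <= y by rewrite -[leRHS]mulr1 zE exprS ler_pM2l// exprn_ile1// ltW.
have zkS k : z ^+ k.+1 <= z by rewrite exprS -[leRHS]mulr1 ler_pM2l.
have N0' : 0 < N%:R :> R by rewrite ltr0n.
have n0' : 0 < n%:R :> R by rewrite ltr0n.
have n10' : 0 < n1%:R :> R by rewrite ltr0n.
have n20 : (0 < n2)%N by apply: leq_trans n12.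
have n20' : 0 < n2%:R :> R by rewrite ltr0n.
have F0 := nrm_ge0 F.
set v := _ - _.
have v2 : nrm v <= 2 * mu.
  have := nrmB (av (grid2 eta p q n1) F) (av (grid2 eta p q n2) F).
  have := nrm_av (grid2 eta p q n1) F; have := nrm_av (grid2 eta p q n2) F.
  by rewrite -/v; lra.
pose e := (80 * B * z + 10 * z) * mu.
have e0 : 0 <= e by rewrite /e mulr_ge0 ?addr_ge0 ?mulr_ge0// ltW.
have he (t u : R) : 0 <= t <= 1 -> 0 <= u <= n%:R / N%:R ->
    nrm (sh (cur a p q (t + u) - cur a p q t - u *: dcur a p q t) v - v) <= e.
  move=> t01 /andP[u0 un].
  have u1 : u <= 1 by apply: le_trans un _; rewrite ler_pdivrMr// mul1r ler_nat.
  have u01 : 0 <= u <= 1 by rewrite u0.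
  pose x1 := a * (ccos (t + u) - ccos t - u * dcos t).
  pose x2 := a * (csin (t + u) - csin t - u * dsin t).
  have -> : cur a p q (t + u) - cur a p q t - u *: dcur a p q t = x1 *: p + x2 *: q.
    rewrite /cur /dcur lin_combB.
    by congr (_ *: _ + _ *: _); rewrite /x1 /x2; ring.
  pose c := 10 * a * (z ^+ 6) ^+ 2 / eta.
  have ce : c * eta = a * (10 * (z ^+ 6) ^+ 2) by rewrite /c; field; rewrite gt_eqF.
  have uz : u ^+ 2 <= (z ^+ 6) ^+ 2.
    by rewrite ler_sqr ?nnegrE// -?nz// exprn_ge0// ltW.
  have x1c : `|x1| <= c * eta.
    rewrite ce /x1 normrM (gtr0_norm a0) ler_pM2l//.
    by apply: le_trans (ccos_taylor t01 u01) _; rewrite ler_pM2l.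
  have x2c : `|x2| <= c * eta.
    rewrite ce /x2 normrM (gtr0_norm a0) ler_pM2l//.
    by apply: le_trans (csin_taylor t01 u01) _; rewrite ler_pM2l.
  have h1 := @sh_grid2 eta x1 x2 c rho b p q n1 F eta0 p1 q1 x1c x2c etar Fb.
  have h2 := @sh_grid2 eta x1 x2 c rho b p q n2 F eta0 p1 q1 x1c x2c etar Fb.
  have c0 : 0 <= c by rewrite /c divr_ge0 ?mulr_ge0 ?sqr_ge0 ?(ltW a0)// ltW.
  have cn : (c + 1) / n1%:R <= 10 * B * z + z.
    rewrite mulrDl mul1r; apply: lerD => //.
    rewrite /c -mulrA -invfM ler_pdivrMr ?mulr_gt0//.
    apply: le_trans (_ : 10 * z * (B * (n1%:R * eta)) <= _); last by rewrite le_eqVlt; apply/orP; left; apply/eqP; ring.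
    apply: le_trans (_ : 10 * z * (n2%:R * eta) <= _); last by rewrite ler_wpM2l ?mulr_ge0// ltW.
    rewrite n2z; have -> : 10 * z * (a * z ^+ 8) = 10 * a * z ^+ 9 by ring.
    by rewrite ler_wpM2l ?mulr_ge0 ?(ltW a0)// -exprM ler_wiXn2l// ltW.
  have cn2 : (c + 1) / n2%:R <= (c + 1) / n1%:R.
    by rewrite ler_wpM2l ?addr_ge0// lef_pV2 ?posrE// ler_nat.
  have hn k : (c + 1) / k%:R <= 10 * B * z + z ->
      4 * (c + 1) / k%:R * nrm F + b <= (40 * B * z + 5 * z) * mu.
    move=> hk; have hk' : 4 * (c + 1) / k%:R <= 4 * (10 * B * z + z).
      by rewrite -mulrA ler_pM2l.
    have : 4 * (c + 1) / k%:R * nrm F <= 4 * (10 * B * z + z) * mu.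
      by rewrite ler_pM// divr_ge0// mulr_ge0// addr_ge0.
    by move: bz; clear -H; lra.
  rewrite /v shB !opprB; set w := x1 *: p + _ in h1 h2 *.
  set P1 := av (grid2 eta p q n1) F in h1 *; set P2 := av (grid2 eta p q n2) F in h2 *.
  have -> : sh w P1 - sh w P2 + (P2 - P1) = (sh w P1 - P1) - (sh w P2 - P2).
    by rewrite opprB addrACA [RHS]addrACA [- sh _ _ - _]addrC.
  apply: le_trans (nrmB _ _) _.
  have := hn _ cn; have := hn _ (le_trans cn2 cn).
  by rewrite /e; move: h1 h2; clear -H; lra.
have := @carc_arcs a e p q N n v N0 n0 nN e0 he.
set X := rmean _ _ => hX.
(* Twice 53, once for each of the two grids in [v], where 53 = 4 * 13 + 1 comes from
   [tangent_pair]. *)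
have [c cE] : {c : R | c = 106} by exists 106.
have c2 : 2 <= c by rewrite cE; clear -H; lra.
suff X15 : X <= (3 + c) * y * mu.
  apply: le_trans hX _; rewrite nz.
  have : 2 * z ^+ 6 * nrm v <= 2 * z * (2 * mu).
    by rewrite ler_pM ?nrm_ge0// ?mulr_ge0 ?exprn_ge0 ?(ltW z0)// ler_pM2l.
  have : z * mu <= y * mu by rewrite ler_pM2r.
  have : B * z * mu <= B * y * mu by rewrite ler_pM2r// ler_pM2l//; lra.
  by rewrite /e; move: X15; rewrite cE; clear -H; lra.
pose f i := nrm (av (tang a p q N n (i%:R / N%:R)) v).
pose Y := rmean (iota 0 N) (fun i => f i ^+ 2).
have XY : X ^+ 2 <= Y by exact: rmean_sqr.
have X0 : 0 <= X by apply: rmean_ge0 => i; exact: nrm_ge0.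
have Y0 : 0 <= Y by apply: rmean_ge0 => i; exact: sqr_ge0.
suff Y213 : Y <= 2 * (3 + c) * (y ^+ 2 * mu ^+ 2).
  have ymu : 0 <= (3 + c) * y * mu by rewrite !mulr_ge0 ?(ltW y0) ?(ltW mu0)//; lra.
  rewrite -ler_sqr ?nnegrE//; apply: le_trans XY _; apply: le_trans Y213 _.
  have -> : ((3 + c) * y * mu) ^+ 2 = (3 + c) ^+ 2 * (y ^+ 2 * mu ^+ 2) by ring.
  apply: ler_wpM2r; first by apply: mulr_ge0; exact: sqr_ge0.
  by rewrite expr2; apply: ler_wpM2r; move: c2; clear -H; lra.
have ymu0 : 0 <= y ^+ 2 * mu ^+ 2 by rewrite mulr_ge0 ?sqr_ge0.
have := av_cs (iota 0 N) (fun i => tang a p q N n (i%:R / N%:R)) v.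
rewrite -/f -/Y; set Z := rmean _ _ => YZ.
suff Z11 : Z <= (8 + c ^+ 2) * (z * mu ^+ 2).
  have h213 : 0 <= 2 * (3 + c) * (y ^+ 2 * mu ^+ 2).
    by rewrite mulr_ge0//; move: c2; clear -H; lra.
  rewrite -ler_sqr ?nnegrE//; apply: le_trans YZ _.
  have v4 : nrm v ^+ 2 <= 4 * mu ^+ 2.
    have -> : 4 * mu ^+ 2 = (2 * mu) ^+ 2 by ring.
    by rewrite ler_sqr ?nnegrE ?nrm_ge0// mulr_ge0// ltW.
  have Z0 : 0 <= Z by apply: rmean_ge0 => i; apply: rmean_ge0 => j; exact: sqr_ge0.
  apply: le_trans (_ : 4 * mu ^+ 2 * ((8 + c ^+ 2) * (z * mu ^+ 2)) <= _).
    by rewrite ler_pM ?sqr_ge0.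
  have mu2 := sqr_ge0 mu.
  have -> : 4 * mu ^+ 2 * ((8 + c ^+ 2) * (z * mu ^+ 2)) =
      4 * (z * (mu ^+ 2 * mu ^+ 2)) * (8 + c ^+ 2) by ring.
  have -> : (2 * (3 + c) * (y ^+ 2 * mu ^+ 2)) ^+ 2 =
      4 * (z * (mu ^+ 2 * mu ^+ 2)) * (3 + c) ^+ 2 by rewrite zE; ring.
  have h0 : 0 <= 4 * (z * (mu ^+ 2 * mu ^+ 2)).
    by rewrite mulr_ge0// mulr_ge0 ?(ltW z0)// mulr_ge0.
  by rewrite ler_wpM2l// sqrrD; move: c2; clear -H; lra.
have zmu0 : 0 <= z * mu ^+ 2 by rewrite mulr_ge0 ?sqr_ge0 ?(ltW z0).
(* Close pairs are bounded trivially: their proportion is at most [2 * z]. *)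
pose close i j := (i < j + t0)%N && (j < i + t0)%N.
have LL i j : (i < N)%N -> (j < N)%N ->
   nrm (av (tang a p q N n (i%:R / N%:R)) (av (tang a p q N n (j%:R / N%:R)) v)) ^+ 2 <=
   (close i j)%:R * (4 * mu ^+ 2) + c ^+ 2 * (z * mu ^+ 2).
  move=> iN jN; set u := av _ (av _ v).
  have u2 : nrm u <= 2 * mu by apply: le_trans v2; do 2 apply: le_trans (nrm_av _ _) _.
  have u0 := nrm_ge0 u.
  have [cij|cij] := boolP (close i j).
    have -> : true%:R * (4 * mu ^+ 2) = (2 * mu) ^+ 2 :> R by rewrite mul1r; ring.
    apply: le_trans (_ : (2 * mu) ^+ 2 <= _); last first.
      by rewrite lerDl; apply: mulr_ge0; rewrite ?sqr_ge0.
    by rewrite ler_sqr ?nnegrE// mulr_ge0// ltW.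
  rewrite mul0r add0r.
  have t01 k : (k < N)%N -> 0 <= (k%:R / N%:R : R) <= 1.
    by move=> kN; rewrite divr_ge0//= ler_pdivrMr// mul1r ler_nat ltnW.
  have far : z <= `|j%:R / N%:R - i%:R / N%:R|.
    rewrite -tz -mulrBl normrM normfV [`|N%:R|]gtr0_norm// ler_pM2r ?invr_gt0//.
    move: cij; rewrite /close negb_and -!leqNgt => /orP[]; rewrite -(ler_nat R) natrD => h.
      by rewrite distrC; apply: le_trans (ler_norm _); move: h; clear -H; lra.
    by apply: le_trans (ler_norm _); move: h; clear -H; lra.
  have C n3 : (0 < n3)%N -> n3%:R * eta <= a * z ^+ 8 ->
      4 * (12 * (n3%:R * eta * N%:R / (a * z)) + 1) / n%:R * nrm F + b <= 53 * z * mu.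
    move=> n30 n3z.
    have : (12 * (n3%:R * eta * N%:R / (a * z)) + 1) / n%:R <= 13 * z.
      rewrite mulrDl mul1r; have -> : 13 * z = 12 * z + z by ring.
      apply: lerD => //; rewrite -mulrA ler_pM2l// ler_pdivrMr// ler_pdivrMr ?mulr_gt0//.
      have nE : n%:R = z ^+ 6 * N%:R by rewrite -nz divfK// gt_eqF.
      have -> : z * n%:R * (a * z) = a * z ^+ 8 * N%:R by rewrite nE; ring.
      by rewrite ler_pM2r.
    set c3 := (_ + 1) / _ => c13; have -> : 4 * (12 * (n3%:R * eta * N%:R / (a * z)) + 1) / n%:R = 4 * c3.
      by rewrite /c3 [RHS]mulrA.
    have c0 : 0 <= c3 by rewrite /c3 divr_ge0// addr_ge0// mulr_ge0// divr_ge0 ?mulr_ge0 ?(ltW eta0) ?(ltW a0) ?(ltW z0).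
    move: c3 c13 c0 => c3 c13 c0.
    have : 4 * c3 * nrm F <= 4 * (13 * z) * mu by rewrite ler_pM ?nrm_ge0 ?mulr_ge0 ?ler_pM2l.
    by move: bz; clear -H; lra.
  have n1z8 : n1%:R * eta <= a * z ^+ 8.
    by rewrite -n2z ler_pM2r// ler_nat.
  have h1 := @tangent_pair a eta rho b p q N n n1 _ _ z F a0 eta0 N0 n10 b0 p1 q1 (t01 i iN) (t01 j jN) z0 far aN Fb.
  have h2 := @tangent_pair a eta rho b p q N n n2 _ _ z F a0 eta0 N0 n20 b0 p1 q1 (t01 i iN) (t01 j jN) z0 far aN Fb.
  have u106 : nrm u <= c * z * mu.
    rewrite cE.
    have -> : u = av (tang a p q N n (i%:R / N%:R)) (av (tang a p q N n (j%:R / N%:R)) (F - av (grid2 eta p q n2) F))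
       - av (tang a p q N n (i%:R / N%:R)) (av (tang a p q N n (j%:R / N%:R)) (F - av (grid2 eta p q n1) F)).
      by rewrite -!avB opprB addrC addrA subrK.
    apply: le_trans (nrmB _ _) _.
    have n2z8 : n2%:R * eta <= a * z ^+ 8 by rewrite n2z.
    have h1' := le_trans h1 (C _ n10 n1z8); have h2' := le_trans h2 (C _ n20 n2z8).
    have -> : 106 * z * mu = 53 * z * mu + 53 * z * mu by ring.
    exact: lerD.
  apply: le_trans (_ : (c * z * mu) ^+ 2 <= _).
    by rewrite ler_sqr ?nnegrE// !mulr_ge0 ?(ltW z0) ?(ltW mu0)//; move: c2; clear -H; lra.
  have -> : (c * z * mu) ^+ 2 = c ^+ 2 * (z ^+ 2 * mu ^+ 2) by ring.
  by rewrite ler_wpM2l ?sqr_ge0// ler_wpM2r ?sqr_ge0.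
apply: (@le_trans _ _ (rmean (iota 0 N) (fun=> (8 + c ^+ 2) * (z * mu ^+ 2)))); last first.
  by apply: rmean_cst_le; apply: mulr_ge0; rewrite ?addr_ge0 ?sqr_ge0.
apply: rmean_le_in => i; rewrite mem_iota add0n => /andP[_ iN].
apply: le_trans (_ : rmean (iota 0 N) (fun j => (close i j)%:R * (4 * mu ^+ 2) + c ^+ 2 * (z * mu ^+ 2)) <= _).
  by apply: rmean_le_in => j; rewrite mem_iota add0n => /andP[_ jN]; exact: LL.
rewrite rmeanD rmean_cst ?size_iota//.
suff : rmean (iota 0 N) (fun j => (close i j)%:R * (4 * mu ^+ 2)) <= 8 * (z * mu ^+ 2) by clear -H; lra.
rewrite (@eq_rmean _ _ _ _ (fun j => 4 * mu ^+ 2 * (close i j)%:R)); last by move=> j; rewrite mulrC.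
rewrite rmeanZ /rmean size_iota.
have -> : \sum_(j <- iota 0 N) (close i j)%:R = (count (close i) (iota 0 N))%:R :> R.
  elim: (iota 0 N) => [|j l IHl]; first by rewrite big_nil.
  by rewrite big_cons/= IHl natrD.
have ct : (count (close i) (iota 0 N) <= 2 * t0)%N.
  rewrite -size_filter -(size_iota (i - t0) (2 * t0)); apply: uniq_leq_size.
    by rewrite filter_uniq ?iota_uniq.
  move=> j; rewrite mem_filter mem_iota => /andP[/andP[h1 h2] _]; rewrite mem_iota.
  apply/andP; split; first by rewrite leq_subLR addnC ltnW.
  apply: leq_trans h2 _; rewrite mul2n -addnn addnA leq_add2r.
  by rewrite addnC -leq_subLR.
have : N%:R^-1 * (count (close i) (iota 0 N))%:R <= 2 * z.
  by rewrite -tz mulrC mulrA ler_pM2r ?invr_gt0// -natrM ler_nat.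
move=> h; have -> : 8 * (z * mu ^+ 2) = 4 * mu ^+ 2 * (2 * z) by ring.
by rewrite ler_wpM2l// mulr_ge0 ?sqr_ge0.
Qed.

(** [stage] compares two grids whose sides have a bounded ratio. Summed over dyadic scales, its
    errors form a geometric series, down to a grid so fine that the modulus [rho] alone controls its
    effect on [F]. The number of scales depends on [rho]; the sum of the series, and hence the
    coarsest side [x * a], does not. *)
Lemma circle_smoothing (e : R) : 0 < e -> exists2 x : R, 0 < x <= 1 &
  forall (a : R) (rho : R -> R) (mu eta0 : R), 0 < a ->
    (forall b, 0 < b -> 0 < rho b) -> 0 < mu -> 0 < eta0 ->
  exists N eta n, [/\ (0 < N)%N, 0 < eta <= eta0, (0 < n)%N, n%:R * eta = x * a &
    forall p q F, `|p| <= 1 -> `|q| <= 1 -> nrm F <= mu ->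
      (forall b, 0 < b -> forall w, `|w| <= rho b -> nrm (sh w F - F) <= b) ->
      nrm (carc a p q N (F - av (grid2 eta p q n) F)) <= e * mu].
Proof.
(* The ratio of the sides [a * zz s ^+ 8] of the grids at consecutive scales, with
   [zz s = 2 ^- (4 * s)]. *)
move=> e0; pose B : R := (2 ^+ 4) ^+ 8.
have B1 : 1 <= B by rewrite /B -exprM exprn_ege1// ler1n.
pose C0 := 80 * B + 123; have C00 : 0 < C0 by rewrite /C0; lra.
pose h : R := 2^-1; have h01 : 0 < h <= 1 by rewrite /h; lra.
have h0 k : 0 < h ^+ k by rewrite exprn_gt0//; case/andP: h01.
have h1 k : h ^+ k <= 1 by case/andP: h01 => ? ?; rewrite exprn_ile1// ltW.
have h2K (k : nat) : h ^+ k * 2 ^+ k = 1 by rewrite -exprMn mulVf ?expr1n.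
have [s0 hs0] : exists s, h ^+ s <= e / (4 * C0) by apply: exists_half_exp; rewrite divr_gt0 ?mulr_gt0.
pose zz s := (h ^+ s) ^+ 4; have zz0 s : 0 < zz s by rewrite /zz exprn_gt0.
exists (zz s0 ^+ 8); first by rewrite /zz -!exprM h0 h1.
move=> a rho mu eta0 a0 rho0 mu0 eta00.
have [q1 hq1] : exists s, h ^+ s <= rho (e / 2 * mu) / (2 * a).
  by apply: exists_half_exp; rewrite divr_gt0 ?rho0 ?mulr_gt0 ?divr_gt0.
pose q := (q1 + s0)%N.
have s0q : (s0 <= q)%N by rewrite leq_addl.
pose b := zz q * mu; have b0 : 0 < b by rewrite mulr_gt0.
(* One term for each requirement: enough points on every grid and arc, steps of the curve and of the
   grid within the modulus at [b], and [eta <= eta0]. *)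
have [K [K0 Kb]] := exists_nat_ge ((zz q)^-1 + 12 * a / rho b + 2 * a / rho b + a / eta0).
have Kpos : 0 < K%:R :> R by rewrite ltr0n.
have t1 : 0 < (zz q)^-1 by rewrite invr_gt0.
have t2 : 0 < 12 * a / rho b by rewrite divr_gt0 ?mulr_gt0 ?rho0.
have t3 : 0 < 2 * a / rho b by rewrite divr_gt0 ?mulr_gt0 ?rho0.
have t4 : 0 < a / eta0 by rewrite divr_gt0.
pose eta := a * zz q ^+ 8 / K%:R.
have etapos : 0 < eta by rewrite /eta divr_gt0 ?mulr_gt0// exprn_gt0.
have etaK : eta * K%:R <= a.
  by rewrite /eta divfK ?gt_eqF// -[leRHS]mulr1 ler_pM2l// /zz -!exprM.
(* All numbers of points are [K] times powers of 2, which makes the ratios required by [stage] exact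
   at every scale. *)
pose N := (K * ((2 ^ q) ^ 4) ^ 6)%N.
pose n s := (K * ((2 ^ (q - s)) ^ 4) ^ 8)%N.
have n0 s : (0 < n s)%N by rewrite muln_gt0 K0 !expn_gt0.
have N0 : (0 < N)%N by rewrite muln_gt0 K0 !expn_gt0.
have h2D s : (s <= q)%N -> 2 ^+ (q - s) = 2 ^+ q * h ^+ s.
  move=> sq; rewrite -{2}(subnK sq) exprD -mulrA [_ * h ^+ _]mulrC h2K mulr1.
  by [].
have nE s : (s <= q)%N -> (n s)%:R * eta = a * zz s ^+ 8.
  move=> sq; rewrite /n /eta natrM !natrX h2D//.
  have <- : ((2 ^+ q * h ^+ s) ^+ 4) ^+ 8 * zz q ^+ 8 = zz s ^+ 8.
    by rewrite /zz -!exprMn mulrAC [2 ^+ q * _]mulrC h2K mul1r.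
  move: (_ ^+ 8) => A; move: (_ ^+ 8) => Z.
  by field; rewrite gt_eqF.
have zle s : (s <= q)%N -> zz q <= zz s.
  move=> sq; rewrite /zz lerXn2r ?nnegrE ?(ltW (h0 _))//.
  by case/andP: h01 => ? ?; rewrite ler_wiXn2l// ltW.
have KzV : K%:R^-1 <= zz q.
  by rewrite -[leRHS]invrK lef_pV2 ?posrE// (le_trans _ Kb)//; lra.
exists N, eta, (n s0); split => //.
- rewrite etapos/=; move: etaK; rewrite -ler_pdivlMr// => /le_trans; apply.
  by rewrite ler_pdivrMr// mulrC -ler_pdivrMr//; lra.
- by rewrite nE// mulrC.
move=> p q' F p1 q1' Fmu Fb.
have etarho : 2 * eta <= rho b.
  rewrite mulrC -ler_pdivlMr//; move: etaK; rewrite -ler_pdivlMr// => /le_trans; apply.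
  rewrite ler_pdivrMr// mulrC -ler_pdivrMr ?divr_gt0 ?rho0//.
  by rewrite invf_div mulrA [a * 2]mulrC; lra.
have aN : 12 * (a / N%:R) <= rho b.
  rewrite mulrA ler_pdivrMr ?ltr0n// [leRHS]mulrC -ler_pdivrMr ?rho0//.
  by apply: le_trans (_ : K%:R <= _); [lra|rewrite ler_nat leq_pmulr// !expn_gt0].
(* Descending induction from the finest scale [q]; the bound closes up because
   [2 * h ^+ s = h ^+ s + 2 * h ^+ s.+1]. *)
have P s : (s0 <= s)%N -> (s <= q)%N ->
    nrm (carc a p q' N (F - av (grid2 eta p q' (n s)) F)) <=
      e / 2 * mu + 2 * C0 * h ^+ s * mu.
  move=> s0s; move: {2}(q - s)%N (leqnn (q - s)) => j; elim: j s s0s => [|j IH] s s0s.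
    rewrite leqn0 subn_eq0 => qs sq; have -> : s = q by apply/eqP; rewrite eqn_leq qs sq.
    apply: le_trans (nrm_carc _ _ _ _ _) _.
    apply: le_trans (_ : e / 2 * mu <= _); last by rewrite lerDl !mulr_ge0 ?(ltW C00) ?(ltW (h0 _)) ?(ltW mu0).
    apply: (@sh_grid2_small eta (rho (e / 2 * mu))) => //.
    - by rewrite !mulr_ge0 ?invr_ge0 ?(ltW e0) ?(ltW mu0).
    - rewrite nE// mulrA -ler_pdivlMl ?mulr_gt0// [leRHS]mulrC; apply: le_trans hq1.
      rewrite /zz -!exprM /q; case/andP: h01 => ? ?; rewrite ler_wiXn2l ?(ltW h0)//.
        exact: ltW.
      by rewrite (leq_trans (leq_addr s0 q1))// leq_pmulr.
    - by move=> w; apply: Fb; rewrite mulr_gt0 ?divr_gt0.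
  move=> qsj sq; have [->|sq'] := eqVneq s q.
    apply: IH; rewrite ?subnn//.
  have sq1 : (s < q)%N by rewrite ltn_neqAle sq' sq.
  have := IH s.+1 (leqW s0s) _ sq1; rewrite subnS -subn1 leq_subLR add1n => /(_ qsj) h3.
  have -> : F - av (grid2 eta p q' (n s)) F = (F - av (grid2 eta p q' (n s.+1)) F) +
      (av (grid2 eta p q' (n s.+1)) F - av (grid2 eta p q' (n s)) F).
    by rewrite addrA subrK.
  set X := F - _ in h3 *; set Z := av _ F - _.
  have -> : carc a p q' N (X + Z) = carc a p q' N X + carc a p q' N Z.
    by rewrite -[X in X + Z]opprK addrC -[Z + _]/(Z - - X) carcB addrC -[X in _ = X + _]opprK; congr (- _ + _); rewrite -[in RHS]sub0r -[X in carc _ _ _ _ X]sub0r carcB /carc /avg big1 ?scaler0// => i _; rewrite sh_0.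
  apply: le_trans (nrmD _ _) _.
  suff : nrm (carc a p q' N Z) <= C0 * h ^+ s * mu.
    by move: h3; rewrite exprS /h; lra.
  pose t0 := (K * ((2 ^ q) ^ 4) ^ 5 * (2 ^ (q - s)) ^ 4)%N.
  apply: (@stage a eta (rho b) b (h ^+ s) B mu p q' N (K * ((2 ^ (q - s)) ^ 4) ^ 6)%N t0 (n s.+1) (n s)) => //.
  - by rewrite muln_gt0 K0 !expn_gt0.
  - by rewrite leq_mul2l !leq_exp2r// leq_exp2l// leq_subr orbT.
  - by rewrite !muln_gt0 K0 !expn_gt0.
  - by rewrite leq_mul2l !leq_exp2r// leq_exp2l// leq_sub2l ?orbT.
  - by rewrite h0 h1.
  - rewrite /N !natrM !natrX h2D// !exprMn; field.
    by rewrite (gt_eqF Kpos) andbT expf_neq0// pnatr_eq0.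
  - rewrite /N /t0 !natrM !natrX h2D//; field.
    by rewrite (gt_eqF Kpos) andbT expf_neq0// pnatr_eq0.
  - exact: nE.
  - have zS : zz s = 2 ^+ 4 * zz s.+1.
      rewrite /zz -exprMn [h ^+ s.+1]exprS mulrA.
      by have -> : 2 * h = 1 by [rewrite /h mulfV]; rewrite mul1r.
    by rewrite (nE s)// (nE s.+1)// zS exprMn /B mulrCA.
  - apply: le_trans (zle _ sq); apply: le_trans KzV.
    by rewrite lef_pV2 ?posrE ?ltr0n// ler_nat leq_pmulr// !expn_gt0.
  - apply: le_trans (zle _ sq); apply: le_trans KzV.
    by rewrite lef_pV2 ?posrE ?ltr0n ?muln_gt0 ?K0 ?expn_gt0// ler_nat leq_pmulr// !expn_gt0.
  - by rewrite (ltW b0)/= ler_pM2r// zle.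
  - by move=> w; exact: Fb.
apply: le_trans (P s0 _ _) _ => //.
have : 2 * C0 * h ^+ s0 <= e / 2.
  rewrite -ler_pdivlMl ?mulr_gt0//; apply: le_trans hs0 _.
  by rewrite le_eqVlt; apply/orP; left; apply/eqP; field; rewrite gt_eqF.
by rewrite -(ler_pM2r mu0); lra.
Qed.

End Circle.

(** * Reflections and isotropy *)

Section Dot.
Variables (R : realType) (m : nat).
Implicit Types (u v w p : 'rV[R]_m).

Definition dot u v : R := \sum_(i < m) u 0 i * v 0 i.

Lemma dotC u v : dot u v = dot v u.
Proof. by apply: eq_bigr => i _; rewrite mulrC. Qed.

Lemma dotDl u v w : dot (u + v) w = dot u w + dot v w.
Proof. by rewrite /dot -big_split/=; apply: eq_bigr => i _; rewrite !mxE mulrDl. Qed.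

Lemma dotZl (c : R) u w : dot (c *: u) w = c * dot u w.
Proof. by rewrite /dot mulr_sumr; apply: eq_bigr => i _; rewrite !mxE mulrA. Qed.

Lemma dotDr u v w : dot w (u + v) = dot w u + dot w v.
Proof. by rewrite dotC dotDl dotC [dot v w]dotC. Qed.

Lemma dotZr (c : R) u w : dot w (c *: u) = c * dot w u.
Proof. by rewrite dotC dotZl dotC. Qed.

Lemma dotNl u w : dot (- u) w = - dot u w.
Proof. by rewrite -scaleN1r dotZl mulN1r. Qed.

Lemma dotNr u w : dot w (- u) = - dot w u.
Proof. by rewrite dotC dotNl dotC. Qed.

Definition dotE := (dotDl, dotDr, dotNl, dotNr, dotZl, dotZr).

Lemma dot_ge0 u : 0 <= dot u u.
Proof. by apply: sumr_ge0 => i _; rewrite -expr2 sqr_ge0. Qed.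

Lemma dot_eq0 u : (dot u u == 0) = (u == 0).
Proof.
apply/idP/idP => [|/eqP ->]; last first.
  by rewrite -(scale0r (0 : 'rV[R]_m)) dotZl mul0r.
rewrite psumr_eq0 => [/allP h|i _]; last by rewrite -expr2 sqr_ge0.
apply/eqP/rowP => i; rewrite mxE; have := h i (mem_index_enum _).
by rewrite /= mulf_eq0 orbb => /eqP.
Qed.

Lemma coord_dot u i : `|u 0 i| ^+ 2 <= dot u u.
Proof.
rewrite real_normK ?num_real// expr2 /dot (bigD1 i)//= lerDl.
by apply: sumr_ge0 => j _; rewrite -expr2 sqr_ge0.
Qed.

Lemma coord_le_norm u i : `|u 0 i| <= `|u|.
Proof.
by rewrite [leRHS]mx_normrE; exact: (le_bigmax _ (fun ij => `|u ij.1 ij.2|) (0, i)).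
Qed.

Lemma norm_le_coord u c : 0 <= c -> (forall i, `|u 0 i| <= c) -> `|u| <= c.
Proof.
move=> c0 uc; rewrite [leLHS]mx_normrE; apply: bigmax_le => // -[i j] _ /=.
by rewrite ord1.
Qed.

Lemma norm_dot_le1 u : dot u u = 1 -> `|u| <= 1.
Proof.
move=> u1; apply: norm_le_coord => // i.
by have := coord_dot u i; rewrite u1 => h; have := normr_ge0 (u 0 i); nra.
Qed.

Definition refl p u := u - (2 * dot u p / dot p p) *: p.

Lemma reflD p u v : refl p (u + v) = refl p u + refl p v.
Proof. by rewrite /refl dotDl mulrDr mulrDl scalerDl opprD addrACA. Qed.

Lemma reflZ p (c : R) u : refl p (c *: u) = c *: refl p u.
Proof. by rewrite /refl dotZl scalerBr scalerA; congr (_ - _ *: _); ring. Qed.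

Lemma dot_refl p u v : p != 0 -> dot (refl p u) (refl p v) = dot u v.
Proof.
rewrite -dot_eq0 => p0; rewrite /refl !dotE [dot p v]dotC; field; exact: p0.
Qed.

Definition crv (t : R) : 'rV[R]_m := \row_(a < m) t ^+ (2 ^ a).


(** [W] gives the weights that extract each coefficient of a polynomial of degree below [P] from its
    values at the points [t i]. *)
Lemma vandermonde_dual (P : nat) (t : 'I_P -> R) : injective t ->
  exists W : 'M[R]_P, forall k j : 'I_P, \sum_i t i ^+ k * W i j = (k == j)%:R.
Proof.
move=> tinj; pose V := Vandermonde P (\row_i t i).
have Vu : V \in unitmx.
  rewrite unitmxE det_Vandermonde unitfE; apply/prodf_neq0 => i _.
  apply/prodf_neq0 => j ij; rewrite !mxE subr_eq0; apply: contraTneq ij => /tinj ->.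
  by rewrite ltnn.
exists (invmx V) => k j; have /matrixP/(_ k j) := mulmxV Vu.
by rewrite !mxE => <-; apply: eq_bigr => i _; rewrite !mxE.
Qed.

Lemma pow2_sum_inj (a b c d : nat) : (a <= b)%N -> (c <= d)%N ->
  (2 ^ a + 2 ^ b = 2 ^ c + 2 ^ d)%N -> (a = c) * (b = d).
Proof.
have lem (x y z w : nat) : (x <= y)%N -> (2 ^ x + 2 ^ y = 2 ^ z + 2 ^ w)%N -> (w <= y)%N.
  move=> xy e; rewrite leqNgt; apply/negP => yw.
  have h1 : (2 ^ x + 2 ^ y <= 2 ^ w)%N.
    apply: (@leq_trans (2 ^ y.+1)); last by rewrite leq_exp2l.
    by rewrite expnS mul2n -addnn leq_add2r leq_exp2l.
  have h2 : (0 < 2 ^ z)%N by rewrite expn_gt0.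
  by move: h1; rewrite e -[X in (_ <= X)%N]add0n leq_add2r leqNgt h2.
move=> ab cd e; have bd : b = d.
  by apply/eqP; rewrite eqn_leq (lem _ _ _ _ cd (esym e)) (lem _ _ _ _ ab e).
split => //; apply/eqP; rewrite -(@eqn_exp2l 2)//; apply/eqP.
by move: e; rewrite bd => /addIn.
Qed.

Lemma pow2_sum_eq (a b c d : nat) :
  (2 ^ a + 2 ^ b == 2 ^ c + 2 ^ d)%N = ((a == c) && (b == d)) || ((a == d) && (b == c)).
Proof.
apply/eqP/idP => [e|/orP[]/andP[/eqP -> /eqP ->]//]; last by rewrite addnC.
have [ab|/ltnW ba] := leqP a b; have [cd|/ltnW dc] := leqP c d.
- by have [-> ->] := pow2_sum_inj ab cd e; rewrite !eqxx.
- by rewrite [in RHS]addnC in e; have [-> ->] := pow2_sum_inj ab dc e; rewrite !eqxx orbT.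
- by rewrite [in LHS]addnC in e; have [-> ->] := pow2_sum_inj ba cd e; rewrite !eqxx orbT.
- by rewrite addnC [in RHS]addnC in e; have [-> ->] := pow2_sum_inj ba dc e; rewrite !eqxx.
Qed.

(* The reflections in the vectors of the curve crv map e to
   (dot p p)^-1 X(t), where X(t) = dot p p *: e - (2 dot e p) *: p is a
   polynomial in t with coefficients dirY; distinct pairs {a, c} give distinct
   exponents, so that interpolation recovers each coefficient, and these span. *)
Definition dirY (e : 'rV[R]_m) (a c : 'I_m) : 'rV[R]_m :=
  (a == c)%:R *: e - (2 * e 0 a) *: delta_mx 0 c.

Lemma crv_poly (e : 'rV[R]_m) (t : R) :
  dot (crv t) (crv t) *: e - (2 * dot e (crv t)) *: crv t =
  \sum_(a < m) \sum_(c < m) t ^+ (2 ^ a + 2 ^ c) *: dirY e a c.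
Proof.
rewrite /dirY; transitivity (\sum_(a < m) \sum_(c < m) (t ^+ (2 ^ a + 2 ^ c) * (a == c)%:R) *: e
   - \sum_(a < m) \sum_(c < m) (2 * (e 0 a * t ^+ (2 ^ a)) * t ^+ (2 ^ c)) *: (delta_mx 0 c : 'rV[R]_m)); last first.
  rewrite -sumrB; apply: eq_bigr => a _; rewrite -sumrB; apply: eq_bigr => c _.
  rewrite scalerBr !scalerA; congr (_ - _ *: _); rewrite exprD; ring.
congr (_ - _).
  rewrite /dot scaler_suml; apply: eq_bigr => a _.
  rewrite (bigD1 a)//= eqxx mulr1 exprD !mxE big1 ?addr0// => c ca.
  by rewrite eq_sym (negPf ca) mulr0 scale0r.
rewrite /dot mulr_sumr scaler_suml; apply: eq_bigr => a _.
rewrite {2}[crv t]row_sum_delta scaler_sumr; apply: eq_bigr => c _.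
by rewrite scalerA !mxE.
Qed.

(** Write $b_c$ for the basis vectors. For $c \ne a$ the symmetrized coefficient is $-2(e_a b_c +
    e_c b_a)$; weighting by $e_c$ and summing gives $b_a$ the coefficient $-2(1 - e_a^2)$ since $e$
    is a unit vector, and the diagonal coefficient $e - 2 e_a b_a$ cancels the multiples of $e$. *)
Lemma delta_dirY (e : 'rV[R]_m) (a : 'I_m) : dot e e = 1 ->
  (delta_mx 0 a : 'rV[R]_m) = - e 0 a *: dirY e a a
    - 2^-1 *: \sum_(c | c != a) e 0 c *: (dirY e a c + dirY e c a).
Proof.
move=> e1; set b := fun c : 'I_m => (delta_mx 0 c : 'rV[R]_m).
have -> : \sum_(c | c != a) e 0 c *: (dirY e a c + dirY e c a) =
   - 2 *: (e 0 a *: (e - e 0 a *: b a) + (1 - e 0 a ^+ 2) *: b a).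
  have -> : 1 - e 0 a ^+ 2 = \sum_(c | c != a) e 0 c ^+ 2.
    have <- : e 0 a ^+ 2 + \sum_(c | c != a) e 0 c ^+ 2 = 1.
      by rewrite -e1 /dot [RHS](bigD1 a)//= expr2; congr (_ + _); apply: eq_bigr => c _; rewrite expr2.
    by rewrite addrAC subrr add0r.
  have -> : e - e 0 a *: b a = \sum_(c | c != a) e 0 c *: b c.
    by rewrite [X in X - _ = _]row_sum_delta (bigD1 a)//= addrAC subrr add0r.
  rewrite scaler_sumr scaler_suml -big_split/= scaler_sumr; apply: eq_bigr => c ca.
  rewrite /dirY eq_sym (negPf ca) !scale0r !sub0r -/(b c) -/(b a).
  rewrite !scalerDr !scalerN !scaleNr !scalerA.
  by congr (- (_ *: _) - _ *: _); ring.
rewrite /dirY eqxx scale1r -/(b a).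
by apply/rowP => i; rewrite !mxE; field.
Qed.

End Dot.

Section Span.
Variables (R : realType) (m : nat).

Definition rpt (i : nat) : 'rV[R]_m := crv m i.+1%:R.

Lemma rpt_neq0 i : (0 < m)%N -> rpt i != 0.
Proof.
move=> m0; apply/negP => /eqP/rowP/(_ (Ordinal m0)); rewrite !mxE expn0 expr1.
by move/eqP; rewrite pnatr_eq0.
Qed.

(** The exponents [2 ^ a + 2 ^ c] are at most [2 ^ m], so that [2 ^ m + 1] distinct points suffice
    for the interpolation. The constant is uniform in [e] because the weights depend only on the
    points. *)
Lemma span_refl1 (l : seq nat) : (0 < m)%N -> uniq l -> size l = (2 ^ m).+1 ->
  exists2 C : R, 0 <= C & forall (e h : 'rV[R]_m), dot e e = 1 ->
    exists c : nat -> R, h = \sum_(i <- l) c i *: refl (rpt i) e /\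
      forall i, i \in l -> `|c i| <= C * `|h|.
Proof.
move=> m0 ul sl.
pose t (i : 'I_(2 ^ m).+1) : R := (nth 0%N l i).+1%:R.
have tinj : injective t.
  move=> i j /eqP; rewrite /t eqr_nat eqSS nth_uniq ?sl// => /eqP ij; exact: val_inj.
have [W WE] := vandermonde_dual tinj.
have ex (a c : 'I_m) : (2 ^ a + 2 ^ c < (2 ^ m).+1)%N.
  have h (b : 'I_m) : (2 ^ b <= 2 ^ m.-1)%N by rewrite leq_exp2l// -ltnS prednK.
  rewrite ltnS; apply: (@leq_trans (2 ^ m.-1.+1)); last by rewrite prednK.
  by rewrite expnS mul2n -addnn leq_add.
pose J a c := Ordinal (ex a c).
pose N i := dot (rpt (nth 0%N l i)) (rpt (nth 0%N l i)).
have XE (e : 'rV[R]_m) (i : 'I_(2 ^ m).+1) : N i *: refl (rpt (nth 0%N l i)) e =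
    \sum_a \sum_c t i ^+ J a c *: dirY e a c.
  rewrite -crv_poly /refl scalerBr scalerA -/(rpt _) -/(N i); congr (_ - _ *: _).
  by rewrite mulrC divfK// /N dot_eq0 rpt_neq0.
have comb (e : 'rV[R]_m) (j : 'I_(2 ^ m).+1) :
    \sum_i (W i j * N i) *: refl (rpt (nth 0%N l i)) e =
    \sum_a \sum_c (J a c == j)%:R *: dirY e a c.
  under eq_bigr do rewrite -scalerA XE scaler_sumr.
  rewrite exchange_big; apply: eq_bigr => a _.
  under eq_bigr do rewrite scaler_sumr.
  rewrite exchange_big; apply: eq_bigr => c _.
  by under eq_bigr do rewrite scalerA mulrC; rewrite -scaler_suml WE.
have interp (e : 'rV[R]_m) (a c : 'I_m) : a != c ->
    \sum_i (W i (J a c) * N i) *: refl (rpt (nth 0%N l i)) e = dirY e a c + dirY e c a.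
  move=> ac; rewrite comb.
  under eq_bigr => a' _ do under eq_bigr => c' _ do rewrite -val_eqE /= pow2_sum_eq !val_eqE.
  rewrite (bigD1 a)//= (bigD1 c)//= !eqxx/= scale1r big1 ?addr0; last first.
    by move=> c' c'c; rewrite (negPf c'c) (negPf ac) scale0r.
  congr (_ + _); rewrite (bigD1 c)/=; last by rewrite eq_sym.
  rewrite (bigD1 a)//= !eqxx orbT scale1r big1 ?addr0; last first.
    by move=> c' c'a; rewrite ?[c == a]eq_sym ?(negPf ac) ?(negPf c'a) ?andbF ?orbF /= scale0r.
  rewrite big1 ?addr0// => a' /andP[a'a a'c]; rewrite big1// => c' _.
  by rewrite (negPf a'a) (negPf a'c) scale0r.
have interp1 (e : 'rV[R]_m) (a : 'I_m) :
    \sum_i (W i (J a a) * N i) *: refl (rpt (nth 0%N l i)) e = dirY e a a.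
  rewrite comb.
  under eq_bigr => a' _ do under eq_bigr => c' _ do rewrite -val_eqE /= pow2_sum_eq orbb !val_eqE.
  rewrite (bigD1 a)//= (bigD1 a)//= !eqxx/= scale1r big1 ?addr0; last first.
    by move=> c' c'a; rewrite (negPf c'a) ?andbF scale0r.
  rewrite big1 ?addr0// => a' a'a; rewrite big1// => c' _.
  by rewrite (negPf a'a) scale0r.
(* The coefficients of [delta_dirY] carried through the interpolation weights; [N i] turns the
   polynomial back into a reflected vector. *)
pose cf (e h : 'rV[R]_m) (i : 'I_(2 ^ m).+1) := \sum_a h 0 a * (- e 0 a * (W i (J a a) * N i)
   - 2^-1 * \sum_(c | c != a) e 0 c * (W i (J a c) * N i)).
pose B : R := \sum_i \sum_a (`|W i (J a a) * N i| + \sum_c `|W i (J a c) * N i|).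
exists B.
  apply: sumr_ge0 => i _; apply: sumr_ge0 => a _; rewrite addr_ge0//; apply: sumr_ge0 => c _; exact: normr_ge0.
move=> e h e1; exists (fun k => if insub (index k l) is Some i then cf e h i else 0); split.
  rewrite (big_nth 0%N) sl big_mkord.
  under eq_bigr => i _ do rewrite index_uniq ?sl// valK.
  rewrite [LHS]row_sum_delta.
  transitivity (\sum_a \sum_i (h 0 a * (- e 0 a * (W i (J a a) * N i)
   - 2^-1 * \sum_(c | c != a) e 0 c * (W i (J a c) * N i))) *: refl (rpt (nth 0%N l i)) e); last first.
    by rewrite exchange_big/=; apply: eq_bigr => i _; rewrite -scaler_suml.
  apply: eq_bigr => a _; rewrite (delta_dirY a e1).
  have -> : \sum_(c | c != a) e 0 c *: (dirY e a c + dirY e c a) =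
      \sum_i (\sum_(c | c != a) e 0 c * (W i (J a c) * N i)) *: refl (rpt (nth 0%N l i)) e.
    under eq_bigr => c ca do rewrite -interp 1?eq_sym// scaler_sumr.
    rewrite exchange_big; apply: eq_bigr => i _; rewrite scaler_suml.
    by apply: eq_bigr => c _; rewrite scalerA.
  rewrite -interp1 !scaler_sumr -sumrB scaler_sumr; apply: eq_bigr => i _.
  by rewrite !scalerA -scalerBl scalerA.
have ele a : `|e 0 a| <= 1 by apply: le_trans (coord_le_norm e a) (norm_dot_le1 e1).
move=> k kl; rewrite insubT ?index_mem//.
  by rewrite -sl index_mem.
move=> kk; rewrite /= /cf.
set i := Sub _ _; rewrite mulrC; apply: le_trans (ler_norm_sum _ _ _) _.
rewrite /B mulr_sumr (bigD1 i)//= mulr_sumr -[leLHS]addr0; apply: lerD; last first.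
  apply: sumr_ge0 => j _; rewrite mulr_ge0//; apply: sumr_ge0 => a _; rewrite addr_ge0//.
  by apply: sumr_ge0 => c _; exact: normr_ge0.
apply: ler_sum => a _; rewrite normrM ler_pM ?coord_le_norm//.
apply: le_trans (ler_normB _ _) _; apply: lerD.
  by rewrite normrM normrN ler_piMl.
rewrite normrM; apply: le_trans (_ : `|\sum_(c | c != a) e 0 c * (W i (J a c) * N i)| <= _).
  by rewrite ler_piMl// ger0_norm//; lra.
apply: le_trans (ler_norm_sum _ _ _) _; rewrite [leRHS](bigID (fun c => c != a))/=.
rewrite -[leLHS]addr0; apply: lerD; last by apply: sumr_ge0 => c _; exact: normr_ge0.
by apply: ler_sum => c _; rewrite normrM ler_piMl.
Qed.

(** Only finitely many lists have their indices below [r]; the sum of their constants serves for all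
    of them. *)
Lemma span_refl (r : nat) : (0 < m)%N -> exists2 C : R, 0 <= C &
  forall (l : seq nat) (e h : 'rV[R]_m), uniq l -> size l = (2 ^ m).+1 ->
    (forall i, i \in l -> (i < r)%N) -> dot e e = 1 ->
    exists c : nat -> R, h = \sum_(i <- l) c i *: refl (rpt i) e /\
      forall i, i \in l -> `|c i| <= C * `|h|.
Proof.
move=> m0.
have ex (t : (2 ^ m).+1.-tuple 'I_r) : exists C : R, 0 <= C /\
    (uniq t -> forall (e h : 'rV[R]_m), dot e e = 1 ->
    exists c : nat -> R, h = \sum_(i <- map val t) c i *: refl (rpt i) e /\
      forall i, i \in map val t -> `|c i| <= C * `|h|).
  have [ut|nut] := boolP (uniq t); last by exists 0; split.
  have [||C C0 CP] := @span_refl1 (map val t) m0.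
  - by rewrite map_inj_uniq//; exact: val_inj.
  - by rewrite size_map size_tuple.
  by exists C; split => // _; exact: CP.
have [Cf CfP] := choice ex.
exists (\sum_t Cf t); first by apply: sumr_ge0 => t _; case: (CfP t).
move=> l e h ul sl lr e1.
case: r ex Cf CfP lr => [|r] _ Cf CfP lr.
  by case: l sl lr {ul} => // i l _ /(_ i); rewrite mem_head => /(_ isT).
have st : size (map (@inord r) l) == (2 ^ m).+1 by rewrite size_map sl.
pose t := Tuple st.
have tl : map val t = l.
  rewrite /= -map_comp -[RHS]map_id; apply/eq_in_map => i /lr ir /=.
  by rewrite inordK.
have [C0 CP] := CfP t.
have ut : uniq t by rewrite -(map_inj_uniq val_inj) tl.
have [c [hc cC]] := CP ut e h e1; rewrite tl in hc cC.
exists c; split => // i il; apply: le_trans (cC i il) _; rewrite ler_wpM2r//.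
by rewrite (bigD1 t)//= lerDl; apply: sumr_ge0 => t' _; case: (CfP t').
Qed.

End Span.

Section Isotropy.
Variables (R : realType) (E : normedModType R) (H : l2space R E).
Variables (m : nat) (io : {linear 'rV[R]_m -> E}).
Hypothesis io_norm : forall u, `|io u| <= `|u|.
Hypothesis m_gt0 : (0 < m)%N.

Definition rdir (eta : R) (p : 'rV[R]_m) (i : nat) : E := eta *: io (refl (rpt R m i) p).

Lemma avs_prog (eta : R) (p : 'rV[R]_m) n l (F : H) :
  avs (fun i => prog1 (rdir eta p i) n) l F = av (prog (map (rdir eta p) l) n) F.
Proof. by elim: l => [|i l /= ->]; rewrite ?av_prog0// -av_prog_cons. Qed.

(** An average in a single direction cannot annihilate [F - av Dh F], but an average over any
    [2 ^ m + 1] reflected directions nearly does: these span, so that it is almost invariant under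
    the much shorter vectors of [Dh]. By [mean_av_le] the single directions then succeed for most
    reflections. *)
Lemma isotropy (e : R) : 0 < e <= 1 -> exists (r : nat) (C : R), [/\ (0 < r)%N, 1 <= C &
  forall (l eta kappa mu : R) (n : nat) (Dh : seq E) (F : H) (p : 'rV[R]_m),
    0 < eta -> 0 < l -> n%:R * eta = l -> C <= n%:R -> C * kappa <= l -> 0 < mu ->
    dot p p = 1 -> (0 < size Dh)%N ->
    (forall d, d \in Dh -> exists2 h, d = io h & `|h| <= kappa) ->
    nrm F <= mu -> (forall w, `|w| <= C * eta -> nrm (sh w F - F) <= mu / C) ->
    rmean (iota 0 r) (fun i => nrm (av (prog1 (rdir eta p i) n) (F - av Dh F)) ^+ 2)
      <= e * mu ^+ 2].
Proof.
move=> /andP[e0 e1]; pose P := (2 ^ m).+1.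
have e401 : 0 < e / 4 <= 1 by apply/andP; split; lra.
pose d := eps_iter (e / 4) P.
have d0 : 0 < d by apply: eps_iter_gt0; case/andP: e401.
have d1 : d <= 1 by exact: eps_iter_le1.
have [r [r0 rP]] := exists_nat_ge (P%:R / d).
have [Cs Cs0 span] := span_refl R r m_gt0.
have P0 : 0 < P%:R :> R by rewrite ltr0n.
pose A := P%:R * (2 * (Cs + 1)) + 1 + P%:R.
have PCs : 0 <= P%:R * (2 * (Cs + 1)).
  by rewrite mulr_ge0 ?(ltW P0)// mulr_ge0// addr_ge0.
have A1 : 1 <= A by rewrite /A; lra.
pose C := A / d.
have C1 : 1 <= C by rewrite /C ler_pdivlMr// mul1r; lra.
have C0 : 0 < C by lra.
have Ad : A / C = d by rewrite /C invf_div mulrCA mulfV ?mulr1// gt_eqF//; lra.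
exists r, C; split=> // l eta kappa mu n Dh F p eta0 l0 nl Cn Ckl mu0 p1 Dh0 DhP Fmu FC.
have n0 : 0 < n%:R :> R by lra.
(* [F - av Dh F] has norm at most [2 * mu]. *)
have -> : e * mu ^+ 2 = e / 4 * (2 * mu) ^+ 2 by field.
apply: (@mean_av_le _ _ _ _ _ _ _ _ P) => //.
- lra.
- apply: le_trans (nrmB _ _) _; have := nrm_av Dh F; lra.
- by rewrite -ler_pdivrMl// mulrC.
move=> ll ul sl lr.
suff : nrm (avs (fun i => prog1 (rdir eta p i) n) ll (F - av Dh F)) <= d * mu.
  move=> h; apply: le_lt_trans (_ : (d * mu) ^+ 2 < _).
    have dmu0 : 0 <= d * mu := mulr_ge0 (ltW d0) (ltW mu0).
    by rewrite ler_sqr ?nnegrE ?nrm_ge0.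
  rewrite -/d; have dd : d ^+ 2 <= d by rewrite expr2 ler_piMl// ltW.
  have -> : d * (2 * mu) ^+ 2 = (4 * d) * mu ^+ 2 by ring.
  rewrite exprMn; have mu2 : 0 < mu ^+ 2 by rewrite exprn_gt0.
  by rewrite (ltr_pM2r mu2); lra.
rewrite avs_prog -[X in X - _](avg_cst F Dh0) -avgB avg_av.
apply: le_trans (nrm_avg _ _) _.
have dmu0 : 0 <= d * mu by rewrite mulr_ge0// ltW.
apply: (@le_trans _ _ (rmean Dh (fun=> d * mu))); last exact: rmean_cst_le.
apply: rmean_le_in => x /DhP[h -> hk]; rewrite avB nrmBC -sh_av.
have [c [hc cC]] := span ll p h ul sl lr p1.
have := @sh_prog R E H [seq (c i / eta, rdir eta p i) | i <- ll] n F (Cs * kappa / eta) (mu / C).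
rewrite !big_map /= /unzip2 -map_comp /= (_ : [seq _ | _ <- _] = map (rdir eta p) ll)//.
have -> : \sum_(j <- ll) (c j / eta) *: rdir eta p j = io h.
  rewrite hc linear_sum; apply: eq_bigr => i _.
  by rewrite /rdir scalerA divfK ?gt_eqF// linearZ.
move=> /(_ _ _)/le_trans; apply.
- move=> y /mapP[i il ->] /=; rewrite normrM normfV (gtr0_norm eta0) ler_pM2r ?invr_gt0//.
  by apply: le_trans (cC i il) _; rewrite ler_wpM2l.
- move=> w wl; apply: FC; apply: le_trans wl _.
  apply: (@le_trans _ _ (\sum_(i <- ll) eta)).
    apply: ler_sum => i _; rewrite /rdir normrZ (gtr0_norm eta0) ler_piMr ?(ltW eta0)//.
    apply: le_trans (io_norm _) _; apply: norm_dot_le1.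
    by rewrite dot_refl ?p1// rpt_neq0.
  rewrite big_const_seq count_predT iter_addr addr0 sl -mulr_natl ler_pM2r//.
  rewrite -/P /C ler_pdivlMr//; apply: le_trans (_ : P%:R * 1 <= _); first by rewrite ler_pM2l.
  by rewrite /A mulr1; lra.
rewrite size_map sl -/P.
have h1 : (Cs * kappa / eta + 1) / n%:R <= (Cs + 1) / C.
  have k1 : kappa / (eta * n%:R) <= C^-1.
    by rewrite [eta * _]mulrC nl ler_pdivrMr// ler_pdivlMl.
  have n1 : n%:R^-1 <= C^-1 by rewrite lef_pV2 ?posrE.
  have -> : (Cs * kappa / eta + 1) / n%:R = Cs * (kappa / (eta * n%:R)) + n%:R^-1.
    by field; rewrite !gt_eqF.
  by rewrite [leRHS]mulrDl mul1r; apply: lerD => //; rewrite ler_wpM2l.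
have -> : d * mu = A / C * mu by rewrite Ad.
have -> : A / C * mu = P%:R * (2 * ((Cs + 1) / C)) * mu + mu / C + P%:R / C * mu.
  by rewrite /A; field; rewrite gt_eqF.
have h2 : 0 <= P%:R / C * mu := mulr_ge0 (divr_ge0 (ltW P0) (ltW C0)) (ltW mu0).
have h3 : P%:R * (2 * (Cs * kappa / eta + 1) / n%:R) * nrm F <= P%:R * (2 * ((Cs + 1) / C)) * mu.
  have h4 : 0 <= (Cs * kappa / eta + 1) / n%:R.
    have kap0 : 0 <= kappa by apply: le_trans hk.
    by rewrite divr_ge0 ?(ltW n0)// addr_ge0// divr_ge0 ?(ltW eta0)// mulr_ge0.
  rewrite -(mulrA 2); move: (_ / n%:R) h1 h4 => y h1 h4.
  have hy : P%:R * (2 * y) <= P%:R * (2 * ((Cs + 1) / C)) by rewrite ler_pM2l// ler_pM2l.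
  by apply: ler_pM => //; rewrite ?nrm_ge0// mulr_ge0 ?(ltW P0)// mulr_ge0.
by lra.
Qed.

End Isotropy.

(** * A vertex moving on an arc *)

Section Invariance.
Variables (R : realType) (E : normedModType R) (H : l2space R E).

(* With M = P^* P for P = av D, a contraction with M^2 <= M, the defect
   |G - M G|^2 is at most |G|^2 - |P G|^2. *)
Lemma almost_invariant (D : seq E) (w : E) (G : H) :
  nrm (sh w G - G) <= 2 * Num.sqrt (nrm G ^+ 2 - nrm (av D G) ^+ 2)
    + nrm (sh w (av D G) - av D G).
Proof.
set M := av (map -%R D) (av D G).
have h : nrm (G - M) <= Num.sqrt (nrm G ^+ 2 - nrm (av D G) ^+ 2).
  rewrite /nrm -/(nrm G) -/(nrm (av D G)) ler_wsqrtr// !ipDl !ipDr !ipNl !ipNr opprK nrm_sqr.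
  have e1 : ip M G = nrm (av D G) ^+ 2 by rewrite ipC -ip_av nrm_sqr.
  have e2 : ip M M <= nrm (av D G) ^+ 2.
    by rewrite -nrm_sqr ler_sqr ?nnegrE ?nrm_ge0// nrm_av.
  by move: e2; rewrite [ip G M]ipC e1; lra.
have -> : sh w G - G = sh w (G - M) - (G - M) + (sh w M - M).
  by rewrite shB opprB addrAC subrKA subrKA.
apply: le_trans (nrmD _ _) _; apply: lerD.
  by apply: le_trans (nrmB _ _) _; rewrite nrm_sh; lra.
by rewrite /M sh_av -avB nrm_av.
Qed.

End Invariance.

Section Vertex.
Variables (R : realType) (E : normedModType R) (H : l2space R E).
Variables (m : nat) (io : {linear 'rV[R]_m -> E}).
Hypothesis io_norm : forall u, `|io u| <= `|u|.
Hypothesis m_gt0 : (0 < m)%N.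

Definition pgrid (eta : R) (K : nat) : seq E :=
  prog [seq eta *: io (delta_mx 0 a) | a <- index_enum 'I_m] K.

Lemma pgrid_size eta K : (0 < K)%N -> (0 < size (pgrid eta K))%N.
Proof. by move=> K0; rewrite size_prog expn_gt0 K0. Qed.

Lemma mem_pgrid eta K d : 0 < eta -> d \in pgrid eta K ->
  exists2 h, d = io h & `|h| <= K%:R * eta.
Proof.
move=> eta0; rewrite /pgrid => dp.
have K0 : 0 <= K%:R * eta by rewrite mulr_ge0// ltW.
suff [h -> hh] : exists2 h : 'rV[R]_m, d = io h & forall a, `|h 0 a| <= K%:R * eta.
  by exists h => //; exact: norm_le_coord.
have : uniq (index_enum 'I_m) by exact: index_enum_uniq.
move: dp; elim: (index_enum 'I_m) d => [|a s IH] d.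
  rewrite inE => /eqP -> _; exists 0; first by rewrite linear0.
  by move=> a; rewrite mxE normr0.
(* The induction also records that the coordinates outside the list vanish, so that each new step
   meets a zero coordinate. *)
suff : d \in prog [seq eta *: io (delta_mx 0 a) | a <- a :: s] K -> uniq (a :: s) ->
  exists2 h : 'rV[R]_m, d = io h & (forall b, `|h 0 b| <= K%:R * eta) /\ forall b, b \notin a :: s -> h 0 b = 0.
  by move=> h dp us; have [x ? []] := h dp us; exists x.
move: d {IH}; elim: {a s}(a :: s) => [|a s IH] d.
  rewrite inE => /eqP -> _; exists 0; first by rewrite linear0.
  by split=> b; rewrite mxE ?normr0.
move=> dp /andP[as_ us]; have [k [d' [kK d'p ->]]] := mem_prog_cons dp.
have [h -> [hb h0]] := IH _ d'p us.
exists ((k%:R * eta) *: delta_mx 0 a + h).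
  by rewrite linearD linearZ/= -scaler_nat scalerA.
split=> b; rewrite !mxE eqxx/=; last first.
  by rewrite inE negb_or => /andP[ba bs]; rewrite (negPf ba) mulr0 add0r h0.
have [->|ba] := eqVneq b a; last by rewrite mulr0 add0r.
rewrite h0// addr0 mulr1 normrM normr_nat (gtr0_norm eta0) ler_pM2r// ler_nat.
exact: ltnW.
Qed.

Lemma sh_pgrid (eta rho b : R) K (u : 'rV[R]_m) (F : H) : 0 < eta ->
  m%:R * eta <= rho -> (forall w, `|w| <= rho -> nrm (sh w F - F) <= b) ->
  nrm (sh (io u) (av (pgrid eta K) F) - av (pgrid eta K) F)
    <= m%:R * (2 * (`|u| / eta + 1) / K%:R) * nrm F + b.
Proof.
move=> eta0 mr Fb.
have := @sh_prog R E H [seq (u 0 a / eta, eta *: io (delta_mx 0 a)) | a <- index_enum 'I_m]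
  K F (`|u| / eta) b.
rewrite !big_map /= /unzip2 -map_comp /= (_ : [seq _ | _ <- _] =
  [seq eta *: io (delta_mx 0 a) | a <- index_enum 'I_m])// -/(pgrid eta K).
have -> : \sum_(j <- index_enum 'I_m) (u 0 j / eta) *: (eta *: io (delta_mx 0 j)) = io u.
  rewrite [u in RHS]row_sum_delta linear_sum; apply: eq_bigr => i _.
  by rewrite scalerA divfK ?gt_eqF// linearZ.
have -> : size [seq (u 0 a / eta, eta *: io (delta_mx 0 a)) | a <- index_enum 'I_m] = m.
  by rewrite size_map -[RHS](card_ord m) cardT enumT.
apply.
- move=> x /mapP[a _ ->] /=; rewrite normrM normfV (gtr0_norm eta0).
  by rewrite ler_pM2r ?invr_gt0// coord_le_norm.
- move=> w wl; apply: Fb; apply: le_trans wl _; apply: le_trans mr.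
  apply: (@le_trans _ _ (\sum_(a < m) eta)); last by rewrite sumr_const card_ord mulr_natl.
  apply: ler_sum => a _; rewrite normrZ (gtr0_norm eta0) ler_piMr ?(ltW eta0)//.
  apply: le_trans (io_norm _) _; apply: norm_le_coord => // i; rewrite mxE eqxx/=.
  by case: (i == a); rewrite ?normr1 ?normr0.
Qed.

Lemma io_cur (a : R) (p q : 'rV[R]_m) (t : R) : io (cur a p q t) = cur a (io p) (io q) t.
Proof. by rewrite linearD !linearZ. Qed.

Lemma refl_cur (z p q : 'rV[R]_m) (a t : R) :
  refl z (cur a p q t) = cur a (refl z p) (refl z q) t.
Proof. by rewrite reflD !reflZ. Qed.

Lemma curZ (V : normedModType R) (l a : R) (p q : V) (t : R) :
  l *: cur a p q t = cur (l * a) p q t.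
Proof. by rewrite /cur scalerDr !scalerA !mulrA. Qed.

Lemma norm_refl_le (z u : 'rV[R]_m) (c : R) : z != 0 -> 0 <= c -> dot u u <= c ^+ 2 ->
  `|refl z u| <= c.
Proof.
move=> z0 c0 uc; apply: norm_le_coord => // i.
have := coord_dot (refl z u) i; rewrite dot_refl// => h.
by rewrite -ler_sqr ?nnegrE// (le_trans h).
Qed.

(** Let [LL] be the planar average of [circle_smoothing] and [G] the average over the small grid. On
    the arc, [F] may be replaced by [LL F]; averaging over reflections, [LL F] by [LL G] through
    [isotropy]; and [G] is almost invariant under the remaining translations by [almost_invariant],
    whence the square root. [N] serves all [o], [p], [q], since these change with the rotations of
    the other vertices. *)
Lemma vertex (e : R) : 0 < e -> exists2 r : nat, (0 < r)%N &
  forall a0 R0 : R, 0 < a0 -> 0 <= R0 -> exists2 C0 : R, 1 <= C0 & forall C, C0 <= C ->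
  forall (lam : R) (rho : R -> R) (mu : R), 0 < lam ->
    (forall b, 0 < b -> 0 < rho b) -> 0 < mu ->
  exists2 N : nat, (0 < N)%N &
  forall (eta : R) (Km Kp : nat) (F : H) (o p q : 'rV[R]_m),
    0 < eta -> m%:R * eta <= rho (mu / C) -> (0 < Km)%N -> Km%:R * eta <= lam / C ->
    C * lam <= Kp%:R * eta -> C <= Kp%:R ->
    nrm F <= mu -> (forall b, 0 < b -> forall w, `|w| <= rho b -> nrm (sh w F - F) <= b) ->
    dot p p = 1 -> dot q q = 1 ->
    (forall t, dot (o + cur a0 p q t) (o + cur a0 p q t) <= R0 ^+ 2) ->
    rmean (iota 0 r) (fun i => nrm (avg (iota 0 N) (fun j =>
        sh (io (lam *: refl (rpt R m i) (o + cur a0 p q (j%:R / N%:R)))) F) - av (pgrid eta Km) F)) <=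
      e * mu + 2 * Num.sqrt (nrm (av (pgrid eta Km) F) ^+ 2
        - nrm (av (pgrid eta Kp) (av (pgrid eta Km) F)) ^+ 2).
Proof.
move=> e0.
have e4 : 0 < e / 4 by rewrite divr_gt0.
have [x /andP[x0 x1] circ] := @circle_smoothing R E H (e / 4) e4.
pose e' := Num.min 1 ((e / 4) ^+ 2).
have e'0 : 0 < e' by rewrite lt_min ltr01 exprn_gt0.
have e'1 : e' <= 1 by rewrite ge_min lexx.
have e'e : e' <= (e / 4) ^+ 2 by rewrite ge_min lexx orbT.
have [r [C2 [r0 C21 iso]]] := @isotropy R E H m io io_norm m_gt0 e' (introT andP (conj e'0 e'1)).
exists r => // a0 R0 a00 R00.
have C20 : 0 < C2 by lra.
have xa0 : 0 < x * a0 by rewrite mulr_gt0.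
pose A := m%:R * (2 * (R0 + 2 * a0 + 1)) + 1.
have A0 : 0 <= A by rewrite addr_ge0// mulr_ge0// mulr_ge0// !addr_ge0// mulr_ge0// ltW.
have t1 : 0 < C2 / (x * a0) by rewrite divr_gt0.
have t2 : 0 <= 4 * A / e by rewrite divr_ge0 ?mulr_ge0// ltW.
(* The second term makes the grid of [Km] points short enough for [isotropy], the third makes the
   translations at scale [lam] short for the grid of [Kp] points. *)
exists (1 + C2 / (x * a0) + 4 * A / e); first by lra.
move=> C CC.
have C1 : 1 <= C by lra.
have C0 : 0 < C by apply: lt_le_trans C1.
have CC2 : C2 / (x * a0) <= C by lra.
have CA : 4 * A / e <= C by lra.
move=> lam rho mu lam0 rho0 mu0.
have la0 : 0 < lam * a0 by rewrite mulr_gt0.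
(* The first term gives the planar grid at least [C2] points on a side, the second keeps [C2] steps
   within the modulus; [isotropy] requires both. *)
pose eta0 := Num.min (x * (lam * a0) / C2) (rho (mu / C2) / C2).
have eta00 : 0 < eta0.
  rewrite lt_min; apply/andP; split; apply: divr_gt0 => //; first by rewrite mulr_gt0.
  by apply: rho0; exact: divr_gt0.
have [N [eta1 [n1 [N0 /andP[eta10 eta1le] n10 n1eta circP]]]] :=
  circ (lam * a0) rho mu eta0 la0 rho0 mu0 eta00.
have [eta1a eta1b] : eta1 <= x * (lam * a0) / C2 /\ eta1 <= rho (mu / C2) / C2.
  by move: eta1le; rewrite le_min => /andP.
exists N => // eta Km Kp F o p q eta0' meta Km0 Kml Kpl CKp Fmu Fc p1 q1 yR0.
set G := av (pgrid eta Km) F.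
set S := Num.sqrt _.
pose P i := io (refl (rpt R m i) p); pose Q i := io (refl (rpt R m i) q).
have unitn (u : 'rV[R]_m) i : dot u u = 1 -> `|refl (rpt R m i) u| <= 1.
  by move=> u1; apply: norm_dot_le1; rewrite dot_refl ?rpt_neq0.
have Pn i : `|P i| <= 1 by apply: le_trans (io_norm _) _; exact: unitn.
have Qn i : `|Q i| <= 1 by apply: le_trans (io_norm _) _; exact: unitn.
pose LL i X : H := av (grid2 eta1 (P i) (Q i) n1) X.
pose w i j := io (lam *: refl (rpt R m i) (o + cur a0 p q (j%:R / N%:R))).
pose A1 i X : H := avg (iota 0 N) (fun j => sh (w i j) X).
have A1E i X : A1 i X = sh (io (lam *: refl (rpt R m i) o)) (carc (lam * a0) (P i) (Q i) N X).
  rewrite sh_avg; apply: eq_avg => j; rewrite -sh_add; congr sh.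
  by rewrite /w reflD scalerDr linearD refl_cur curZ io_cur.
have A1B i X Y : A1 i (X - Y) = A1 i X - A1 i Y.
  by rewrite -avgB; apply: eq_avg => j; rewrite shB.
have nrmA1 i X : nrm (A1 i X) <= nrm X.
  by apply: nrm_avg_le => [|j]; rewrite ?nrm_ge0// nrm_sh.
have Gmu : nrm G <= mu by apply: le_trans (nrm_av _ _) _.
have step1 i : nrm (A1 i (F - LL i F)) <= e / 4 * mu.
  by rewrite A1E nrm_sh; apply: circP.
have step3 i : nrm (A1 i (LL i G) - G) <= 2 * S + e / 4 * mu.
  have s0 : (0 < size (iota 0 N))%N by rewrite size_iota.
  have gs0 : (0 < size (grid2 eta1 (P i) (Q i) n1))%N by rewrite size_prog expn_gt0 n10.
  have B0 : 0 <= 2 * S + e / 4 * mu by rewrite addr_ge0 ?mulr_ge0 ?sqrtr_ge0// ltW.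
  rewrite -[X in _ - X](avg_cst G s0) -avgB; apply: le_trans (nrm_avg _ _) _.
  apply: rmean_leC => // j.
  rewrite /LL -[X in _ - X](avg_cst G gs0) sh_avg -avgB.
  apply: le_trans (nrm_avg _ _) _.
  apply: (@le_trans _ _ (rmean (grid2 eta1 (P i) (Q i) n1) (fun=> 2 * S + e / 4 * mu))); last exact: rmean_cst_le.
  apply: rmean_le_in => d /mem_grid2[k [k' [kn kn' ->]]].
  pose u := lam *: refl (rpt R m i) (o + cur a0 p q (j%:R / N%:R))
     + ((eta1 * k%:R) *: refl (rpt R m i) p + (eta1 * k'%:R) *: refl (rpt R m i) q).
  have -> : sh (w i j) (sh ((eta1 *: P i) *+ k + (eta1 *: Q i) *+ k') G) = sh (io u) G.
    have ioZ c v : io (c *: v) = c *: io v by exact: linearZ.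
    rewrite -sh_add; congr (sh _ G); rewrite /u (linearD io) (linearD io) (ioZ (eta1 * k%:R)) (ioZ (eta1 * k'%:R)).
    by rewrite -!(mulrC _ eta1) -!scalerA !scaler_nat.
  have un : `|u| <= lam * (R0 + 2 * a0).
    have kl (l : nat) v : (l < n1)%N -> dot v v = 1 ->
        `|(eta1 * l%:R) *: refl (rpt R m i) v| <= lam * a0.
      move=> ln v1; rewrite normrZ normrM (gtr0_norm eta10) normr_nat.
      have h1 : eta1 * l%:R <= x * (lam * a0).
        by rewrite -n1eta mulrC ler_pM2r// ler_nat ltnW.
      have h2 : x * (lam * a0) <= lam * a0 by rewrite ler_piMl// ltW.
      apply: le_trans (le_trans h1 h2); rewrite ler_piMr ?unitn//.
      by rewrite mulr_ge0// ltW.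
    have h0 : `|lam *: refl (rpt R m i) (o + cur a0 p q (j%:R / N%:R))| <= lam * R0.
      rewrite normrZ (gtr0_norm lam0) ler_pM2l//.
      by apply: norm_refl_le => //; exact: rpt_neq0.
    apply: le_trans (ler_normD _ _) _.
    have h1 := kl k p kn p1; have h2 := kl k' q kn' q1.
    by apply: le_trans (lerD h0 (le_trans (ler_normD _ _) (lerD h1 h2))) _; clear -H m_gt0 io_norm; lra.
  apply: le_trans (@almost_invariant R E H (pgrid eta Kp) (io u) G) _.
  rewrite lerD2l.
  have Gc v : `|v| <= rho (mu / C) -> nrm (sh v G - G) <= mu / C.
    move=> vr; rewrite /G sh_av -avB; apply: le_trans (nrm_av _ _) _.
    by apply: Fc => //; rewrite divr_gt0.
  apply: le_trans (@sh_pgrid eta (rho (mu / C)) (mu / C) Kp u G eta0' meta Gc) _.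
  have Kp0 : 0 < Kp%:R :> R by apply: lt_le_trans CKp.
  have h1 : (`|u| / eta + 1) / Kp%:R <= (R0 + 2 * a0 + 1) / C.
    have -> : (`|u| / eta + 1) / Kp%:R = `|u| / (Kp%:R * eta) + Kp%:R^-1.
      by field; rewrite !gt_eqF.
    rewrite [leRHS]mulrDl mul1r; apply: lerD; last by rewrite lef_pV2 ?posrE.
    have Kpe : 0 < Kp%:R * eta by rewrite mulr_gt0.
    rewrite ler_pdivrMr// mulrAC ler_pdivlMr//.
    apply: le_trans (_ : lam * (R0 + 2 * a0) * C <= _); first by rewrite ler_pM2r.
    have -> : lam * (R0 + 2 * a0) * C = (R0 + 2 * a0) * (C * lam) by ring.
    by rewrite ler_wpM2l// addr_ge0// mulr_ge0// ltW.
  have h2 : 0 <= (`|u| / eta + 1) / Kp%:R.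
    by rewrite divr_ge0 ?(ltW Kp0)// addr_ge0// divr_ge0// ltW.
  rewrite -(mulrA 2); move: (_ / Kp%:R) h1 h2 => y h1 h2.
  have h3 : m%:R * (2 * y) * nrm G <= m%:R * (2 * ((R0 + 2 * a0 + 1) / C)) * mu.
    apply: ler_pM => //; rewrite ?nrm_ge0 ?mulr_ge0//.
    by rewrite ler_wpM2l// ler_pM2l.
  have h4 : m%:R * (2 * ((R0 + 2 * a0 + 1) / C)) * mu + mu / C = A / C * mu.
    by rewrite /A; field; rewrite gt_eqF.
  have h5 : A / C * mu <= e / 4 * mu.
    rewrite ler_pM2r// ler_pdivrMr//.
    have -> : e / 4 * C = C * (e / 4) by rewrite mulrC.
    rewrite -ler_pdivrMr//; apply: le_trans CA; rewrite le_eqVlt; apply/orP; left.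
    by apply/eqP; field; rewrite gt_eqF.
  by move: h3 h4 h5; clear -H m_gt0 io_norm; lra.
have step2 : rmean (iota 0 r) (fun i => nrm (A1 i (LL i (F - G)))) <= e / 4 * mu.
  pose f i := nrm (av (prog1 (rdir io eta1 p i) n1) (F - G)).
  have h : rmean (iota 0 r) (fun i => f i ^+ 2) <= e' * mu ^+ 2.
    have l0 : 0 < x * (lam * a0) by rewrite mulr_gt0.
    have Cn1 : C2 <= n1%:R.
      rewrite -(ler_pM2r eta10) n1eta mulrC -ler_pdivlMr//.
    apply: (@iso (x * (lam * a0)) eta1 (Km%:R * eta) mu n1 (pgrid eta Km) F p) => //.
    - apply: le_trans (_ : C2 * (lam / C) <= _); first by rewrite ler_pM2l.
      rewrite mulrA ler_pdivrMr//; apply: le_trans (_ : x * (lam * a0) * (C2 / (x * a0)) <= _).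
        by rewrite le_eqVlt; apply/orP; left; apply/eqP; field; rewrite !gt_eqF.
      by rewrite ler_pM2l.
    - exact: pgrid_size.
    - by move=> d /(mem_pgrid eta0').
    - move=> v vC; apply: (Fc (mu / C2)); first by rewrite divr_gt0.
      by apply: le_trans vC _; rewrite mulrC -ler_pdivlMr.
  apply: (@le_trans _ _ (rmean (iota 0 r) f)).
    apply: rmean_le => i; apply: le_trans (nrmA1 _ _) _.
    (* Only the direction of [p] is exploited; the average along [q] is a contraction. *)
    rewrite /LL /grid2 av_prog_cons; apply: le_trans (_ : nrm (av (prog1 (eta1 *: P i) n1) (F - G)) <= _) => //.
    by rewrite avC; exact: nrm_av.
  have f0 : 0 <= rmean (iota 0 r) f by apply: rmean_ge0 => i; exact: nrm_ge0.
  have em : 0 <= e / 4 * mu by rewrite mulr_ge0// ltW.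
  rewrite -ler_sqr ?nnegrE//; apply: le_trans (rmean_sqr _ _) _; apply: le_trans h _.
  by rewrite exprMn ler_wpM2r ?sqr_ge0.
apply: (@le_trans _ _ (rmean (iota 0 r) (fun i => nrm (A1 i (LL i (F - G))) + (2 * S + 2 * (e / 4 * mu))))).
  apply: rmean_le => i; rewrite -/(A1 i F).
  have -> : A1 i F - G = A1 i (F - LL i F) + (A1 i (LL i (F - G)) + (A1 i (LL i G) - G)).
    by rewrite /LL avB !A1B !subrKA.
  apply: le_trans (nrmD _ _) _; have := nrmD (A1 i (LL i (F - G))) (A1 i (LL i G) - G).
  by have := step1 i; have := step3 i; clear -H m_gt0 io_norm; lra.
rewrite rmeanD rmean_cst ?size_iota//.
have : 0 <= e / 4 * mu by rewrite mulr_ge0// ltW.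
by move: step2; clear -H m_gt0 io_norm; lra.
Qed.

End Vertex.

(** * Translation invariant integrals *)

Record invint (R : realType) (E : zmodType) := Invint {
  idom : (E -> R) -> Prop;
  itg : (E -> R) -> R;
  idom0 : idom (cst 0);
  idom_lin : forall (c : R) f g, idom f -> idom g -> idom (fun x => c * f x + g x);
  idomM : forall f g, idom f -> idom g -> idom (fun x => f x * g x);
  idom_sh : forall w f, idom f -> idom (fun x => f (x + w));
  itg_lin : forall (c : R) f g, idom f -> idom g ->
    itg (fun x => c * f x + g x) = c * itg f + itg g;
  itg_ge0 : forall f, idom f -> (forall x, 0 <= f x) -> 0 <= itg f;
  itg_sh : forall w f, idom f -> itg (fun x => f (x + w)) = itg f }.

Section Functions.
Variables (R : realType) (E : zmodType) (J : invint R E).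

Definition ipred : {pred E -> R} := fun f => `[< idom J f >].

Lemma ipred_submod : GRing.subsemimod_closed ipred.
Proof.
split; first split.
- by apply/asboolP; exact: idom0.
- move=> f g /asboolP fd /asboolP gd; apply/asboolP.
  have := idom_lin 1 fd gd; congr idom; apply/funext => x; by rewrite mul1r.
- move=> c f /asboolP fd; apply/asboolP.
  have := idom_lin c fd (idom0 J); congr idom; apply/funext => x; by rewrite addr0.
Qed.

Record ifun := Ifun { ival :> E -> R; ifunP : ival \in ipred }.

HB.instance Definition _ := [isSub for ival].
HB.instance Definition _ := [Choice of ifun by <:].
HB.instance Definition _ :=
  GRing.SubChoice_isSubLmodule.Build R (E -> R) ipred ifun ipred_submod.

Lemma idomP (F : ifun) : idom J F.
Proof. exact/asboolP/ifunP. Qed.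

Definition mkifun (f : E -> R) (fd : idom J f) : ifun := Ifun (introT (asboolP _) fd).

Lemma ifun_eq (F G : ifun) : (forall x, F x = G x) -> F = G.
Proof. by move=> FG; apply: val_inj; apply/funext. Qed.

Lemma ivalD (F G : ifun) x : (F + G) x = F x + G x.
Proof. by []. Qed.

Lemma ivalZ c (F : ifun) x : (c *: F) x = c * F x.
Proof. by []. Qed.

Lemma ivalB (F G : ifun) x : (F - G) x = F x - G x.
Proof. by []. Qed.

Lemma ival_sum I (s : seq I) (f : I -> ifun) x : (\sum_(i <- s) f i) x = \sum_(i <- s) f i x.
Proof. by elim/big_ind2: _ => // a F b G <- <-; rewrite ivalD. Qed.

Lemma itg_eq f g : (forall x, f x = g x) -> itg J f = itg J g.
Proof. by move=> /funext ->. Qed.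

Lemma itgD f g : idom J f -> idom J g -> itg J (fun x => f x + g x) = itg J f + itg J g.
Proof.
by move=> fd gd; rewrite -[in RHS](mul1r (itg J f)) -itg_lin//; apply: itg_eq => x; rewrite mul1r.
Qed.

Lemma itg_cst0 : itg J (cst 0) = 0.
Proof.
have h : itg J (cst 0) = itg J (fun x => cst 0 x + cst 0 x) by apply: itg_eq => x; rewrite addr0.
by move: (itgD (idom0 J) (idom0 J)); rewrite -h; lra.
Qed.

Lemma itgZ c f : idom J f -> itg J (fun x => c * f x) = c * itg J f.
Proof.
move=> fd; have := itg_lin c fd (idom0 J); rewrite itg_cst0 addr0 => <-.
by apply: itg_eq => x; rewrite addr0.
Qed.

Lemma idomB f g : idom J f -> idom J g -> idom J (fun x => f x - g x).
Proof.
move=> fd gd; have := idom_lin (-1) gd fd; congr idom; apply/funext => x.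
by rewrite mulN1r addrC.
Qed.

Lemma itgB f g : idom J f -> idom J g -> itg J (fun x => f x - g x) = itg J f - itg J g.
Proof.
move=> fd gd; have := itg_lin (-1) gd fd; rewrite mulN1r addrC => <-.
by apply: itg_eq => x; rewrite mulN1r addrC.
Qed.

Lemma itg_le f g : idom J f -> idom J g -> (forall x, f x <= g x) -> itg J f <= itg J g.
Proof.
move=> fd gd fg; rewrite -subr_ge0 -itgB//; apply: itg_ge0; first exact: idomB.
by move=> x; rewrite subr_ge0.
Qed.

Definition iip (F G : ifun) : R := itg J (fun x => F x * G x).

Definition ish (w : E) (F : ifun) : ifun := mkifun (idom_sh w (idomP F)).

Lemma ishE w F x : ish w F x = F (x + w).
Proof. by []. Qed.

Lemma iipC F G : iip F G = iip G F.
Proof. by apply: itg_eq => x; rewrite mulrC. Qed.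

Lemma iipDl F G K : iip (F + G) K = iip F K + iip G K.
Proof.
rewrite /iip -itgD; [|exact: idomM (idomP _) (idomP _)..].
by apply: itg_eq => x; rewrite ivalD mulrDl.
Qed.

Lemma iipZl c F K : iip (c *: F) K = c * iip F K.
Proof.
rewrite /iip -itgZ; last exact: idomM (idomP _) (idomP _).
by apply: itg_eq => x; rewrite ivalZ mulrA.
Qed.

Lemma iip_ge0 F : 0 <= iip F F.
Proof. by apply: itg_ge0 => [|x]; [exact: idomM (idomP _) (idomP _)|rewrite -expr2 sqr_ge0]. Qed.

Lemma iip_sh w F G : iip (ish w F) (ish w G) = iip F G.
Proof. by rewrite /iip -(itg_sh w (idomM (idomP F) (idomP G))). Qed.

Lemma ishD w F G : ish w (F + G) = ish w F + ish w G.
Proof. exact: ifun_eq. Qed.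

Lemma ishZ w c F : ish w (c *: F) = c *: ish w F.
Proof. exact: ifun_eq. Qed.

Lemma ish_add v w F : ish (v + w) F = ish v (ish w F).
Proof. by apply: ifun_eq => x; rewrite !ishE [v + w]addrC addrA addrAC. Qed.

Lemma ish0 F : ish 0 F = F.
Proof. by apply: ifun_eq => x; rewrite ishE addr0. Qed.

Canonical ispace : l2space R E :=
  @L2space R E ltac:(let t := constr:(ifun : lmodType R) in
    let t := eval cbv beta delta [reverse_coercion] in t in exact t) iip ish iipC iipDl iipZl iip_ge0 ishD ishZ ish_add ish0 iip_sh.

End Functions.

Section Products.
Variables (R : realType) (E : normedModType R) (J : invint R E).
Let H := ispace J.
Implicit Types (F G X Y : ifun J) (Ws : seq (ifun J)).

Lemma shE w F x : (sh w F : ifun J) x = F (x + w).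
Proof. by []. Qed.

Lemma ipE F G : ip F G = itg J (fun x => F x * G x).
Proof. by []. Qed.

Lemma avgE I (s : seq I) (f : I -> H) x : (avg s f : ifun J) x = rmean s (fun i => (f i : ifun J) x).
Proof. by rewrite /avg ivalZ (ival_sum s (f : I -> ifun J)). Qed.

Definition bprod Ws (x : E) : R := \prod_(W <- Ws) W x.

(** The empty product is the constant 1, which is not integrable on the whole space; hence the
    separate head here and below. *)
Lemma idom_bprod W Ws : idom J (bprod (W :: Ws)).
Proof.
elim: Ws W => [|V Ws IH] W.
  have := idomP W; congr idom; apply/funext => x.
  by rewrite /bprod big_cons big_nil mulr1.
have := idomM (idomP W) (IH V); congr idom; apply/funext => x.
by rewrite [RHS]/bprod big_cons.
Qed.

Definition ipr Ws : R := itg J (bprod Ws).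

Definition ifprod W Ws : ifun J := mkifun (idom_bprod W Ws).

Definition unitf F := forall x, 0 <= F x <= 1.

Lemma nrm_mono F G : (forall x, `|F x| <= `|G x|) -> nrm F <= nrm G.
Proof.
move=> FG; rewrite /nrm ler_wsqrtr// !ipE; apply: itg_le.
- exact: idomM (idomP _) (idomP _).
- exact: idomM (idomP _) (idomP _).
move=> x; rewrite -!expr2 -[F x ^+ 2]real_normK ?num_real// -[G x ^+ 2]real_normK ?num_real//.
by rewrite ler_sqr ?nnegrE.
Qed.

Lemma bprod_unit Ws x : (forall W, W \in Ws -> unitf W) -> 0 <= bprod Ws x <= 1.
Proof.
elim: Ws => [|W Ws IH] h; first by rewrite /bprod big_nil ler01 lexx.
rewrite /bprod big_cons -/(bprod Ws x).
have /andP[a0 a1] := h W (mem_head _ _) x.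
have /andP[b0 b1] : 0 <= bprod Ws x <= 1 by apply: IH => V VWs; apply: h; rewrite inE VWs orbT.
by rewrite mulr_ge0//= mulr_ile1.
Qed.

Lemma ipr_cons X W Ws : ipr (X :: W :: Ws) = ip X (ifprod W Ws).
Proof. by rewrite ipE; apply: itg_eq => x; rewrite /bprod big_cons. Qed.

Lemma ipr_perm Ws Vs : perm_eq Ws Vs -> ipr Ws = ipr Vs.
Proof. by move=> p; apply: itg_eq => x; exact: perm_big. Qed.

Lemma itg_avg I (s : seq I) (f : I -> ifun J) :
  itg J (avg s (f : I -> H) : ifun J) = rmean s (fun i => itg J (f i)).
Proof.
have dsum (t : seq I) : idom J (fun x => \sum_(i <- t) f i x) /\
    itg J (fun x => \sum_(i <- t) f i x) = \sum_(i <- t) itg J (f i).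
  elim: t => [|i t [IHd IH]].
    split; last by rewrite big_nil -[RHS](itg_cst0 J); apply: itg_eq => x; rewrite big_nil.
    by have := idom0 J; congr idom; apply/funext => x; rewrite big_nil.
  split; last first.
    by rewrite big_cons -IH -(itgD (idomP (f i)) IHd); apply: itg_eq => x; rewrite big_cons.
  have := idom_lin 1 (idomP (f i)) IHd; congr idom; apply/funext => x.
  by rewrite big_cons mul1r.
have [d e] := dsum s; rewrite /rmean -e -itgZ//.
by apply: itg_eq => x; rewrite avgE.
Qed.

Lemma ipr_avg I (s : seq I) (f : I -> H) Ws :
  ipr ((avg s f : ifun J) :: Ws) = rmean s (fun i => ipr ((f i : ifun J) :: Ws)).
Proof.
case: Ws => [|W Ws]; last by rewrite ipr_cons ip_avgl; apply: eq_rmean => i; rewrite ipr_cons.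
rewrite /ipr (@itg_eq _ _ J _ (avg s f : ifun J)); last by move=> x; rewrite /bprod big_seq1.
rewrite itg_avg; apply: eq_rmean => i; apply: itg_eq => x; by rewrite /bprod big_seq1.
Qed.

Definition cl (mu : R) F := unitf F /\ nrm F <= mu.

Lemma nrm_ifprod mu W Ws : (forall V, V \in W :: Ws -> cl mu V) -> nrm (ifprod W Ws) <= mu.
Proof.
move=> h; apply: le_trans (_ : nrm W <= _); last by case: (h W (mem_head _ _)).
have hu V : V \in W :: Ws -> unitf V by move=> /h[].
apply: nrm_mono => x; have /andP[W0 W1] := hu W (mem_head _ _) x.
have /andP[b0 b1] : 0 <= bprod (W :: Ws) x <= 1 by apply: bprod_unit.
rewrite !ger0_norm// [leLHS]/= /bprod big_cons ler_piMr//.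
have /andP[] // : 0 <= bprod Ws x <= 1.
by apply: bprod_unit => V VW; apply: hu; rewrite inE VW orbT.
Qed.

(** The other factors have values in [0, 1], so their product has norm at most that of [W]. At least
    one other factor is needed to gain this second [mu]. *)
Lemma ipr_diff mu X Y W Ws : (forall V, V \in W :: Ws -> cl mu V) ->
  `|ipr (X :: W :: Ws) - ipr (Y :: W :: Ws)| <= mu * nrm (X - Y : ifun J).
Proof.
move=> h; rewrite !ipr_cons -ipNl -ipDl; apply: le_trans (ip_nrm _ _) _.
by rewrite mulrC ler_wpM2r ?nrm_ge0// nrm_ifprod.
Qed.

Lemma ipr_nseq_diff mu X Y a : (1 < a)%N -> cl mu X -> cl mu Y ->
  `|ipr (nseq a X) - ipr (nseq a Y)| <= a%:R * (mu * nrm (X - Y : ifun J)).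
Proof.
move=> a1 cX cY.
suff h k Ws : (forall V, V \in Ws -> V = Y) -> (1 < size Ws + k)%N ->
    `|ipr (nseq k X ++ Ws) - ipr (nseq k Y ++ Ws)| <= k%:R * (mu * nrm (X - Y : ifun J)).
  by have := h a [::]; rewrite !cats0; apply.
elim: k Ws => [|k IH] Ws WsY sk; first by rewrite subrr normr0 mul0r.
have pY (Z : ifun J) : perm_eq (nseq k Z ++ Y :: Ws) (Y :: nseq k Z ++ Ws).
  by rewrite perm_catC /= perm_cons perm_catC.
apply: le_trans (ler_distD (ipr (nseq k X ++ Y :: Ws)) _ _) _.
rewrite -natr1 mulrDl mul1r [leRHS]addrC; apply: lerD.
  rewrite (ipr_perm (pY X)) /=.
  have : (0 < size (nseq k X ++ Ws))%N by move: sk; rewrite size_cat size_nseq addnS ltnS addnC.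
  have : forall V, V \in nseq k X ++ Ws -> cl mu V.
    by move=> V; rewrite mem_cat => /orP[/nseqP[->]//|/WsY ->].
  by case: (nseq k X ++ Ws) => // W Vs h _; exact: ipr_diff.
rewrite [ipr (nseq k.+1 Y ++ Ws)](_ : _ = ipr (nseq k Y ++ Y :: Ws)).
  apply: IH; last by rewrite /= addSn -addnS.
  by move=> V; rewrite inE => /orP[/eqP //|/WsY].
by apply: ipr_perm; rewrite perm_sym.
Qed.

(** The default 0 can be taken only for the empty list. *)
Definition tup (s : seq E) F : ifun J := insubd 0 (fun x => \prod_(d <- s) F (x + d)).

Lemma tup_ifprod d s F : tup (d :: s) F = ifprod (sh d F) [seq sh e F | e <- s].
Proof.
apply: val_inj; rewrite val_insubd.
have -> : (fun x => \prod_(j <- d :: s) F (x + j)) = bprod [seq (sh e F : ifun J) | e <- d :: s].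
  by apply/funext => x; rewrite /bprod big_map.
by rewrite ifT//; exact/asboolP/idom_bprod.
Qed.

Lemma tupE s F x : s != [::] -> tup s F x = \prod_(d <- s) F (x + d).
Proof. by case: s => // d s _; rewrite tup_ifprod /= /bprod -(map_cons (fun e => sh e F : ifun J)) big_map. Qed.

Lemma itg_tup s F : s != [::] -> itg J (tup s F) = ipr [seq (sh d F : ifun J) | d <- s].
Proof. by case: s => // d s _; rewrite tup_ifprod. Qed.

Lemma tup_unit s F : s != [::] -> unitf F -> unitf (tup s F).
Proof.
case: s => // d s _ Fu x; rewrite tup_ifprod; apply: bprod_unit => W.
by rewrite -(map_cons (fun e => sh e F : ifun J)) => /mapP[e _ ->] y; exact: Fu.
Qed.

Lemma tup_cl mu s F : s != [::] -> cl mu F -> cl mu (tup s F).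
Proof.
move=> s0 [Fu Fm]; split; first exact: tup_unit.
case: s s0 => // d s _; rewrite tup_ifprod; apply: nrm_ifprod => V.
rewrite -(map_cons (fun e => sh e F : ifun J)) => /mapP[e _ ->]; split; first by move=> x; exact: Fu.
by rewrite nrm_sh.
Qed.

Lemma cl_av mu D F : (0 < size D)%N -> cl mu F -> cl mu (av D F : ifun J).
Proof.
move=> D0 [Fu Fm]; split; last by apply: le_trans (nrm_av _ _) _.
move=> x; rewrite avgE rmean_ge0/=; last by move=> d; case/andP: (Fu (x + d)).
by rewrite -[leRHS](rmean_cst 1 D0); apply: rmean_le => d; case/andP: (Fu (x + d)).
Qed.

(** The product rule for differences, all factors being at most 1. *)
Lemma tup_modulus s F w : s != [::] -> unitf F ->
  nrm (sh w (tup s F) - tup s F) <= (size s)%:R * nrm (sh w F - F).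
Proof.
move=> s0 Fu.
case: s s0 => // d s _; elim: s d => [|e s IH] d.
  rewrite mul1r -(nrm_sh d (sh w F - F)) shB shC.
  have -> : tup [:: d] F = sh d F by apply: ifun_eq => x; rewrite tupE// big_seq1.
  by [].
pose K := tup (e :: s) F.
have Ku : unitf K by exact: tup_unit.
have tK x : tup [:: d, e & s] F x = F (x + d) * K x by rewrite /K !tupE// big_cons.
have -> : sh w (tup [:: d, e & s] F) - tup [:: d, e & s] F =
    (mkifun (idomM (idomP (sh d (sh w F - F))) (idomP (sh w K)))
    + mkifun (idomM (idomP (sh d F)) (idomP (sh w K - K))) : ifun J).
  apply: ifun_eq => x; transitivity (F (x + w + d) * K (x + w) - F (x + d) * K x).
    by rewrite -!tK.
  transitivity ((F (x + d + w) - F (x + d)) * K (x + w) + F (x + d) * (K (x + w) - K x)) => //.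
  by rewrite (addrAC x w d); ring.
apply: le_trans (nrmD _ _) _; rewrite -[(size _)%:R]natr1 mulrDl mul1r addrC.
apply: lerD.
  apply: le_trans (IH e); apply: nrm_mono => x /=; rewrite normrM ler_piMl//.
  by have /andP[x0 x1] := Fu (x + d); rewrite ger0_norm.
rewrite -(nrm_sh d (sh w F - F)); apply: nrm_mono => x /=; rewrite normrM ler_piMr//.
by have /andP[x0 x1] := Ku (x + w); rewrite ger0_norm.
Qed.

End Products.

(** * Rotations fixing all vertices but one *)

Section Frame.
Variables (R : realType) (m : nat) (v : 'I_m -> 'rV[R]_m).
Hypothesis v_indep : affinely_independent v.

Lemma dot_mx (u w : 'rV[R]_m) : u *m w^T = (dot u w)%:M.
Proof. by apply/matrixP => i j; rewrite !ord1 !mxE eqxx mulr1n; apply: eq_bigr => k _; rewrite !mxE. Qed.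

Lemma normalize (u : 'rV[R]_m) : u != 0 -> exists2 c : R, 0 < c & dot (c *: u) (c *: u) = 1.
Proof.
rewrite -dot_eq0 => u0; have up : 0 < dot u u by rewrite lt_def u0 dot_ge0.
exists (Num.sqrt (dot u u))^-1; first by rewrite invr_gt0 sqrtr_gt0.
by rewrite dotZl dotZr mulrA -invfM -expr2 sqr_sqrtr ?mulVf// ltW.
Qed.

(** The [m] points span only a hyperplane: [q] is its unit normal and [p] is the normal, within it,
    of the facet opposite to [v k]. The rotations about [o] in the plane of [p] and [q] therefore
    fix that facet and move [v k] on a circle of radius [a0]. *)
Lemma frame (k : 'I_m) : (1 < m)%N -> exists (p q o : 'rV[R]_m) (a0 : R),
  [/\ 0 < a0, [/\ dot p p = 1, dot q q = 1 & dot p q = 0], v k = o + a0 *: p &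
    forall a, a != k -> dot (v a - o) p = 0 /\ dot (v a - o) q = 0].
Proof.
move=> m1; have key (p q W D : 'rV[R]_m) : dot p p = 1 -> dot q p = 0 ->
    dot W p = 0 -> dot W q = 0 -> dot D q = 0 ->
    dot (W - D + dot D p *: p) p = 0 /\ dot (W - D + dot D p *: p) q = 0.
  move=> p1 qp h1 h2 h3; rewrite !dotDl !dotNl !dotZl h1 h2 h3 p1 [dot p q]dotC qp; split; ring.
have [b0 b0k] : exists b0 : 'I_m, b0 != k.
  have : (0 < #|predC1 k|)%N by rewrite cardC1 card_ord -ltnS prednK// ltnW.
  by case/card_gt0P => b bk; exists b.
pose w a := v a - v b0.
have [q q1 qw] : exists2 q : 'rV[R]_m, dot q q = 1 & forall a, dot (w a) q = 0.
  (* Row [b0] vanishes, so [W] is singular and some vector is orthogonal to all its rows. *)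
  pose W : 'M[R]_m := \matrix_a w a.
  have : kermx W^T != 0.
    rewrite kermx_eq0 row_free_unit unitmx_tr -row_free_unit; apply/negP => /row_freeP[V WV].
    have : row b0 (W *m V) = 0 by rewrite row_mul rowK /w subrr mul0mx.
    rewrite WV => /rowP/(_ b0); rewrite !mxE eqxx => /eqP; by rewrite oner_eq0.
  case/rowV0Pn => q /sub_kermxP qW /normalize[c c0 cq]; exists (c *: q) => // a.
  rewrite dotZr dotC; have /rowP/(_ a) := qW; rewrite !mxE => h.
  rewrite (_ : dot q (w a) = 0) ?mulr0// -[RHS]h; apply: eq_bigr => i _; by rewrite !mxE.
pose d := w k.
(* If [d] were a combination of the rows of [B], orthogonality to [q] would remove row [k] and leave
   an affine relation between the vertices. So some vector is orthogonal to the rows of [B] but not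
   to [d]. *)
pose B : 'M[R]_m := \matrix_a (if a == k then q else w a).
have dB : ~~ (d <= B)%MS.
  apply/negP => /submxP[c dE].
  have dsum : d = \sum_a c 0 a *: (if a == k then q else w a).
    by rewrite dE mulmx_sum_row; apply: eq_bigr => a _; rewrite rowK.
  have ck : c 0 k = 0.
    have := qw k; rewrite -/d dsum (bigD1 k)//= eqxx dotDl dotZl q1 mulr1.
    suff -> : dot (\sum_(i | i != k) c 0 i *: (if i == k then q else w i)) q = 0 by rewrite addr0.
    elim/big_rec: _ => [|i x ik IH]; first by rewrite -(scale0r q) dotZl mul0r.
    by rewrite dotDl IH (negPf ik) dotZl qw mulr0 addr0.
  pose c' a := if a == k then 0 else c 0 a.
  (* The last term accounts for the base point [v b0] of the edges and brings the sum of the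
     coefficients to 0. *)
  pose e a := c' a - (a == k)%:R + (1 - \sum_b c' b) * (a == b0)%:R.
  have dirac (x : 'I_m) : \sum_a (a == x)%:R = 1 :> R.
    by rewrite (bigD1 x)//= eqxx big1 ?addr0// => a /negPf ->.
  have diracv (x : 'I_m) : \sum_a (a == x)%:R *: v a = v x.
    rewrite (bigD1 x)//= eqxx scale1r big1 ?addr0// => a /negPf ->; by rewrite scale0r.
  have e0 : \sum_a e a = 0.
    by rewrite !big_split/= sumrN -mulr_sumr !dirac; ring.
  have ev : \sum_a e a *: v a = 0.
    under eq_bigr do rewrite !scalerDl scaleNr -scalerA.
    rewrite !big_split/= sumrN -scaler_sumr !diracv scalerBl scale1r scaler_suml.
    apply/eqP; rewrite addrACA -addrA; apply/eqP.
    transitivity (\sum_a c' a *: w a - d).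
      rewrite /w; under [X in _ = X - _]eq_bigr do rewrite scalerBr.
      rewrite sumrB /d /w; move: (\sum_i c' i *: v i) (\sum_i c' i *: v b0) => S T.
      by apply/rowP => i; rewrite !mxE; ring.
    rewrite dsum (bigD1 k)//= [X in _ - X](bigD1 k)//= eqxx /c' eqxx ck !scale0r !add0r.
    by apply/eqP; rewrite subr_eq0; apply/eqP/eq_bigr => a ak; rewrite (negPf ak).
  have := v_indep e0 ev k; rewrite /e /c' eqxx eq_sym (negPf b0k) => /eqP.
  by rewrite mulr0 sub0r addr0 oppr_eq0 oner_eq0.
have [p0 dp0 p0B] : exists2 p0 : 'rV[R]_m, dot d p0 != 0 & forall a, dot (if a == k then q else w a) p0 = 0.
  move: dB; rewrite submxE => /rV0Pn[j dj].
  exists (col j (cokermx B))^T.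
    apply: contra dj => /eqP dj; apply/eqP; rewrite -[RHS]dj !mxE; apply: eq_bigr => i _; by rewrite !mxE.
  move=> a; have /matrixP/(_ a j) := mulmx_coker B; rewrite !mxE => h; rewrite -[RHS]h.
  by apply: eq_bigr => i _; rewrite !mxE.
have p00 : p0 != 0.
  apply: contraNneq dp0 => ->; by rewrite -(scale0r (0 : 'rV[R]_m)) dotZr mul0r.
have [c c0 cp] := normalize p00.
(* The sign points [p] towards [v k], so that the radius is positive. *)
pose s : R := Num.sg (dot d p0).
pose p := (s * c) *: p0.
have s2 : s * s = 1 by rewrite -expr2 sqr_sg dp0.
have p1 : dot p p = 1.
  rewrite -[RHS]cp !dotZl !dotZr; transitivity ((s * s) * (c * (c * dot p0 p0))); first by ring.
  by rewrite s2 mul1r.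
have a00 : 0 < dot d p.
  rewrite dotZr (_ : s * c * _ = c * (s * dot d p0)); last by ring.
  by rewrite mulr_gt0// /s -normrEsg normr_gt0.
have pB a : dot (if a == k then q else w a) p = 0 by rewrite dotZr p0B mulr0.
have qp : dot q p = 0 by have := pB k; rewrite eqxx.
exists p, q, (v k - dot d p *: p), (dot d p); split => //; first by split; rewrite // dotC.
  by rewrite subrK.
move=> a ak; have -> : v a - (v k - dot d p *: p) = w a - d + dot d p *: p.
  by move: (dot d p) => x; rewrite /d /w; apply/rowP => i; rewrite !mxE; ring.
have := pB a; rewrite (negPf ak) => wp.
by apply: key => //; exact: qw.
Qed.

End Frame.

Section Rotation.
Variables (R : realType) (m : nat).
Implicit Types (p q o u x y : 'rV[R]_m) (f g : 'rV[R]_m -> 'rV[R]_m).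

(** Affinity is part of the definition, as it lets an isometry carry [cur] to a curve of the same
    form. *)
Definition aiso g :=
  (forall x y, dot (g x - g y) (g x - g y) = dot (x - y) (x - y)) /\
  (forall x u y (a b : R), g (x + (a *: u + b *: y)) = g x + (a *: (g u - g 0) + b *: (g y - g 0))).

Lemma aiso_id : aiso id.
Proof. by split => // x u y a b; rewrite !subr0. Qed.

Lemma aiso_comp f g : aiso f -> aiso g -> aiso (f \o g).
Proof.
move=> [fi fa] [gi ga]; split => [x y|x u y a b] /=; first by rewrite fi gi.
have fl z : f (g z - g 0) - f 0 = f (g z) - f (g 0).
  have := fa (g 0) (g z - g 0) 0 1 0; rewrite scale1r !scale0r !addr0 scale1r.
  by rewrite addrC subrK => ->; rewrite [RHS]addrC addrA addNr add0r.
by rewrite ga fa !fl.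
Qed.

Definition rot p q o (t : R) x :=
  let y := x - o in x + ((ccos t - 1) * dot y p - csin t * dot y q) *: p
     + (csin t * dot y p + (ccos t - 1) * dot y q) *: q.

Lemma rot_iso p q o t : dot p p = 1 -> dot q q = 1 -> dot p q = 0 -> aiso (rot p q o t).
Proof.
move=> p1 q1 pq; have qp : dot q p = 0 by rewrite dotC.
have sq z (al be : R) : dot (z + al *: p + be *: q) (z + al *: p + be *: q) =
    dot z z + al ^+ 2 + be ^+ 2 + 2 * al * dot z p + 2 * be * dot z q.
  rewrite !dotDl !dotDr !dotZl !dotZr p1 q1 pq qp (dotC p z) (dotC q z); ring.
split.
  move=> x y; set z := x - y.
  have -> : rot p q o t x - rot p q o t y = z + ((ccos t - 1) * dot z p - csin t * dot z q) *: p
     + (csin t * dot z p + (ccos t - 1) * dot z q) *: q.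
    by rewrite /rot /z !dotE; apply/rowP => i; rewrite !mxE; ring.
  have cs := ccos_csin t.
  rewrite sq; move: (dot z p) (dot z q) (dot z z) => A B D.
  have -> : csin t * A + (ccos t - 1) * B = (ccos t - 1) * B + csin t * A by rewrite addrC.
  transitivity (D + (ccos t ^+ 2 + csin t ^+ 2 - 1) * (A ^+ 2 + B ^+ 2)); first by ring.
  by rewrite cs subrr mul0r addr0.
move=> x u y a b; have d0 z : dot (0 : 'rV[R]_m) z = 0 by rewrite -(scale0r z) dotZl mul0r.
rewrite /rot !dotE !d0; apply/rowP => i; rewrite !mxE; ring.
Qed.

Lemma rot_fix p q o t x : dot (x - o) p = 0 -> dot (x - o) q = 0 -> rot p q o t x = x.
Proof. by move=> h1 h2; rewrite /rot h1 h2 !mulr0 subrr addr0 !scale0r !addr0. Qed.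

Lemma rot_cur p q o (a0 t : R) : dot p p = 1 -> dot p q = 0 ->
  rot p q o t (o + a0 *: p) = o + cur a0 p q t.
Proof.
move=> p1 pq; rewrite /rot /cur.
have -> : o + a0 *: p - o = a0 *: p by rewrite addrAC subrr add0r.
by rewrite !dotZl p1 pq; apply/rowP => i; rewrite !mxE; ring.
Qed.

Lemma aiso_cur g o p q (a0 t : R) : aiso g ->
  g (o + cur a0 p q t) = g o + cur a0 (g p - g 0) (g q - g 0) t.
Proof. by move=> [_ ga]; rewrite ga. Qed.

Lemma aiso_unit g p : aiso g -> dot p p = 1 -> dot (g p - g 0) (g p - g 0) = 1.
Proof. by move=> [gi _]; rewrite gi subr0. Qed.

Lemma dot_add_le x y : dot (x + y) (x + y) <= 2 * dot x x + 2 * dot y y.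
Proof.
have := dot_ge0 (x - y); rewrite !dotE [dot y x]dotC; lra.
Qed.

Lemma aiso_bound g x : aiso g -> dot (g x) (g x) <= 2 * dot x x + 2 * dot (g 0) (g 0).
Proof.
move=> [gi _]; rewrite -[g x](subrK (g 0)); apply: le_trans (dot_add_le _ _) _.
by rewrite gi subr0.
Qed.

End Rotation.

(** * Moving the vertices of a configuration one after the other *)

Section Configurations.
Variables (R : realType) (E : normedModType R) (J : invint R E).
Variables (m : nat) (io : {linear 'rV[R]_m -> E}).
Let H := ispace J.

Definition lists (I : eqType) (T : Type) (grid : I -> seq T) : seq I -> seq (seq T) :=
  fix F ks := if ks is k :: ks' then [seq t :: ts | t <- grid k, ts <- F ks'] else [:: [::]].

Lemma lists_size (I : eqType) (T : Type) (grid : I -> seq T) ks :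
  (forall k, 0 < size (grid k))%N -> (0 < size (lists grid ks))%N.
Proof. by move=> g0; elim: ks => //= k ks IH; rewrite size_allpairs muln_gt0 g0. Qed.

Lemma lists_mem_size (I : eqType) (T : eqType) (grid : I -> seq T) ks ts :
  ts \in lists grid ks -> size ts = size ks.
Proof.
elim: ks ts => [|k ks IH] ts /=; first by rewrite inE => /eqP ->.
by case/allpairsP => -[t ts'] [_ /IH /= h ->] /=; rewrite h.
Qed.

Lemma rmean_lists (I : eqType) (T : Type) (grid : I -> seq T) k ks (f : seq T -> R) :
  rmean (lists grid (k :: ks)) f = rmean (grid k) (fun t => rmean (lists grid ks) (fun ts => f (t :: ts))).
Proof. exact: rmean_allpairs. Qed.

(* The vertices are moved one at a time: the rotation Rt k fixes all vertices
   but the k-th, and is applied inside those of the previous indices. *)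
Variables (v : 'I_m -> 'rV[R]_m) (Rt : 'I_m -> R -> 'rV[R]_m -> 'rV[R]_m).
Hypothesis Rt_iso : forall k t, aiso (Rt k t).
Hypothesis Rt_fix : forall k t a, a != k -> Rt k t (v a) = v a.

Fixpoint conf (ks : seq 'I_m) (ts : seq R) (g : 'rV[R]_m -> 'rV[R]_m) : seq 'rV[R]_m :=
  match ks, ts with
  | k :: ks', t :: ts' => g (Rt k t (v k)) :: conf ks' ts' (g \o Rt k t)
  | _, _ => [::]
  end.

(** [h] is the composite of [g] with all the rotations: those applied inside the [k]-th one fix
    [v k], so that all vertices are images under the same isometry. *)
Lemma conf_iso ks ts g : uniq ks -> size ts = size ks -> aiso g ->
  exists h, [/\ aiso h, conf ks ts g = [seq h (v k) | k <- ks] &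
    forall a, a \notin ks -> h (v a) = g (v a)].
Proof.
elim: ks ts g => [|k ks IH] [|t ts] g //=; first by exists g.
move=> /andP[kks us] [st] gi.
have [h [hi hc hf]] := IH ts (g \o Rt k t) us st (aiso_comp gi (Rt_iso k t)).
exists h; split => //; first by rewrite hc hf.
by move=> a; rewrite inE negb_or => /andP[ak aks]; rewrite hf//= Rt_fix.
Qed.

Variables (F G : ifun J) (mu lam : R) (grid : 'I_m -> seq R) (z : nat -> 'rV[R]_m).
Hypothesis F_cl : cl mu F.
Hypothesis G_cl : cl mu G.
Hypothesis grid0 : forall k, (0 < size (grid k))%N.

Let X i y : ifun J := sh (io (lam *: refl (z i) y)) F.

Definition cerr i k (g : 'rV[R]_m -> 'rV[R]_m) : R :=
  nrm (avg (grid k) (fun t => X i (g (Rt k t (v k))) : H) - G).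

Fixpoint terr i ks g : R := if ks is k :: ks' then
  rmean (grid k) (fun t => terr i ks' (g \o Rt k t)) + cerr i k g else 0.

Lemma X_cl i y : cl mu (X i y).
Proof. by case: F_cl => Fu Fm; split; [move=> x; exact: Fu|rewrite nrm_sh]. Qed.

(* The last vertex is replaced first, the previous ones being then frozen. *)
Lemma telescope i ks g Ws : (forall W, W \in Ws -> cl mu W) -> (1 < size ks + size Ws)%N ->
  `|rmean (lists grid ks) (fun ts => ipr (map (X i) (conf ks ts g) ++ Ws))
    - ipr (nseq (size ks) G ++ Ws)| <= mu * terr i ks g.
Proof.
elim: ks g Ws => [|k ks IH] g Ws Wc s1.
  by rewrite /= rmean_cst//= subrr normr0 mulr0.
rewrite rmean_lists.
pose K t := ipr (nseq (size ks) G ++ X i (g (Rt k t (v k))) :: Ws).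
have step : `|rmean (grid k) K - ipr (nseq (size ks).+1 G ++ Ws)| <= mu * cerr i k g.
  have perm Y : ipr (nseq (size ks) G ++ Y :: Ws) = ipr (Y :: (nseq (size ks) G ++ Ws)).
    by apply: ipr_perm; rewrite perm_catC /= perm_cons perm_catC.
  have -> : rmean (grid k) K = ipr ((avg (grid k) (fun t => X i (g (Rt k t (v k))) : H) : ifun J) :: (nseq (size ks) G ++ Ws)).
    by rewrite ipr_avg; apply: eq_rmean => t; exact: perm.
  have : (0 < size (nseq (size ks) G ++ Ws))%N by rewrite size_cat size_nseq; move: s1; rewrite /= addSn ltnS.
  have : forall W, W \in nseq (size ks) G ++ Ws -> cl mu W.
    by move=> W; rewrite mem_cat => /orP[/nseqP[->]//|/Wc].
  rewrite (_ : nseq (size ks).+1 G ++ Ws = G :: (nseq (size ks) G ++ Ws))//.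
  by case: (nseq (size ks) G ++ Ws) => // W Vs h _; exact: ipr_diff.
rewrite /= mulrDr; apply: le_trans (ler_distD (rmean (grid k) K) _ _) _.
apply: lerD step; rewrite -rmeanB -rmeanZ; apply: le_trans (rmean_norm _ _) _.
apply: rmean_le => t; have := IH (g \o Rt k t) (X i (g (Rt k t (v k))) :: Ws).
move=> /(_ _ _) h; apply: le_trans (h _ _); last 2 first.
- by move=> W; rewrite inE => /orP[/eqP ->|/Wc//]; exact: X_cl.
- by move: s1; rewrite /= addSn addnS.
rewrite le_eqVlt; apply/orP; left; apply/eqP; congr (`| _ - _|).
apply: eq_rmean => ts; apply: ipr_perm.
by rewrite perm_sym perm_catC /= perm_cons perm_catC.
Qed.

(** The single vertex estimate is available only while the isometry moves the origin by a bounded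
    amount; [b n] is that bound after [n] rotations. *)
Lemma terr_bound r ks j (b : nat -> R) e : 
  (forall g k t n, aiso g -> dot (g 0) (g 0) <= b n -> dot (g (Rt k t 0)) (g (Rt k t 0)) <= b n.+1) ->
  (forall g k n, aiso g -> dot (g 0) (g 0) <= b n -> (n <= m)%N ->
     rmean (iota 0 r) (fun i => cerr i k g) <= e) -> 
  forall g, aiso g -> dot (g 0) (g 0) <= b j -> (j + size ks <= m)%N ->
  rmean (iota 0 r) (fun i => terr i ks g) <= (size ks)%:R * e.
Proof.
move=> bs be; elim: ks j => [|k ks IH] j g gi gj jm.
  by rewrite /= mul0r (_ : rmean _ _ = 0)// /rmean big1 ?mulr0.
rewrite /= rmeanD -[(size ks).+1%:R]natr1 mulrDl mul1r; apply: lerD; last first.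
  by apply: (be _ _ j) => //; apply: leq_trans jm; rewrite leq_addr.
rewrite exchange_rmean -[leRHS](rmean_cst _ (grid0 k)); apply: rmean_le => t.
apply: (IH j.+1); rewrite ?addSnnS//=; last exact: bs.
exact: aiso_comp.
Qed.

End Configurations.

(** * One simplex *)

Section Powers.
Variables (R : realType) (E : normedModType R) (J : invint R E).
Let H := ispace J.
Implicit Types (F G X Y chi : ifun J) (D : seq E).

(** The left side is the tangent of the power at [c]. *)
Lemma tangent_power (a : nat) (u c : R) : 0 <= u -> 0 <= c ->
  a.+1%:R * c ^+ a * u - a%:R * c ^+ a.+1 <= u ^+ a.+1.
Proof.
move=> u0 c0; elim: a => [|a IH]; first by rewrite expr0 expr1; lra.
have ca : 0 <= c ^+ a by exact: exprn_ge0.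
have h : u * (a.+1%:R * c ^+ a * u - a%:R * c ^+ a.+1) <= u ^+ a.+2 by rewrite [leRHS]exprS ler_wpM2l.
apply: le_trans h; rewrite -subr_ge0.
have -> : u * (a.+1%:R * c ^+ a * u - a%:R * c ^+ a.+1) -
   (a.+2%:R * c ^+ a.+1 * u - a.+1%:R * c ^+ a.+2) = a.+1%:R * c ^+ a * (u - c) ^+ 2.
  by rewrite !exprS -[in a.+2%:R]natr1 -!natr1; ring.
by rewrite mulr_ge0 ?sqr_ge0// mulr_ge0.
Qed.

Lemma rmean_power (I : eqType) (s : seq I) (x : I -> R) (a : nat) :
  (forall i, i \in s -> 0 <= x i) ->
  rmean s x ^+ a.+1 <= rmean s (fun i => x i ^+ a.+1).
Proof.
move=> x0; have [s0|s0] := posnP (size s).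
  by rewrite /rmean s0 invr0 !mul0r expr0n.
have c0 : 0 <= rmean s x by rewrite mulr_ge0 ?invr_ge0// big_seq sumr_ge0.
set c := rmean s x.
apply: (@le_trans _ _ (rmean s (fun i => (a.+1%:R * c ^+ a) * x i - a%:R * c ^+ a.+1))); last first.
  by apply: rmean_le_in => i si; apply: tangent_power => //; exact: x0.
rewrite rmeanB rmeanZ rmean_cst// -/c -natr1 exprS le_eqVlt; apply/orP; left; apply/eqP; ring.
Qed.

Lemma bprod_nseq a X x : bprod (nseq a X) x = X x ^+ a.
Proof. by elim: a => [|a IH]; rewrite /bprod ?big_nil// big_cons exprS -/(bprod _ x) IH. Qed.

Lemma itg_sh_ifun w F : itg J (sh w F : ifun J) = itg J F.
Proof. exact: itg_sh (idomP F). Qed.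

Lemma itg_av D F : (0 < size D)%N -> itg J (av D F : ifun J) = itg J F.
Proof. by move=> D0; rewrite itg_avg -[RHS](rmean_cst _ D0); apply: eq_rmean => d; exact: itg_sh_ifun. Qed.

Lemma ipr1 F : ipr [:: F] = itg J F.
Proof. by apply: itg_eq => x; rewrite /bprod big_seq1. Qed.

Lemma ipr_nseq_av a D X : unitf X ->
  ipr (nseq a.+1 (av D X : ifun J)) <= ipr (nseq a.+1 X).
Proof.
move=> Xu; pose P := ifprod X (nseq a X).
have PE x : P x = X x ^+ a.+1 by rewrite -bprod_nseq.
have itP : itg J P = ipr (nseq a.+1 X) by [].
apply: (@le_trans _ _ (itg J (av D P : ifun J))).
  apply: itg_le; [exact: (idom_bprod _ (nseq a _))|exact: idomP|move=> x].
  rewrite bprod_nseq !avgE.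
  apply: le_trans (rmean_power _ _) _; first by move=> d _; case/andP: (Xu (x + d)).
  by apply: rmean_le => d; rewrite !shE PE.
rewrite -itP itg_avg; apply: le_trans (_ : rmean D (fun=> itg J P) <= _).
  by apply: rmean_le => d; rewrite itg_sh_ifun.
apply: rmean_cst_le; apply: itg_ge0 => [|x]; first exact: idomP.
by rewrite PE exprn_ge0//; case/andP: (Xu x).
Qed.

(* Jensen's inequality, by integrating the tangent line of the power at the mean
   value of X on the support of chi. *)
Lemma ipr_nseq_lower a X chi (V : R) : 0 < V -> unitf X -> (forall x, 0 <= chi x) ->
  (forall x, X x != 0 -> chi x = 1) -> itg J chi <= V ->
  V * (itg J X / V) ^+ a.+1 <= ipr (nseq a.+1 X).
Proof.
move=> V0 Xu chi0 chi1 chiV.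
have X0 x : 0 <= X x by case/andP: (Xu x).
have IX0 : 0 <= itg J X by apply: itg_ge0 => //; exact: idomP.
have t0 : 0 <= itg J X / V by rewrite divr_ge0// ltW.
set t := itg J X / V in t0 *.
have IX : itg J X = t * V by rewrite /t divfK ?gt_eqF.
have ta : 0 <= t ^+ a.+1 by exact: exprn_ge0.
apply: (@le_trans _ _ ((a.+1%:R * t ^+ a) * itg J X - (a%:R * t ^+ a.+1) * itg J chi)).
  have h : (a%:R * t ^+ a.+1) * itg J chi <= (a%:R * t ^+ a.+1) * V by rewrite ler_wpM2l// mulr_ge0.
  have e : a.+1%:R * t ^+ a * itg J X = (a%:R * t ^+ a.+1) * V + V * t ^+ a.+1.
    by rewrite IX -natr1 exprS; ring.
  by lra.
have Y : idom J (fun x => (a.+1%:R * t ^+ a) * X x - (a%:R * t ^+ a.+1) * chi x).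
  exact: (idomP (((a.+1%:R * t ^+ a) *: X - (a%:R * t ^+ a.+1) *: chi) : ifun J)).
have -> : (a.+1%:R * t ^+ a) * itg J X - (a%:R * t ^+ a.+1) * itg J chi =
    itg J (fun x => (a.+1%:R * t ^+ a) * X x - (a%:R * t ^+ a.+1) * chi x).
  rewrite -!itgZ ?itgB//; try exact: idomP.
  - exact: (idomP ((a.+1%:R * t ^+ a) *: X : ifun J)).
  - exact: (idomP ((a%:R * t ^+ a.+1) *: chi : ifun J)).
apply: itg_le => //; first exact: (idom_bprod _ (nseq a _)).
move=> x; rewrite bprod_nseq.
have [->|x0] := eqVneq (X x) 0.
  by rewrite mulr0 sub0r expr0n/= oppr_le0 mulr_ge0// mulr_ge0.
by rewrite chi1// mulr1; exact: tangent_power.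
Qed.

Fixpoint tups D a : seq (seq E) :=
  if a is a'.+1 then [seq d :: s | d <- D, s <- tups D a'] else [:: [::]].

Lemma tups_size D a s : s \in tups D a -> size s = a.
Proof.
elim: a s => [|a IH] s /=; first by rewrite inE => /eqP ->.
by case/allpairsP => -[d s'] [_ /IH /= h ->] /=; rewrite h.
Qed.

Lemma tups_mem D a s d : s \in tups D a -> d \in s -> d \in D.
Proof.
elim: a s => [|a IH] s /=; first by rewrite inE => /eqP ->.
case/allpairsP => -[d' s'] [/= dD /IH h ->]; rewrite inE => /orP[/eqP -> //|]; exact: h.
Qed.

Definition cntD D a F : R := rmean (tups D a) (fun s => itg J (tup s F)).

(** The shifts of the points of a tuple are independent, so that integrating over them produces a
    power of the local density [av D F]. *)
Lemma cntD_ipr D a F : cntD D a.+1 F = ipr (nseq a.+1 (av D F : ifun J)).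
Proof.
have gen b Ws : rmean (tups D b) (fun s => ipr ([seq (sh d F : ifun J) | d <- s] ++ Ws)) =
    ipr (nseq b (av D F : ifun J) ++ Ws).
  elim: b Ws => [|b IH] Ws; first by rewrite /rmean /= big_seq1 invr1 mul1r.
  rewrite /= rmean_allpairs (@ipr_avg _ _ J E D (fun d => sh d F)); apply: eq_rmean => d.
  have perm A (W : ifun J) : ipr (W :: A ++ Ws) = ipr (A ++ W :: Ws).
    by apply: ipr_perm; rewrite perm_sym perm_catC /= perm_cons perm_catC.
  by rewrite perm -IH; apply: eq_rmean => s; rewrite /= perm.
have := gen a.+1 [::]; rewrite cats0 => <-; rewrite /cntD /= !rmean_allpairs.
by apply: eq_rmean => d; apply: eq_rmean => s; rewrite itg_tup// cats0.
Qed.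

Lemma cntD_ipr_pos D a F : (0 < a)%N -> cntD D a F = ipr (nseq a (av D F : ifun J)).
Proof. by case: a => // a _; exact: cntD_ipr. Qed.

Lemma cntD1 D F : (0 < size D)%N -> cntD D 1 F = itg J F.
Proof. by move=> D0; rewrite cntD_ipr ipr1 itg_av. Qed.

Lemma cntD2 D F : cntD D 2 F = nrm (av D F) ^+ 2.
Proof.
by rewrite cntD_ipr nrm_sqr ipE; apply: itg_eq => x; rewrite bprod_nseq expr2.
Qed.

(** All that is known of a function when the copies are chosen. *)
Definition rclass (mu : R) (rho : R -> R) F := cl mu F /\
  forall b, 0 < b -> forall w, `|w| <= rho b -> nrm (sh w F - F) <= b.

End Powers.

Section Block.
Variables (R : realType) (E : normedModType R) (J : invint R E).
Let H := ispace J.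
Variables (m : nat) (io : {linear 'rV[R]_m -> E}).
Hypothesis io_norm : forall u, `|io u| <= `|u|.
Hypothesis m_gt0 : (0 < m)%N.

(* The grid of step eta with Km (resp. Kp) points on each side is much smaller
   (resp. larger) than lam. *)
Record scales (q : nat) (C lam : R) (rho : R -> R) (mu eta : R) (Km Kp : nat) : Prop := Scales {
  sc_eta : 0 < eta;
  sc_rho : q%:R * eta <= rho (mu / C);
  sc_Km0 : (0 < Km)%N;
  sc_Km : Km%:R * eta <= lam / C;
  sc_Kp : C * lam <= Kp%:R * eta;
  sc_Kp0 : C <= Kp%:R }.

Variables (q : nat).
Hypothesis m_le : (m <= q)%N.

(** The points of the small grid are short translations for the large one. *)
Lemma absorb C lam rho mu eta Km Kp (F : ifun J) : 1 <= C -> 0 < mu ->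
  scales q C lam rho mu eta Km Kp -> rclass mu rho F ->
  nrm (av (pgrid io eta Kp) (av (pgrid io eta Km) F) - av (pgrid io eta Kp) F : ifun J)
    <= (4 * m%:R + 1) / C * mu.
Proof.
move=> C1 mu0 [eta0 er Km0 Kml Kpl CKp] [[Fu Fm] Fr].
have C0 : 0 < C by lra.
have Kp0 : 0 < Kp%:R :> R by lra.
have s0 : (0 < size (pgrid io eta Km))%N by exact: pgrid_size.
have B0 : 0 <= (4 * m%:R + 1) / C * mu.
  by rewrite mulr_ge0 ?(ltW mu0)// divr_ge0 ?(ltW C0)// addr_ge0// mulr_ge0.
rewrite avC -[X in _ - X](avg_cst (av (pgrid io eta Kp) F) s0) -avgB.
apply: le_trans (nrm_avg _ _) _.
apply: (@le_trans _ _ (rmean (pgrid io eta Km) (fun=> (4 * m%:R + 1) / C * mu))); last exact: rmean_cst_le.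
apply: rmean_le_in => d /(mem_pgrid eta0)[h -> hk].
have me : m%:R * eta <= rho (mu / C) by apply: le_trans er; rewrite ler_pM2r// ler_nat.
have muC : 0 < mu / C by exact: divr_gt0.
apply: le_trans (@sh_pgrid R E H m io io_norm eta (rho (mu / C)) (mu / C) Kp h F eta0 me (Fr _ muC)) _.
have h1 : (`|h| / eta + 1) / Kp%:R <= 2 / C.
  have hKm : `|h| / eta <= Km%:R by rewrite ler_pdivrMr.
  have CKm : C * Km%:R <= Kp%:R.
    rewrite -(ler_pM2r eta0); apply: le_trans Kpl; rewrite -mulrA ler_pM2l//.
    apply: (le_trans Kml); rewrite ler_pdivrMr// ler_peMr//.
    have := le_trans (mulr_ge0 (ler0n R Km) (ltW eta0)) Kml.
    by rewrite pmulr_lge0 ?invr_gt0.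
  rewrite ler_pdivrMr// mulrAC ler_pdivlMr//; nra.
have h2 : 0 <= (`|h| / eta + 1) / Kp%:R by rewrite divr_ge0// addr_ge0// divr_ge0// ltW.
rewrite -(mulrA 2); move: (_ / Kp%:R) h1 h2 => y h1 h2.
have h3 : m%:R * (2 * y) * nrm F <= m%:R * (2 * (2 / C)) * mu.
  apply: ler_pM => //; rewrite ?nrm_ge0 ?mulr_ge0//.
  by rewrite ler_wpM2l// ler_pM2l.
have h4 : m%:R * (2 * (2 / C)) * mu + mu / C = (4 * m%:R + 1) / C * mu by field; rewrite gt_eqF.
by move: h3 h4; lra.
Qed.

(** By [absorb] the coarse density is nearly an average of the fine one, and by Jensen's inequality
    averaging decreases the integral of a power. For [a = 1] both counts are the integral of [F]. *)
Lemma cntD_mono (a : nat) (e : R) : (0 < a)%N -> 0 < e -> exists2 C0, 1 <= C0 &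
  forall C lam rho mu eta Km Kp (F : ifun J), C0 <= C -> 0 < mu ->
    scales q C lam rho mu eta Km Kp -> rclass mu rho F ->
    cntD (pgrid io eta Kp) a F <= cntD (pgrid io eta Km) a F + e * mu ^+ 2.
Proof.
case: a => // a _ e0; pose A := a.+1%:R * (4 * m%:R + 1) / e : R.
have A0 : 0 <= A by rewrite divr_ge0 ?(ltW e0)// mulr_ge0// addr_ge0// mulr_ge0.
exists (1 + A); first by lra.
move=> C lam rho mu eta Km Kp F CA mu0 sc Fc.
have C1 : 1 <= C by lra.
have C0 : 0 < C by lra.
have Kp0 : (0 < Kp)%N by rewrite -(ltr_nat R); apply: lt_le_trans (sc_Kp0 sc).
have emu : 0 <= e * mu ^+ 2 by rewrite mulr_ge0 ?sqr_ge0// ltW.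
case: a @A A0 CA => [|a] A A0 CA.
  by rewrite !cntD1 ?pgrid_size//; [lra|exact: sc_Km0 sc].
have [Fcl _] := Fc.
have Gcl : cl mu (av (pgrid io eta Km) F : ifun J) by apply: cl_av => //; apply: pgrid_size; exact: sc_Km0 sc.
have ca X : cl mu X -> cl mu (av (pgrid io eta Kp) X : ifun J) by apply: cl_av; exact: pgrid_size.
have h1 := @ipr_nseq_diff _ _ J mu _ _ a.+2 isT (ca _ Gcl) (ca _ Fcl).
have h2 := absorb C1 mu0 sc Fc.
have h3 := @ipr_nseq_av _ _ J a.+1 (pgrid io eta Kp) (av (pgrid io eta Km) F : ifun J) Gcl.1.
rewrite !cntD_ipr; move: h1; rewrite distrC => /ler_normlP[_ h1].
have h4 : a.+2%:R * (mu * nrm (av (pgrid io eta Kp) (av (pgrid io eta Km) F) - av (pgrid io eta Kp) F : ifun J)) <= e * mu ^+ 2.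
  apply: le_trans (_ : a.+2%:R * (mu * ((4 * m%:R + 1) / C * mu)) <= _).
    by rewrite ler_wpM2l// ler_pM2l.
  have -> : a.+2%:R * (mu * ((4 * m%:R + 1) / C * mu)) = (A / C * e) * mu ^+ 2.
    by rewrite /A; field; rewrite !gt_eqF.
  rewrite ler_wpM2r ?sqr_ge0// ler_piMl ?(ltW e0)// ler_pdivrMr// mul1r; lra.
by apply: le_trans (_ : _ <= ipr (nseq a.+2 (av (pgrid io eta Kp) (av (pgrid io eta Km) F) : ifun J)) + e * mu ^+ 2) _; [move: h1 h4; lra|move: h3; lra].
Qed.


Lemma eq_in_rmean (I : eqType) (s : seq I) (f g : I -> R) :
  (forall i, i \in s -> f i = g i) -> rmean s f = rmean s g.
Proof. by move=> fg; apply/eqP; rewrite eq_le !rmean_le_in// => i /fg ->. Qed.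

Definition sim (v : 'I_m -> 'rV[R]_m) (lam : R) (s : seq E) : Prop :=
  exists h : 'rV[R]_m -> 'rV[R]_m,
    (forall x y, dot (h x - h y) (h x - h y) = dot (x - y) (x - y)) /\
    s = [seq io (lam *: h (v k)) | k <- enum 'I_m].

(** One point leaves no plane to rotate in, but both counts are then the integral of [F]. *)
Lemma simplex_system1 (v : 'I_m -> 'rV[R]_m) (lam : R) : m = 1%N ->
  exists sigma : seq (seq E), [/\ (0 < size sigma)%N,
    forall s, s \in sigma -> sim v lam s &
    forall D (F : ifun J), (0 < size D)%N -> rmean sigma (fun s => itg J (tup s F)) = cntD D m F].
Proof.
move=> m1; exists [:: [seq io (lam *: v k) | k <- enum 'I_m]]; split => //.
  by move=> s; rewrite inE => /eqP ->; exists id.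
move=> D F D0; have -> : cntD D m F = itg J F by rewrite m1 cntD1.
rewrite /rmean /= big_seq1 invr1 mul1r.
have : size [seq io (lam *: v k) | k <- enum 'I_m] = 1%N by rewrite size_map size_enum_ord.
by case: [seq _ | _ <- _] => // d [|//] _; rewrite itg_tup//= ipr1 itg_sh_ifun.
Qed.

(** This makes the error affine in the difference of counts, so that it can be averaged over the
    other blocks and telescoped over the scales. *)
Lemma sqrt_am_gm (mu e z : R) : 0 < e -> 0 <= mu -> 0 <= z ->
  2 * mu * Num.sqrt z <= e * mu ^+ 2 + z / e.
Proof.
move=> e0 mu0 z0; have := sqr_ge0 (e * mu - Num.sqrt z).
rewrite sqrrB sqr_sqrtr// => h.
have : 0 <= (e * mu) ^+ 2 - e * mu * Num.sqrt z *+ 2 + z by [].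
rewrite -(ler_pM2l (_ : 0 < e^-1)) ?invr_gt0// mulr0.
have -> : e^-1 * ((e * mu) ^+ 2 - e * mu * Num.sqrt z *+ 2 + z) =
  e * mu ^+ 2 - 2 * mu * Num.sqrt z + z / e by field; rewrite gt_eqF.
lra.
Qed.

Lemma simplex_system2 (v : 'I_m -> 'rV[R]_m) (e : R) : (1 < m)%N -> affinely_independent v ->
  0 < e -> exists c C0 : R, [/\ 0 <= c, 1 <= C0 &
  forall C lam rho mu, C0 <= C -> 0 < lam -> (forall b, 0 < b -> 0 < rho b) -> 0 < mu ->
  exists sigma : seq (seq E), [/\ (0 < size sigma)%N,
    forall s, s \in sigma -> sim v lam s &
    forall eta Km Kp (F : ifun J), scales q C lam rho mu eta Km Kp -> rclass mu rho F ->
    `|rmean sigma (fun s => itg J (tup s F)) - cntD (pgrid io eta Km) m F|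
      <= e * mu ^+ 2 + c * (cntD (pgrid io eta Km) 2 F - cntD (pgrid io eta Kp) 2 F)]].
Proof.
move=> m1 vi e0.
have [p hp] := choice (fun k => frame vi k m1).
have [qq hq] := choice hp; have [ o ho] := choice hq; have [a0 fr] := choice ho => {hp hq ho}.
pose Rt k t := rot (p k) (qq k) (o k) t.
have Rt_iso k t : aiso (Rt k t) by have [_ [? ? ?] _ _] := fr k; exact: rot_iso.
have Rt_fix k t a : a != k -> Rt k t (v a) = v a.
  by move=> ak; have [_ _ _ /(_ a ak)[? ?]] := fr k; exact: rot_fix.
have Rt_cur k t : Rt k t (v k) = o k + cur (a0 k) (p k) (qq k) t.
  by have [_ [? ? ?] -> _] := fr k; exact: rot_cur.
(* Each rotation fixes some other vertex [v b], hence sends the origin to a point of norm at most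
   twice that of [v b]. *)
pose D := 4 * \sum_a dot (v a) (v a).
have vD a : 4 * dot (v a) (v a) <= D.
  by rewrite ler_pM2l// (bigD1 a)//= lerDl; apply: sumr_ge0 => b _; exact: dot_ge0.
have D0 : 0 <= D by rewrite mulr_ge0// sumr_ge0// => b _; exact: dot_ge0.
move: D vD D0 => D vD D0.
have RtD k t : dot (Rt k t 0) (Rt k t 0) <= D.
  have [b bk] : exists b : 'I_m, b != k.
    have : (0 < #|predC1 k|)%N by rewrite cardC1 card_ord -ltnS prednK// ltnW.
    by case/card_gt0P => b bk; exists b.
  apply: le_trans (vD b); rewrite -[Rt k t 0](subrK (v b)).
  have := (Rt_iso k t).1 0 (v b); rewrite Rt_fix// sub0r => h.
  apply: le_trans (dot_add_le _ _) _; rewrite h dotNl dotNr opprK; lra.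
(* The recursion of [aiso_bound], for the squared norm of the image of the origin under [n]
   rotations. *)
pose b n := iter n (fun x : R => 2 * D + 2 * x) 0.
have b0 n : 0 <= b n by elim: n => //= n IH; rewrite addr_ge0// mulr_ge0.
have bS n : b n <= b n.+1 by rewrite /=; have := b0 n; move: D0; rewrite -/(b n); lra.
have bm n : (n <= m)%N -> b n <= b m.
  by move=> /subnK <-; elim: (m - n)%N => //= k IH; exact: le_trans IH (bS _).
have bm0 := b0 m.
have Q0 : 0 <= 8 * D + 2 * b m by rewrite addr_ge0// mulr_ge0.
have [R0 [R00 R0Q]] : exists R0 : R, 0 <= R0 /\ 8 * D + 2 * b m <= R0 ^+ 2.
  by exists (8 * D + 2 * b m + 1); move: (8 * D + 2 * b m) Q0 => x x0; split; nra.
have orbit g k n : aiso g -> dot (g 0) (g 0) <= b n -> (n <= m)%N -> forall t,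
    dot (g (o k + cur (a0 k) (p k) (qq k) t)) (g (o k + cur (a0 k) (p k) (qq k) t)) <= R0 ^+ 2.
  move=> gi g0 nm t; apply: le_trans R0Q; rewrite -Rt_cur.
  apply: le_trans (aiso_bound _ gi) _.
  have h1 := aiso_bound (v k) (Rt_iso k t).
  by move: h1 (vD k) (RtD k t) g0 (bm n nm); lra.
have m0 : 0 < m%:R :> R by rewrite ltr0n.
have e14 : 0 < e / 4 by rewrite divr_gt0.
have e1 : 0 < e / (4 * m%:R) by rewrite divr_gt0// mulr_gt0.
have [r r0 vtx] := @vertex R E H m io io_norm m_gt0 _ e1.
have a00 k : 0 < a0 k by have [] := fr k.
have [Ck CkP] := choice (fun k => let: ex_intro2 C h1 h2 := vtx (a0 k) R0 (a00 k) R00 in ex_intro _ C (conj h1 h2)).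
(* The factor that [sqrt_am_gm] produces with the weight [e / 4 / m%:R ^+ 2]. *)
pose c := m%:R ^+ 2 / (e / 4).
have c0 : 0 < c by rewrite divr_gt0// exprn_gt0.
pose e2 := e / 4 / c.
have e20 : 0 < e2 by rewrite divr_gt0.
pose A := 2 * (4 * m%:R + 1) / e2.
have A0 : 0 <= A by rewrite divr_ge0 ?(ltW e20)// mulr_ge0// addr_ge0// mulr_ge0// ltW.
have Ck0 k : 0 <= Ck k by case: (CkP k) => h _; lra.
have Cs0 : 0 <= \sum_k Ck k by apply: sumr_ge0.
exists c, (1 + A + \sum_k Ck k); split; [exact: ltW|lra|].
move=> C lam rho mu CC lam0 rho0 mu0.
have C1 : 1 <= C by lra.
have C0 : 0 < C by lra.
have CkC k : Ck k <= C.
  apply: (@le_trans _ _ (\sum_k Ck k)); last lra.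
  by rewrite (bigD1 k)//= lerDl sumr_ge0.
have /choice [N NP] : forall k, exists N : nat, (0 < N)%N /\
  forall (eta : R) (Km Kp : nat) (F : H) (o p q : 'rV[R]_m),
    0 < eta -> m%:R * eta <= rho (mu / C) -> (0 < Km)%N -> Km%:R * eta <= lam / C ->
    C * lam <= Kp%:R * eta -> C <= Kp%:R ->
    nrm F <= mu -> (forall b, 0 < b -> forall w, `|w| <= rho b -> nrm (sh w F - F) <= b) ->
    dot p p = 1 -> dot q q = 1 ->
    (forall t, dot (o + cur (a0 k) p q t) (o + cur (a0 k) p q t) <= R0 ^+ 2) ->
    rmean (iota 0 r) (fun i => nrm (avg (iota 0 N) (fun j =>
        sh (io (lam *: refl (rpt R m i) (o + cur (a0 k) p q (j%:R / N%:R)))) F) - av (pgrid io eta Km) F)) <=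
      e / (4 * m%:R) * mu + 2 * Num.sqrt (nrm (av (pgrid io eta Km) F) ^+ 2
        - nrm (av (pgrid io eta Kp) (av (pgrid io eta Km) F)) ^+ 2).
  move=> k; have [_ h] := CkP k.
  by have [N N0 hN] := h C (CkC k) lam rho mu lam0 rho0 mu0; exists N; split.
pose grid k : seq R := [seq j%:R / (N k)%:R | j <- iota 0 (N k)].
have grid0 k : (0 < size (grid k))%N by rewrite size_map size_iota; case: (NP k).
pose ks := enum 'I_m.
have sks : size ks = m by rewrite size_enum_ord.
pose cf i ts := [seq io (lam *: refl (rpt R m i) y) | y <- conf v Rt ks ts id].
have L0 : (0 < size (lists grid ks))%N by exact: lists_size.
have cfE ts : ts \in lists grid ks -> exists h, aiso h /\ conf v Rt ks ts id = [seq h (v k) | k <- ks].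
  move=> /lists_mem_size st.
  by have [h [hi hc _]] := conf_iso Rt_iso Rt_fix (enum_uniq _) st (aiso_id R m); exists h.
exists [seq cf i ts | i <- iota 0 r, ts <- lists grid ks]; split.
- by rewrite size_allpairs size_iota muln_gt0 r0.
- move=> s /allpairsP[[i ts] [/= _ /cfE[h [[hi _] hc]] ->]].
  exists (fun x => refl (rpt R m i) (h x)); split; last by rewrite /cf hc -map_comp.
  move=> x y; rewrite -[RHS]hi; have -> : refl (rpt R m i) (h x) - refl (rpt R m i) (h y) = refl (rpt R m i) (h x - h y).
    by rewrite reflD -(scaleN1r (h y)) reflZ scaleN1r.
  by rewrite dot_refl// rpt_neq0.
move=> eta Km Kp F sc Fc.
have [eta0 er Km0 Kml Kpl CKp] := sc; have [[Fu Fm] Fr] := Fc.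
have Kp0 : (0 < Kp)%N by rewrite -(ltr_nat R); apply: lt_le_trans CKp.
have me : m%:R * eta <= rho (mu / C) by apply: le_trans er; rewrite ler_pM2r// ler_nat.
set G := av (pgrid io eta Km) F.
have Gcl : cl mu (G : ifun J) by apply: cl_av => //; exact: pgrid_size.
set z := nrm G ^+ 2 - nrm (av (pgrid io eta Kp) G) ^+ 2.
have z0 : 0 <= z by rewrite subr_ge0 ler_sqr ?nnegrE ?nrm_ge0// nrm_av.
have cerrP g k n : aiso g -> dot (g 0) (g 0) <= b n -> (n <= m)%N ->
    rmean (iota 0 r) (fun i => cerr io v Rt F G lam grid (rpt R m) i k g) <=
      e / (4 * m%:R) * mu + 2 * Num.sqrt z.
  move=> gi g0 nm; have [N0 hN] := NP k; have [_ [p1 q1 pq] _ _] := fr k.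
  have ob t : dot (g (o k) + cur (a0 k) (g (p k) - g 0) (g (qq k) - g 0) t)
      (g (o k) + cur (a0 k) (g (p k) - g 0) (g (qq k) - g 0) t) <= R0 ^+ 2.
    by rewrite -aiso_cur//; exact: orbit nm t.
  have := hN eta Km Kp F (g (o k)) (g (p k) - g 0) (g (qq k) - g 0) eta0 me Km0 Kml Kpl CKp Fm Fr
    (aiso_unit gi p1) (aiso_unit gi q1) ob.
  apply: le_trans; apply: rmean_le => i; rewrite /cerr le_eqVlt; apply/orP; left; apply/eqP.
  congr (nrm (_ - _)); rewrite /avg /grid size_map big_map.
  by congr (_ *: _); apply: eq_bigr => j _; rewrite Rt_cur aiso_cur.
have tb := @terr_bound R E J m io v Rt Rt_iso F G lam grid (rpt R m) grid0 r ks 0 b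
  (e / (4 * m%:R) * mu + 2 * Num.sqrt z).
have {tb} tb : rmean (iota 0 r) (fun i => terr io v Rt F G lam grid (rpt R m) i ks id) <=
    m%:R * (e / (4 * m%:R) * mu + 2 * Num.sqrt z).
  rewrite sks in tb; apply: tb => //.
  - move=> g k t n gi g0; apply: le_trans (aiso_bound _ gi) _.
    by rewrite /= -/(b n) lerD// ler_pM2l.
  - exact: aiso_id.
  - by rewrite -(scale0r (0 : 'rV[R]_m)) dotZl mul0r.
have main : `|rmean [seq cf i ts | i <- iota 0 r, ts <- lists grid ks] (fun s => itg J (tup s F))
    - cntD (pgrid io eta Km) m F| <= mu * (m%:R * (e / (4 * m%:R) * mu + 2 * Num.sqrt z)).
  rewrite rmean_allpairs.
  have -> : cntD (pgrid io eta Km) m F = rmean (iota 0 r) (fun=> ipr (nseq m (G : ifun J))).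
    by rewrite rmean_cst ?size_iota// cntD_ipr_pos.
  rewrite -rmeanB; apply: le_trans (rmean_norm _ _) _.
  apply: le_trans (_ : rmean (iota 0 r) (fun i => mu * terr io v Rt F G lam grid (rpt R m) i ks id) <= _); last first.
    by rewrite rmeanZ ler_pM2l.
  apply: rmean_le => i.
  have := @telescope R E J m io v Rt F G mu lam grid (rpt R m) (conj Fu Fm) Gcl i ks id [::].
  rewrite sks cats0 addn0 => /(_ _ m1) h; apply: le_trans (h _) => //.
  rewrite le_eqVlt; apply/orP; left; apply/eqP; congr (`|_ - _|).
  apply: eq_in_rmean => ts /cfE[hh [_ hc]]; rewrite cats0 itg_tup /cf ?hc; last first.
    by rewrite -size_eq0 -lt0n size_map size_map sks.
  by rewrite -!map_comp.
apply: le_trans main _; rewrite !cntD2 -/G; move=> {cerrP tb}.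
(* The defect [z] contains the coarse average of [G], the conclusion that of [F]; [absorb] compares
   them. *)
have ab := absorb C1 mu0 sc Fc; rewrite -/G in ab.
set x := nrm (av (pgrid io eta Kp) F); pose y := nrm (av (pgrid io eta Kp) G).
have zE : z = nrm G ^+ 2 - y ^+ 2 by [].
move: z zE z0 => z zE z0.
have xy : x ^+ 2 <= y ^+ 2 + e2 * mu ^+ 2.
  have x0 : 0 <= x by exact: nrm_ge0.
  have y0 : 0 <= y by exact: nrm_ge0.
  have xm : x <= mu by apply: le_trans (nrm_av _ _) _.
  have ym : y <= mu by apply: le_trans (nrm_av _ _) _; case: Gcl.
  have xyd : x - y <= (4 * m%:R + 1) / C * mu.
    apply: le_trans ab; rewrite nrmBC lerBlDr -[in leLHS]/x.
    by have := nrmD (av (pgrid io eta Kp) F - av (pgrid io eta Kp) G) (av (pgrid io eta Kp) G); rewrite subrK.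
  have ek : 2 * ((4 * m%:R + 1) / C) <= e2.
    have AC : A <= C by lra.
    rewrite mulrA ler_pdivrMr// (_ : 2 * _ = e2 * A) ?ler_pM2l//.
    by rewrite /A [RHS]mulrC divfK// gt_eqF.
  have : x ^+ 2 - y ^+ 2 <= 2 * mu * ((4 * m%:R + 1) / C * mu).
    have h0 : 0 <= (4 * m%:R + 1) / C * mu.
      by rewrite mulr_ge0 ?(ltW mu0)// divr_ge0 ?(ltW C0)// addr_ge0// mulr_ge0// ltW.
    rewrite subr_sqr [leLHS]mulrC; apply: le_trans (_ : (x + y) * ((4 * m%:R + 1) / C * mu) <= _).
      by rewrite ler_wpM2l// addr_ge0.
    by rewrite ler_wpM2r//; move: xm ym; clear -H io_norm m_gt0 m_le; lra.
  have -> : 2 * mu * ((4 * m%:R + 1) / C * mu) = 2 * ((4 * m%:R + 1) / C) * mu ^+ 2 by ring.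
  have : 2 * ((4 * m%:R + 1) / C) * mu ^+ 2 <= e2 * mu ^+ 2 by rewrite ler_wpM2r// sqr_ge0.
  by clear -H io_norm m_gt0 m_le; lra.
have cz : c * z <= c * (nrm G ^+ 2 - x ^+ 2) + e / 4 * mu ^+ 2.
  have -> : e / 4 * mu ^+ 2 = c * (e2 * mu ^+ 2) by rewrite /e2; field; rewrite !gt_eqF.
  by rewrite -mulrDr ler_pM2l// zE; move: xy; clear -H io_norm m_gt0 m_le; lra.
have -> : mu * (m%:R * (e / (4 * m%:R) * mu + 2 * Num.sqrt z)) =
   e / 4 * mu ^+ 2 + 2 * (m%:R * mu) * Num.sqrt z by field; rewrite gt_eqF.
have e5 : 0 < e / 4 / m%:R ^+ 2 by rewrite divr_gt0// exprn_gt0.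
have := sqrt_am_gm e5 (mulr_ge0 (ltW m0) (ltW mu0)) z0.
have -> : e / 4 / m%:R ^+ 2 * (m%:R * mu) ^+ 2 = e / 4 * mu ^+ 2 by field; rewrite gt_eqF.
have -> : z / (e / 4 / m%:R ^+ 2) = c * z by rewrite /c; field; rewrite !gt_eqF.
have emu : 0 <= e / 4 * mu ^+ 2 by rewrite mulr_ge0 ?sqr_ge0// ltW.
have -> : e * mu ^+ 2 = 4 * (e / 4 * mu ^+ 2) by field.
move: cz emu; move: (e / 4 * mu ^+ 2) (c * z) (c * _) (2 * _ * _) => t1 t2 t3 t4.
by clear; lra.
Qed.

Lemma simplex_system (v : 'I_m -> 'rV[R]_m) (e : R) : affinely_independent v ->
  0 < e -> exists c C0 : R, [/\ 0 <= c, 1 <= C0 &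
  forall C lam rho mu, C0 <= C -> 0 < lam -> (forall b, 0 < b -> 0 < rho b) -> 0 < mu ->
  exists sigma : seq (seq E), [/\ (0 < size sigma)%N,
    forall s, s \in sigma -> sim v lam s &
    forall eta Km Kp (F : ifun J), scales q C lam rho mu eta Km Kp -> rclass mu rho F ->
    `|rmean sigma (fun s => itg J (tup s F)) - cntD (pgrid io eta Km) m F|
      <= e * mu ^+ 2 + c * (cntD (pgrid io eta Km) 2 F - cntD (pgrid io eta Kp) 2 F)]].
Proof.
move=> vi e0; have [m1|m1] := ltnP 1 m; first exact: simplex_system2.
have m1E : m = 1%N by apply/eqP; rewrite eqn_leq m1.
exists 0, 1; split=> // C lam rho mu _ lam0 _ mu0.
have [sigma [s0 ss sE]] := simplex_system1 v lam m1E.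
exists sigma; split=> // eta Km Kp F sc _.
rewrite (sE (pgrid io eta Km)); last by apply: pgrid_size; exact: sc_Km0 sc.
by rewrite subrr normr0 mul0r addr0 mulr_ge0 ?sqr_ge0// ltW.
Qed.

End Block.

(** * Products of simplices *)

Fixpoint all2P (T U : Type) (P : T -> U -> Prop) (xs : seq T) (ys : seq U) : Prop :=
  match xs, ys with
  | [::], [::] => True
  | x :: xs', y :: ys' => P x y /\ all2P P xs' ys'
  | _, _ => False
  end.

Lemma all2P_size T U (P : T -> U -> Prop) xs ys : all2P P xs ys -> size xs = size ys.
Proof. by elim: xs ys => [|x xs IH] [|y ys] //= [_ /IH ->]. Qed.

Lemma all2P_cat T U (P : T -> U -> Prop) xs ys xs' ys' :
  all2P P xs ys -> all2P P xs' ys' -> all2P P (xs ++ xs') (ys ++ ys').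
Proof. by elim: xs ys => [|x xs IH] [|y ys] //= [? /IH h] /h. Qed.

Section Counting.
Variables (R : realType) (E : normedModType R) (J : invint R E).
Implicit Types (F G f : ifun J) (X Y : seq (seq E)) (Xs Ys : seq (seq (seq E))).

Fixpoint cntG Xs (Phi : ifun J -> R) F : R :=
  if Xs is X :: Xs' then rmean X (fun s => cntG Xs' Phi (tup s F)) else Phi F.

Definition cntT X F := rmean X (fun s => itg J (tup s F)).

Definition cnt Xs F := cntG Xs (itg J) F.

Lemma cntG_cat Xs Ys Phi F : cntG (Xs ++ Ys) Phi F = cntG Xs (cntG Ys Phi) F.
Proof. by elim: Xs F => //= X Xs IH F; apply: eq_rmean => s. Qed.

(** The invariant is indexed by the depth, because each passage to tuples worsens the modulus
    ([reach]) and enlarges the support ([spread]). *)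
Lemma cntG_le (P : nat -> ifun J -> Prop) (Xs : seq (seq (seq E))) Phi Psi i F :
  (forall X s j G, X \in Xs -> s \in X -> P j G -> P j.+1 (tup s G)) -> P i F ->
  (forall G, P (i + size Xs)%N G -> Phi G <= Psi G) -> cntG Xs Phi F <= cntG Xs Psi F.
Proof.
elim: Xs i F => [|X Xs IH] i F PP PF h /=; first by apply: h; rewrite addn0.
apply: rmean_le_in => s sX; apply: (IH i.+1).
- by move=> Y t j G YX; apply: PP; rewrite inE YX orbT.
- exact: PP (mem_head _ _) sX PF.
- by move=> G; rewrite addSnnS; exact: h.
Qed.

Lemma cntG_abs (P : nat -> ifun J -> Prop) Xs Phi Psi B i F :
  (forall X s j G, X \in Xs -> s \in X -> P j G -> P j.+1 (tup s G)) -> P i F ->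
  (forall G, P (i + size Xs)%N G -> `|Phi G - Psi G| <= B G) ->
  `|cntG Xs Phi F - cntG Xs Psi F| <= cntG Xs B F.
Proof.
elim: Xs i F => [|X Xs IH] i F PP PF h /=; first by apply: h; rewrite addn0.
rewrite -rmeanB; apply: le_trans (rmean_norm _ _) _.
apply: rmean_le_in => s sX; apply: (IH i.+1).
- by move=> Y t j G YX; apply: PP; rewrite inE YX orbT.
- exact: PP (mem_head _ _) sX PF.
- by move=> G; rewrite addSnnS; exact: h.
Qed.

Lemma cntG_lin Xs (c : R) Phi Psi F :
  cntG Xs (fun G => Phi G + c * Psi G) F = cntG Xs Phi F + c * cntG Xs Psi F.
Proof.
elim: Xs F => //= X Xs IH F; rewrite -rmeanZ -rmeanD; apply: eq_rmean => s; exact: IH.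
Qed.

Lemma cntG_cst_le Xs (c : R) F : 0 <= c -> cntG Xs (fun=> c) F <= c.
Proof.
move=> c0; elim: Xs F => //= X Xs IH F; apply: rmean_leC => // s; exact: IH.
Qed.

Definition okt X := forall s, s \in X -> s != [::].

Lemma tupC s t F : s != [::] -> t != [::] -> tup s (tup t F) = tup t (tup s F).
Proof.
move=> s0 t0; apply: ifun_eq => x; rewrite !tupE//.
under eq_bigr do rewrite tupE//; under [RHS]eq_bigr do rewrite tupE//.
rewrite exchange_big; apply: eq_bigr => d _; apply: eq_bigr => e _.
by rewrite addrAC.
Qed.

Lemma cntG_swap X Ys Phi F : okt X -> (forall Y, Y \in Ys -> okt Y) ->
  cntG (X :: Ys) Phi F = cntG Ys (fun G => rmean X (fun s => Phi (tup s G))) F.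
Proof.
move=> oX; elim: Ys F => [|Y Ys IH] F oY //=.
transitivity (rmean Y (fun t => cntG (X :: Ys) Phi (tup t F))); last first.
  by apply: eq_rmean => t; apply: IH => Z ZY; apply: oY; rewrite inE ZY orbT.
rewrite /= exchange_rmean; apply: eq_in_rmean => t tY; apply: eq_in_rmean => s sX.
by rewrite (tupC F (oX _ sX) (oY _ (mem_head _ _) _ tY)).
Qed.

(** Tuples of different blocks commute, so any block can be made the innermost one, where the one
    simplex estimate applies to a tuple function of the others. *)
Lemma cnt_swap Zs X Ys F : okt X -> (forall Y, Y \in Ys -> okt Y) ->
  cnt (Zs ++ X :: Ys) F = cntG (Zs ++ Ys) (cntT X) F.
Proof.
move=> oX oY; rewrite /cnt !cntG_cat; elim: Zs F => [|Z Zs IH] F; last first.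
  by apply: eq_rmean => s; exact: IH.
by rewrite [LHS]cntG_swap.
Qed.

(** Jensen's inequality through the nested means, normalized as in [ipr_nseq_lower]. *)
Lemma cntG_power (P : nat -> ifun J -> Prop) Xs Phi (V : R) a i F : 0 < V ->
  (forall X s j G, X \in Xs -> s \in X -> P j G -> P j.+1 (tup s G)) -> P i F ->
  (forall G, P (i + size Xs)%N G -> 0 <= Phi G) ->
  0 <= cntG Xs Phi F /\
  V * (cntG Xs Phi F / V) ^+ a.+1 <= cntG Xs (fun G => V * (Phi G / V) ^+ a.+1) F.
Proof.
move=> V0; elim: Xs i F => [|X Xs IH] i F PP PF h /=.
  by split; rewrite ?h ?addn0.
have IH' s : s \in X -> _ := fun sX => IH i.+1 (tup s F)
   (fun Y t j G YX => PP Y t j G (introT orP (or_intror YX))) (PP X s i F (mem_head _ _) sX PF)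
   (fun G => eq_ind _ (fun n => P n G -> 0 <= Phi G) (h G) _ (esym (addSnnS _ _))).
have c0 s : s \in X -> 0 <= cntG Xs Phi (tup s F) by case/IH'.
split; first by rewrite mulr_ge0 ?invr_ge0// big_seq sumr_ge0.
apply: le_trans (_ : rmean X (fun s => V * (cntG Xs Phi (tup s F) / V) ^+ a.+1) <= _); last first.
  by apply: rmean_le_in => s /IH'[].
rewrite rmeanZ ler_pM2l// mulrC -rmeanZ.
under [leRHS]eq_rmean do rewrite mulrC.
by apply: rmean_power => s sX; rewrite mulr_ge0 ?c0// invr_ge0 ltW.
Qed.

End Counting.

Section Hybrid.
Variables (R : realType) (E : normedModType R) (J : invint R E).
Implicit Types (F G f : ifun J) (X Y : seq (seq E)) (Xs Ys Ts : seq (seq (seq E))).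

Record block := Block {
  bdim : nat;
  bio : {linear 'rV[R]_bdim -> E};
  bpt : 'I_bdim -> 'rV[R]_bdim;
  bio_norm : forall u, `|bio u| <= `|u|;
  bdim_gt0 : (0 < bdim)%N;
  bpt_indep : affinely_independent bpt }.

Variable (q : nat).
Hypothesis q_gt1 : (1 < q)%N.

(* tys B eta K a consists of the a-tuples of points of a grid in the block B. *)
Definition tys (B : block) (eta : R) (K a : nat) := tups (pgrid (bio B) eta K) a.

Definition full eta K (ps : seq block) := [seq tys B eta K (bdim B) | B <- ps].

Definition sysP (lam : R) (B : block) (X : seq (seq E)) :=
  (0 < size X)%N /\ forall s, s \in X -> sim (bio B) (@bpt B) lam s.

(** The three families that the error estimate for [B] puts in its place: the main term and the two
    counts of close pairs. *)
Definition choP (eta : R) (Km Kp : nat) (B : block) (X : seq (seq E)) :=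
  [\/ X = tys B eta Km (bdim B), X = tys B eta Km 2 | X = tys B eta Kp 2].

Definition qt X := forall s, s \in X -> s != [::] /\ (size s <= q)%N.

Lemma qt_okt X : qt X -> okt X.
Proof. by move=> h s /h[]. Qed.

Lemma qt_tys B eta K a : (0 < a)%N -> (a <= q)%N -> qt (tys B eta K a).
Proof. by move=> a0 aq s /tups_size ss; rewrite -size_eq0 -lt0n ss. Qed.

Lemma qt_cho eta Km Kp B X : (bdim B <= q)%N -> choP eta Km Kp B X -> qt X.
Proof. by move=> Bq [->|->|->]; apply: qt_tys => //; exact: bdim_gt0. Qed.

Lemma qt_sys lam B X : (bdim B <= q)%N -> sysP lam B X -> qt X.
Proof.
move=> Bq [_ h] s /h[hh [_ ->]]; rewrite -size_eq0 size_map size_enum_ord.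
by rewrite -lt0n bdim_gt0.
Qed.

Lemma all2P_qt (P : block -> seq (seq E) -> Prop) ps Xs :
  (forall B, B \in [seq bdim C | C <- ps] -> (B <= q)%N) ->
  (forall B X, (bdim B <= q)%N -> P B X -> qt X) -> all2P P ps Xs -> forall X, X \in Xs -> qt X.
Proof.
move=> + h; elim: ps Xs => [|B ps IH] [|X Xs] //= psq [PB PX] Y.
rewrite inE => /orP[/eqP ->|]; first by apply: h PB; apply: psq; rewrite mem_head.
by apply: IH PX _ => b bps; apply: psq; rewrite inE bps orbT.
Qed.

(** What [j] passages to tuples of at most [q] points leave of the continuity of [f]. *)
Definition reach (mu : R) f (j : nat) F := cl mu F /\
  forall w, nrm (sh w F - F) <= q%:R ^+ j * nrm (sh w f - f).

Lemma reach_tup mu f X s j F : qt X -> s \in X -> reach mu f j F -> reach mu f j.+1 (tup s F).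
Proof.
move=> qX /qX[s0 sq] [Fc Fw]; split; first exact: tup_cl.
move=> w; apply: le_trans (tup_modulus w s0 Fc.1) _.
by rewrite exprS -mulrA ler_pM// ?nrm_ge0// ler_nat.
Qed.

Definition modulus (k : nat) (rho : R -> R) f := forall b, 0 < b -> forall w, `|w| <= rho b ->
  q%:R ^+ k * nrm (sh w f - f) <= b.

Lemma reach_rclass mu rho f k j F : (j <= k)%N -> modulus k rho f -> reach mu f j F -> rclass mu rho F.
Proof.
move=> jk fm [Fc Fw]; split => // b b0 w wb; apply: le_trans (Fw w) _; apply: le_trans (fm b b0 w wb).
by rewrite ler_wpM2r ?nrm_ge0// ler_weXn2l// ler1n ltnW.
Qed.

Lemma reach0 mu f : cl mu f -> reach mu f 0 f.
Proof. by move=> fc; split => // w; rewrite expr0 mul1r. Qed.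

(** Replacing the last block costs a difference of counts which still contain the copies in the
    previous blocks. The induction hypothesis, with the last block kept as one of its three families
    in front of [Ts], removes these too; this is why the assumed differences allow any choice in the
    later blocks. *)
Lemma hybrid (ps : seq block) (e : R) : (forall b, b \in [seq bdim C | C <- ps] -> (b <= q)%N) ->
  0 < e -> exists C0 h : R, [/\ 1 <= C0, 0 < h &
  forall C lam rho mu, C0 <= C -> 0 < lam -> (forall b, 0 < b -> 0 < rho b) -> 0 < mu ->
  exists2 sgs : seq (seq (seq E)), all2P (sysP lam) ps sgs &
  forall eta Km Kp f k Ts, scales q C lam rho mu eta Km Kp ->
    cl mu f -> modulus k rho f -> (size ps + size Ts <= k)%N -> (forall X, X \in Ts -> qt X) ->
    (forall ps1 B ps2 Xs, ps = ps1 ++ B :: ps2 -> all2P (choP eta Km Kp) ps2 Xs ->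
      cnt (full eta Km ps1 ++ tys B eta Km 2 :: Xs ++ Ts) f
      - cnt (full eta Km ps1 ++ tys B eta Kp 2 :: Xs ++ Ts) f <= h * mu ^+ 2) ->
    `|cnt (sgs ++ Ts) f - cnt (full eta Km ps ++ Ts) f| <= e * mu ^+ 2].
Proof.
elim/last_ind: ps e => [|ps B IH] e psq e0.
  exists 1, 1; split=> // C lam rho mu _ _ _ mu0; exists [::] => // eta Km Kp f k Ts _ _ _ _ _ _.
  by rewrite subrr normr0 mulr_ge0 ?sqr_ge0// ltW.
have Bq : (bdim B <= q)%N by apply: psq; rewrite map_rcons mem_rcons mem_head.
have psq' b : b \in [seq bdim C | C <- ps] -> (b <= q)%N.
  by move=> bps; apply: psq; rewrite map_rcons mem_rcons inE bps orbT.
have e4 : 0 < e / 4 by rewrite divr_gt0.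
have [c [C1 [c0 C11 sys]]] := @simplex_system R E J (bdim B) (bio B) (@bio_norm B) (bdim_gt0 B)
  q Bq (@bpt B) (e / 4) (@bpt_indep B) e4.
have c1 : 0 < 1 + 2 * c by lra.
have e'0 : 0 < e / 4 / (1 + 2 * c) by rewrite divr_gt0.
have [C2 [h [C21 h0 hyb]]] := IH _ psq' e'0.
(* The induction hypothesis is used once for the main term, and twice for the difference that
   carries the factor [c]. *)
pose e' := e / 4 / (1 + 2 * c).
have e'E : e' * (1 + 2 * c) = e / 4 by rewrite divfK// gt_eqF.
have c1' : 0 < 1 + c by lra.
(* The first term feeds the induction hypothesis, the second bounds the difference for the last
   block. *)
pose h' := Num.min h (e / 4 / (1 + c)).
have h'0 : 0 < h' by rewrite lt_min h0 divr_gt0.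
have h'h : h' <= h by rewrite ge_min lexx.
have ch' : c * h' <= e / 4.
  have : h' <= e / 4 / (1 + c) by rewrite ge_min lexx orbT.
  rewrite ler_pdivlMr// => hh; have : 0 <= h' by exact: ltW.
  by move: hh; lra.
exists (C1 + C2), h'; split=> //; first by lra.
move=> C lam rho mu CC lam0 rho0 mu0.
have CC1 : C1 <= C by lra.
have CC2 : C2 <= C by lra.
have [sg [sg0 sgs sgP]] := sys C lam rho mu CC1 lam0 rho0 mu0.
have [sgs' sims' sgP'] := hyb C lam rho mu CC2 lam0 rho0 mu0.
exists (rcons sgs' sg).
  by rewrite -!cats1; apply: all2P_cat => //=.
move=> eta Km Kp f k Ts sc fc fm sk qTs diag.
have mu2 : 0 <= mu ^+ 2 by exact: sqr_ge0.
have sk1 : (size ps + (size Ts).+1 <= k)%N by move: sk; rewrite size_rcons addSnnS.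
have IHX X : choP eta Km Kp B X -> qt X ->
    `|cnt (sgs' ++ X :: Ts) f - cnt (full eta Km ps ++ X :: Ts) f| <= e' * mu ^+ 2.
  move=> cX qX; apply: (sgP' eta Km Kp f k (X :: Ts)) => //.
    by move=> Y; rewrite inE => /orP[/eqP -> //|]; exact: qTs.
  move=> ps1 B' ps2 Xs psE chXs.
  have := diag ps1 B' (rcons ps2 B) (rcons Xs X).
  rewrite psE -rcons_cons -rcons_cat => /(_ erefl) dd.
  rewrite -(cat_rcons X Xs Ts); apply: le_trans (dd _) _; last by rewrite ler_wpM2r.
  by rewrite -!cats1; exact: all2P_cat.
have oTs X : X \in Ts -> okt X by move=> /qTs /qt_okt.
have qsgs : forall X, X \in sgs' -> qt X by apply: all2P_qt sims' => // B' X; exact: qt_sys.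
have qall X : X \in sgs' ++ Ts -> qt X by rewrite mem_cat => /orP[/qsgs|/qTs].
have qf : qt (tys B eta Km (bdim B)) by apply: qt_tys => //; exact: bdim_gt0.
have q2 K : qt (tys B eta K 2) by exact: qt_tys.
have qsg : qt sg by apply: (@qt_sys lam B).
have key : `|cnt (sgs' ++ sg :: Ts) f - cnt (sgs' ++ tys B eta Km (bdim B) :: Ts) f| <=
    e / 4 * mu ^+ 2 + c * (cnt (sgs' ++ tys B eta Km 2 :: Ts) f - cnt (sgs' ++ tys B eta Kp 2 :: Ts) f).
  rewrite !cnt_swap//; try exact: qt_okt.
  apply: (@le_trans _ _ (cntG (sgs' ++ Ts) (fun G => e / 4 * mu ^+ 2 + c * (cntT (tys B eta Km 2) G - cntT (tys B eta Kp 2) G)) f)).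
    apply: (@cntG_abs _ _ _ (reach mu f) _ _ _ _ 0%N).
    - by move=> X s j G /qall qX sX; exact: reach_tup sX.
    - exact: reach0.
    move=> G; rewrite add0n => /(@reach_rclass mu rho f k) Gc; apply: sgP => //; apply: Gc => //.
    by rewrite size_cat -(all2P_size sims'); apply: leq_trans sk1; rewrite leq_add2l.
  have -> : (fun G => e / 4 * mu ^+ 2 + c * (cntT (tys B eta Km 2) G - cntT (tys B eta Kp 2) G)) =
     (fun G => e / 4 * mu ^+ 2 + c * (cntT (tys B eta Km 2) G + (-1) * cntT (tys B eta Kp 2) G)).
    by apply/funext => G; rewrite mulN1r.
  rewrite cntG_lin cntG_lin mulN1r lerD2r; apply: cntG_cst_le.
  by rewrite mulr_ge0// ltW.
rewrite /full map_rcons -/(full _ _ _) !cat_rcons.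
have a1 := IHX _ (Or31 _ _ erefl) qf.
have a2 := IHX _ (Or32 _ _ erefl) (q2 Km).
have a3 := IHX _ (Or33 _ _ erefl) (q2 Kp).
have := diag ps B [::] [::]; rewrite cats1 => /(_ erefl Logic.I) /= d4.
move: (cnt (sgs' ++ sg :: Ts) f) (cnt (sgs' ++ tys B eta Km (bdim B) :: Ts) f)
  (cnt (full eta Km ps ++ tys B eta Km (bdim B) :: Ts) f) key a1 => x1 x2 x3 key a1.
move: (cnt (sgs' ++ tys B eta Km 2 :: Ts) f) (cnt (full eta Km ps ++ tys B eta Km 2 :: Ts) f)
  (cnt (sgs' ++ tys B eta Kp 2 :: Ts) f) (cnt (full eta Km ps ++ tys B eta Kp 2 :: Ts) f)
  key a2 a3 d4 => y1 y2 y3 y4 key a2 a3 d4.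
have cc : c * (y1 - y3) <= c * (2 * (e' * mu ^+ 2) + h' * mu ^+ 2).
  by rewrite ler_wpM2l//; move: a2 a3 d4; rewrite !ler_norml => /andP[_ b2] /andP[b3 _] d; clear -b2 b3 d; lra.
have cc2 : c * (2 * (e' * mu ^+ 2) + h' * mu ^+ 2) + e' * mu ^+ 2 = (e' * (1 + 2 * c) + c * h') * mu ^+ 2 by ring.
rewrite e'E in cc2.
have cc3 : (e / 4 + c * h') * mu ^+ 2 <= (e / 4 + e / 4) * mu ^+ 2 by rewrite ler_wpM2r// lerD2l.
have cc4 : (e / 4 + e / 4) * mu ^+ 2 + e / 4 * mu ^+ 2 <= e * mu ^+ 2.
  by rewrite -mulrDl ler_wpM2r//; lra.
apply: le_trans (ler_distD x2 _ _) _; apply: le_trans (lerD key a1) _.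
by move: cc cc2 cc3 cc4; clear; lra.
Qed.

End Hybrid.

(** * Choice of the scale *)

Fixpoint each (T : Type) (P : T -> Prop) (xs : seq T) : Prop :=
  if xs is x :: xs' then P x /\ each P xs' else True.

Lemma each_cat T (P : T -> Prop) xs ys : each P (xs ++ ys) <-> each P xs /\ each P ys.
Proof. by elim: xs => /= [|x xs ->]; tauto. Qed.

Lemma all2P_trans T U V (P : T -> U -> Prop) (Q : U -> V -> Prop) (S : T -> V -> Prop) xs ys zs :
  (forall x y z, P x y -> Q y z -> S x z) -> all2P P xs ys -> all2P Q ys zs -> all2P S xs zs.
Proof.
move=> PQ; elim: xs ys zs => [|x xs IH] [|y ys] [|z zs] //= [xy h1] [yz h2].
by split; [exact: PQ xy yz|exact: IH h1 h2].
Qed.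

Section Core.
Variables (R : realType) (E : normedModType R) (J : invint R E).
Implicit Types (F G f chi : ifun J) (X Y : seq (seq E)) (Xs Ys Ts : seq (seq (seq E))).
Variable (q : nat).
Hypothesis q_gt1 : (1 < q)%N.

Definition dominated (mu : R) (rho : R -> R) (e : R) X Y :=
  forall F, rclass mu rho F -> cntT X F <= cntT Y F + e * mu ^+ 2.

Lemma cnt_dominated mu rho e k f Zs Xs Ys : 0 <= e -> all2P (dominated mu rho e) Xs Ys ->
  (forall X, X \in Zs ++ Xs ++ Ys -> qt q X) -> (size Zs + size Xs <= k)%N ->
  cl mu f -> modulus q k rho f ->
  cnt (Zs ++ Xs) f <= cnt (Zs ++ Ys) f + (size Xs)%:R * (e * mu ^+ 2).
Proof.
move=> e0; elim: Xs Ys Zs => [|X Xs IH] [|Y Ys] Zs //=.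
  by move=> _ _ _ _ _; rewrite mul0r addr0.
move=> [XY XsYs] qq sk fc fm.
have emu : 0 <= e * mu ^+ 2 by rewrite mulr_ge0 ?sqr_ge0.
have qX : qt q X by apply: qq; rewrite !(mem_cat, inE) eqxx orbT.
have qY : qt q Y by apply: qq; rewrite !(mem_cat, inE) eqxx !orbT.
have qZ V : V \in Zs ++ Xs -> qt q V.
  by move=> h; apply: qq; move: h; rewrite !(mem_cat, inE) => /orP[->//|->]; rewrite !orbT.
have oXs V : V \in Xs -> okt V by move=> h; apply: (@qt_okt _ _ q); apply: qZ; rewrite mem_cat h orbT.
have h1 : cnt (Zs ++ X :: Xs) f <= cnt (rcons Zs Y ++ Xs) f + e * mu ^+ 2.
  rewrite cat_rcons !cnt_swap//; try exact: (@qt_okt _ _ q).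
  apply: le_trans (_ : cntG (Zs ++ Xs) (fun G => e * mu ^+ 2 + 1 * cntT Y G) f <= _).
    apply: (@cntG_le _ _ _ (reach q mu f) _ _ _ 0%N).
    - by move=> V s j G /qZ qV sV; exact: reach_tup sV.
    - exact: reach0.
    move=> G; rewrite add0n mul1r addrC => /(@reach_rclass _ _ _ _ q_gt1 mu rho f k) Gc.
    apply: XY; apply: Gc => //; rewrite size_cat; apply: leq_trans sk; by rewrite leq_add2l.
  by rewrite cntG_lin mul1r addrC lerD2l; exact: cntG_cst_le.
have h2 := IH Ys (rcons Zs Y) XsYs.
have {}h2 : cnt (rcons Zs Y ++ Xs) f <= cnt (Zs ++ Y :: Ys) f + (size Xs)%:R * (e * mu ^+ 2).
  rewrite -(cat_rcons Y Zs Ys); apply: h2 => //; last by rewrite size_rcons addSnnS.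
  move=> V; rewrite !(mem_cat, mem_rcons, inE) => h; apply: qq; move: h.
  by rewrite !(mem_cat, inE) => /or3P[/orP[->|->]|->|->]; rewrite ?orbT.
rewrite -natr1 mulrDl mul1r; move: h1 h2; clear; lra.
Qed.

Definition sel (B : block E) (b : bool) : nat := if b then 2 else bdim B.

(** All blocks have the same scale here; [t] tells which ones carry pairs. These counts are the ones
    that telescope. *)
Definition typ eta K (ps : seq (block E)) (t : seq bool) :=
  [seq tys p.1 eta K (sel p.1 p.2) | p <- zip ps t].

Definition gdom mu rho e eta Km Kp (B : block E) :=
  (bdim B <= q)%N /\ forall b, dominated mu rho e (tys B eta Kp (sel B b)) (tys B eta Km (sel B b)).

Lemma gdom_all (ps : seq (block E)) (e : R) : (forall b, b \in [seq bdim C | C <- ps] -> (b <= q)%N) ->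
  0 < e -> exists2 C0 : R, 1 <= C0 & forall C lam rho mu eta Km Kp, C0 <= C -> 0 < mu ->
    scales q C lam rho mu eta Km Kp -> each (gdom mu rho e eta Km Kp) ps.
Proof.
move=> + e0; elim: ps => [|B ps IH] psq; first by exists 1.
have Bq : (bdim B <= q)%N by apply: psq; rewrite mem_head.
have [|C1 C11 h1] := IH; first by move=> b bps; apply: psq; rewrite inE bps orbT.
have [C2 C21 h2] := @cntD_mono R E J (bdim B) (bio B) (@bio_norm _ _ B) q Bq 2 e isT e0.
have [C3 C31 h3] := @cntD_mono R E J (bdim B) (bio B) (@bio_norm _ _ B) q Bq _ e (bdim_gt0 B) e0.
exists (C1 + C2 + C3); first by lra.
move=> C lam rho mu eta Km Kp CC mu0 sc; split; last first.
  by apply: (h1 C lam) => //; clear -CC C21 C31; lra.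
split=> // -[] F Fc.
  by apply: (h2 C lam rho mu eta) => //; clear -CC C11 C31; lra.
by apply: (h3 C lam rho mu eta) => //; clear -CC C21 C11; lra.
Qed.

Lemma dominated_refl mu rho e X : 0 <= e -> dominated mu rho e X X.
Proof. by move=> e0 F _; rewrite lerDl mulr_ge0 ?sqr_ge0. Qed.

Lemma typ_dominated mu rho e eta Km Kp ps t : size t = size ps ->
  each (gdom mu rho e eta Km Kp) ps -> all2P (dominated mu rho e) (typ eta Kp ps t) (typ eta Km ps t).
Proof. by elim: ps t => [|B ps IH] [|b t] //= [st] [[_ gB] gps]; split; [exact: gB|exact: IH]. Qed.

Lemma choP_typ mu rho e eta Km Kp ps Xs : 0 <= e -> all2P (choP eta Km Kp) ps Xs ->
  each (gdom mu rho e eta Km Kp) ps -> exists t, [/\ size t = size ps,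
    all2P (dominated mu rho e) (typ eta Kp ps t) Xs & all2P (dominated mu rho e) Xs (typ eta Km ps t)].
Proof.
move=> e0; elim: ps Xs => [|B ps IH] [|X Xs] //=; first by exists [::].
move=> [cX cXs] [[_ gB] gps]; have [t [st h1 h2]] := IH _ cXs gps.
have gt := gB true; have gf := gB false; have rr Y := @dominated_refl mu rho e Y e0.
case: cX => ->; [exists (false :: t)|exists (true :: t)|exists (true :: t)];
  split; rewrite /= ?st//; split=> //; (exact: rr || exact: gf || exact: gt).
Qed.

Lemma qt_typ eta K ps t : (forall b, b \in [seq bdim C | C <- ps] -> (b <= q)%N) ->
  forall X, X \in typ eta K ps t -> qt q X.
Proof.
elim: ps t => [|B ps IH] [|b t] //= psq X; rewrite inE => /orP[/eqP ->|].
  apply: qt_tys; rewrite /sel; case: b => //; first exact: bdim_gt0.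
  by apply: psq; rewrite mem_head.
by apply: IH => c cps; apply: psq; rewrite inE cps orbT.
Qed.

Lemma full_typ eta K ps : full eta K ps = typ eta K ps (nseq (size ps) false).
Proof. by elim: ps => //= B ps ->. Qed.

Lemma typ_cat eta K ps ps' t t' : size t = size ps ->
  typ eta K (ps ++ ps') (t ++ t') = typ eta K ps t ++ typ eta K ps' t'.
Proof. by move=> st; rewrite /typ zip_cat// map_cat. Qed.

(** The differences in [hybrid] mix the two scales. Counts nearly increase as the scale gets finer,
    so making all the other blocks fine in the first count and coarse in the second bounds the mixed
    difference by one between two pure scales. *)
Lemma diagonal_bound mu rho e k eta Km Kp f ps ps1 B ps2 Xs (g : R) : 0 <= e ->
  (forall b, b \in [seq bdim C | C <- ps] -> (b <= q)%N) ->
  each (gdom mu rho e eta Km Kp) ps -> (size ps <= k)%N -> cl mu f -> modulus q k rho f ->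
  ps = ps1 ++ B :: ps2 -> all2P (choP eta Km Kp) ps2 Xs ->
  (forall t, size t = size ps -> cnt (typ eta Km ps t) f - cnt (typ eta Kp ps t) f <= g) ->
  cnt (full eta Km ps1 ++ tys B eta Km 2 :: Xs) f - cnt (full eta Km ps1 ++ tys B eta Kp 2 :: Xs) f
    <= g + 2 * ((size ps)%:R * (e * mu ^+ 2)).
Proof.
move=> e0 psq gps sk fc fm psE cXs tg.
have psq1 b : b \in [seq bdim C | C <- ps1] -> (b <= q)%N.
  by move=> h; apply: psq; rewrite psE map_cat mem_cat h.
have psq2 b : b \in [seq bdim C | C <- ps2] -> (b <= q)%N.
  by move=> h; apply: psq; rewrite psE map_cat mem_cat inE h !orbT.
have /each_cat[g1 [gB g2]] : each (gdom mu rho e eta Km Kp) (ps1 ++ B :: ps2) by rewrite -psE.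
have [t2 [st2 d1 d2]] := choP_typ e0 cXs g2.
pose t := nseq (size ps1) false ++ true :: t2.
have st : size t = size ps by rewrite /t psE !size_cat size_nseq /= st2.
have tE K : typ eta K ps t = full eta K ps1 ++ tys B eta K 2 :: typ eta K ps2 t2.
  by rewrite psE typ_cat ?size_nseq// -full_typ.
have qXs X : X \in Xs -> qt q X by apply: (@all2P_qt _ _ q (choP eta Km Kp) ps2 Xs psq2 _ cXs) => B' Y; exact: qt_cho.
have qf K X : X \in full eta K ps1 -> qt q X by rewrite full_typ; exact: qt_typ.
have qB K : qt q (tys B eta K 2) by exact: qt_tys.
have qT K X : X \in typ eta K ps2 t2 -> qt q X by exact: qt_typ.
have sXs : size Xs = size ps2 by rewrite (all2P_size cXs).
have emu : 0 <= e * mu ^+ 2 by rewrite mulr_ge0 ?sqr_ge0.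
have szP : (size ps = size ps1 + (size ps2).+1)%N by rewrite psE size_cat.
have u1 : cnt (full eta Km ps1 ++ tys B eta Km 2 :: Xs) f <=
    cnt (typ eta Km ps t) f + (size ps)%:R * (e * mu ^+ 2).
  rewrite tE -(cat_rcons _ _ Xs) -(cat_rcons _ _ (typ _ _ _ _)).
  apply: le_trans (@cnt_dominated mu rho e k f _ _ _ e0 d2 _ _ fc fm) _.
  - move=> X; rewrite !(mem_cat, mem_rcons, inE) => /or3P[/orP[/eqP -> //|/qf//]|/qXs//|/qT//].
  - by rewrite size_rcons size_map sXs addSnnS -szP.
  - by rewrite lerD2l ler_wpM2r// ler_nat sXs szP addnS leqW// leq_addl.
have d3 : all2P (dominated mu rho e) (typ eta Kp ps t) (full eta Km ps1 ++ tys B eta Kp 2 :: Xs).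
  rewrite tE; apply: all2P_cat.
    by rewrite !full_typ; apply: typ_dominated; rewrite ?size_nseq.
  by split => //; exact: dominated_refl.
have u2 := @cnt_dominated mu rho e k f [::] _ _ e0 d3.
have {}u2 : cnt (typ eta Kp ps t) f <= cnt (full eta Km ps1 ++ tys B eta Kp 2 :: Xs) f + (size ps)%:R * (e * mu ^+ 2).
  rewrite [in X in X * _](_ : size ps = size (typ eta Kp ps t)).
    apply: u2 => //; last by rewrite add0n tE size_cat /= size_map size_map size_zip st2 minnn -szP.
    move=> X; rewrite tE !(mem_cat, inE) /= -!orbA => /or4P[/qf//|/eqP -> //|/qT//|].
    by move/or3P => [/qf//|/eqP -> //|/qXs//].
  by rewrite size_map size_zip st minnn.
have := tg t st; move: u1 u2; clear; lra.
Qed.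

(** * Supports and lower bounds for the counts *)

Definition spread f (l : R) (j : nat) G := unitf G /\
  forall x, G x != 0 -> exists2 w, `|w| <= j%:R * l & f (x + w) != 0.

Lemma spread_tup f l j D a s G : (0 < a)%N -> (forall d, d \in D -> `|d| <= l) ->
  s \in tups D a -> spread f l j G -> spread f l j.+1 (tup s G).
Proof.
move=> a0 Dl sD [Gu Gs].
have s0 : s != [::] by rewrite -size_eq0 (tups_size sD) -lt0n.
split; first exact: tup_unit.
move=> x; rewrite tupE//; case: s sD s0 => // d s sD _; rewrite big_cons mulf_eq0 negb_or => /andP[/Gs[w wl fw] _].
exists (d + w); last by rewrite addrA.
by rewrite (le_trans (ler_normD _ _))// -natr1 mulrDl mul1r addrC lerD// Dl// (tups_mem sD)// mem_head.
Qed.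

Lemma spread_av f l j D G : (forall d, d \in D -> `|d| <= l) -> (0 < size D)%N ->
  spread f l j G -> spread f l j.+1 (av D G : ifun J).
Proof.
move=> Dl D0 [Gu Gs]; split.
  move=> x; rewrite avgE rmean_ge0/=; last by move=> d; case/andP: (Gu (x + d)).
  by rewrite -[leRHS](rmean_cst 1 D0); apply: rmean_le => d; case/andP: (Gu (x + d)).
move=> x; rewrite avgE => nz; have [d dD dG] : exists2 d, d \in D & G (x + d) != 0.
  apply/hasP; rewrite -[has _ _]negbK; apply/negP => /hasPn h; move/negP: nz; apply; apply/eqP.
  rewrite /rmean big_seq big1 ?mulr0// => d /h; by rewrite negbK => /eqP.
have [w wl fw] := Gs _ dG; exists (d + w); last by rewrite addrA.
by rewrite (le_trans (ler_normD _ _))// -natr1 mulrDl mul1r addrC lerD// Dl.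
Qed.

Lemma pgrid_norm (B : block E) eta K l d : 0 < eta -> K%:R * eta <= l ->
  d \in pgrid (bio B) eta K -> `|d| <= l.
Proof.
by move=> eta0 Kl /(mem_pgrid eta0)[h -> hK]; exact: (le_trans (@bio_norm _ _ B h) (le_trans hK Kl)).
Qed.

Lemma mem_full eta K ps X : X \in full eta K ps -> exists B, X = tys B eta K (bdim B).
Proof. by elim: ps => //= B ps IH; rewrite inE => /orP[/eqP ->|//]; exists B. Qed.

(** One use of Jensen's inequality for each block; all functions met are supported where [chi] is 1,
    so that [V] remains the right normalization. The exponent is the number of vertices of the
    product. *)
Lemma cnt_full_lower ps eta K l f chi (V : R) : 0 < eta -> (0 < K)%N -> K%:R * eta <= l -> 0 < V ->
  unitf f -> (forall x, 0 <= chi x) -> itg J chi <= V ->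
  (forall x w, `|w| <= (size ps)%:R * l -> f (x + w) != 0 -> chi x = 1) ->
  V * (itg J f / V) ^+ (\prod_(b <- [seq bdim C | C <- ps]) b) <= cnt (full eta K ps) f.
Proof.
move=> eta0 K0 Kl V0 fu chi0 chiV; elim/last_ind: ps => [|ps B IH] hc.
  by rewrite big_nil expr1 mulrC divfK// gt_eqF.
have l0 : 0 <= l by apply: le_trans Kl; rewrite mulr_ge0// ltW.
rewrite map_rcons -cats1 big_cat big_seq1 exprM /full map_rcons -cats1 /cnt cntG_cat -/(full eta K ps).
have IH' : V * (itg J f / V) ^+ (\prod_(b <- [seq bdim C | C <- ps]) b) <= cnt (full eta K ps) f.
  apply: IH => x w wl; apply: hc; apply: le_trans wl _.
  by rewrite size_rcons ler_wpM2r// ler_nat.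
have Pst X s j G : X \in full eta K ps -> s \in X -> spread f l j G -> spread f l j.+1 (tup s G).
  move=> /mem_full[B' ->]; apply: spread_tup; first exact: bdim_gt0.
  by move=> d; exact: pgrid_norm.
have P0 : spread f l 0 f.
  by split => // x fx; exists 0; rewrite ?normr0 ?mul0r// addr0.
have [a aE] : exists a, bdim B = a.+1 by exists (bdim B).-1; rewrite prednK// bdim_gt0.
have D0 : (0 < size (pgrid (bio B) eta K))%N by exact: pgrid_size.
have [c0 cP] := @cntG_power R E J (spread f l) (full eta K ps) (itg J) V a 0%N f V0 Pst P0
  (fun G hG => itg_ge0 (idomP G) (fun x => (andP (hG.1 x)).1)).
apply: (@le_trans _ _ (V * (cntG (full eta K ps) (itg J) f / V) ^+ a.+1)).
  rewrite aE ler_pM2l// lerXn2r ?nnegrE ?divr_ge0 ?exprn_ge0 ?(ltW V0)//.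
    by rewrite divr_ge0 ?(ltW V0)//; apply: itg_ge0 (idomP f) _ => x; case/andP: (fu x).
  by rewrite ler_pdivlMr// mulrC.
apply: le_trans cP _; apply: (@cntG_le _ _ _ (spread f l) _ _ _ 0%N) => // G GP.
have -> : cntG [:: tys B eta K (bdim B)] (itg J) G =
    ipr (nseq a.+1 (av (pgrid (bio B) eta K) G : ifun J)).
  by rewrite -aE; exact: cntD_ipr_pos (bdim_gt0 B).
rewrite -(itg_av G D0).
have GP' : spread f l (0 + size (full eta K ps)).+1 (av (pgrid (bio B) eta K) G : ifun J).
  by apply: spread_av GP => // d; exact: pgrid_norm.
apply: ipr_nseq_lower chiV => //; first exact: GP'.1.
move=> x /GP'.2[w wl fw]; apply: hc fw; apply: le_trans wl _.
by rewrite add0n size_map size_rcons.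
Qed.


Lemma itg_gt0_ex F : 0 < itg J F -> exists x, F x != 0.
Proof.
move=> F0; apply: contrapT => /forallNP h; move: F0.
by rewrite (@itg_eq _ _ J F (cst 0)) ?itg_cst0 ?ltxx// => x; have /negP := h x; rewrite negbK => /eqP.
Qed.

Lemma rmean_gt0_ex (I : eqType) (s : seq I) (g : I -> R) : 0 < rmean s g -> exists2 i, i \in s & 0 < g i.
Proof.
move=> s0; apply: contrapT => h; move: s0; apply/negP; rewrite -leNgt.
rewrite /rmean mulr_ge0_le0 ?invr_ge0// big_seq; apply: sumr_le0 => i si.
by rewrite leNgt; apply/negP => gi; apply: h; exists i.
Qed.

Lemma cnt_gt0_ex Xs F : (forall X, X \in Xs -> okt X) -> 0 < cnt Xs F ->
  exists ss x, all2P (fun X s => s \in X) Xs ss /\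
    forall ds, all2P (fun (s : seq E) d => d \in s) ss ds -> F (x + \sum_(d <- ds) d) != 0.
Proof.
elim: Xs F => [|X Xs IH] F ok.
  move=> /itg_gt0_ex[x Fx]; exists [::], x; split => // -[] //= _.
  by rewrite big_nil addr0.
move=> /rmean_gt0_ex[s sX c0].
have [|ss [x [hs hx]]] := IH (tup s F) _ c0.
  by move=> Y YX; apply: ok; rewrite inE YX orbT.
exists (s :: ss), x; split => // -[] // d ds [ds' dss].
have s0 : s != [::] by apply: (ok X) => //; rewrite mem_head.
have := hx ds dss; rewrite tupE// (prodf_seq_neq0) => /allP/(_ d ds').
by rewrite /= big_cons [d + _]addrC addrA.
Qed.

Lemma typ_cnt_bounds eta K ps t f : (0 < K)%N -> (forall b, b \in [seq bdim C | C <- ps] -> (b <= q)%N) ->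
  unitf f -> 0 <= cnt (typ eta K ps t) f <= itg J f.
Proof.
move=> K0 psq fu; have I0 : 0 <= itg J f by apply: itg_ge0 (idomP f) _ => x; case/andP: (fu x).
pose P (j : nat) G := unitf G /\ itg J G <= itg J f.
have Pst X s j G : X \in typ eta K ps t -> s \in X -> P j G -> P j.+1 (tup s G).
  move=> /(qt_typ psq) qX /qX[s0 _] [Gu Gf]; split; first exact: tup_unit.
  apply: le_trans Gf; case: s s0 => // d s _; rewrite -(itg_sh_ifun d G).
  apply: itg_le; [exact: idomP|exact: idomP|move=> x].
  rewrite tup_ifprod /= /bprod big_cons ler_piMr//; first by case/andP: (Gu (x + d)).
  have /andP[] // : 0 <= bprod [seq (sh e G : ifun J) | e <- s] x <= 1.
  by apply: bprod_unit => W /mapP[e _ ->] y; exact: Gu.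
have P0 : P 0%N f by [].
have [c0 _] := @cntG_power R E J P (typ eta K ps t) (itg J) 1 0 0%N f ltr01 Pst P0
  (fun G hG => itg_ge0 (idomP G) (fun x => (andP (hG.1 x)).1)).
rewrite c0/=; apply: le_trans (_ : cntG (typ eta K ps t) (fun=> itg J f) f <= _); last exact: cntG_cst_le.
by apply: (@cntG_le _ _ _ P _ _ _ 0%N) => // G [].
Qed.

(** If each scale were bad for some pattern, the sum over all patterns would drop by at least
    [h - (2 ^ n)%:R * e] at every step, the other patterns growing by at most [e]; but it stays
    between 0 and [(2 ^ n)%:R * M]. *)
Lemma pigeonhole_scale (n J0 : nat) (N : n.-tuple bool -> nat -> R) (M h e : R) :
  (forall t j, 0 <= N t j <= M) -> (forall t j, N t j.+1 <= N t j + e) -> 0 <= e ->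
  (2 ^ n)%:R * M < J0%:R * (h - (2 ^ n)%:R * e) ->
  exists2 j, (j < J0)%N & forall t, N t j - N t j.+1 <= h.
Proof.
move=> NM Ne e0 JM; apply: contrapT => hn.
have bad j : (j < J0)%N -> exists t, h < N t j - N t j.+1.
  move=> jJ; apply: contrapT => /forallNP hj; apply: hn; exists j => // t.
  by have /negP := hj t; rewrite -leNgt.
have Sj j : (j < J0)%N -> h - (2 ^ n)%:R * e <= \sum_t (N t j - N t j.+1).
  move=> /bad[t ht]; rewrite (bigD1 t)//=; apply: lerD; first exact: ltW.
  apply: (@le_trans _ _ (\sum_(i : n.-tuple bool | i != t) - e)).
    apply: (@le_trans _ _ (\sum_(i : n.-tuple bool) - e)).
      by rewrite sumr_const card_tuple card_bool -[leRHS]mulr_natl mulrN.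
    by rewrite [leLHS](bigD1 t)//= gerDr oppr_le0.
  by apply: ler_sum => i _; have := Ne i j; lra.
have : J0%:R * (h - (2 ^ n)%:R * e) <= (2 ^ n)%:R * M.
  apply: (@le_trans _ _ (\sum_(0 <= j < J0) \sum_t (N t j - N t j.+1))).
    rewrite big_mkord mulr_natl -[X in _ *+ X]card_ord -sumr_const; apply: ler_sum => j _; exact: Sj.
  rewrite exchange_big/=.
  have -> : (2 ^ n)%:R * M = \sum_(t : n.-tuple bool) M.
    by rewrite sumr_const card_tuple card_bool mulr_natl.
  apply: ler_sum => t _; rewrite (eq_bigr (fun j => - (N t j.+1 - N t j))); last by move=> j _; rewrite opprB.
  rewrite sumrN telescope_sumr// opprB.
  by have /andP[_ ?] := NM t 0%N; have /andP[? _] := NM t J0; lra.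
by move=> /le_lt_trans/(_ JM); rewrite ltxx.
Qed.

Lemma many_scales (ps : seq (block E)) (kap : R) :
  (forall b, b \in [seq bdim C | C <- ps] -> (b <= q)%N) -> 0 < kap ->
  exists (J0 : nat) (C : R), 1 <= C /\
  forall (lam : nat -> R) f chi (V : R), 0 < lam 0%N -> (forall j, C * lam j <= lam j.+1) ->
    0 < V -> unitf f -> (forall x, f x * f x = f x) -> kap * V <= itg J f -> itg J f <= V ->
    (forall x, 0 <= chi x) -> itg J chi <= V ->
    (forall j x w, (j < J0)%N -> `|w| <= (size ps)%:R * lam j -> f (x + w) != 0 -> chi x = 1) ->
    (forall b, 0 < b -> exists2 r, 0 < r & forall w, `|w| <= r -> nrm (sh w f - f) <= b) ->
  exists2 j, (j < J0)%N & exists ss x,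
    all2P (fun B s => sim (bio B) (@bpt _ _ B) (lam j) s) ps ss /\
    forall ds, all2P (fun (s : seq E) d => d \in s) ss ds -> f (x + \sum_(d <- ds) d) != 0.
Proof.
move=> psq kap0; pose A := \prod_(b <- [seq bdim C | C <- ps]) b; pose n := size ps.
have kA : 0 < kap ^+ A by exact: exprn_gt0.
have kA2 : 0 < kap ^+ A / 2 by rewrite divr_gt0.
have [C1 [h [C11 h0 hyb]]] := @hybrid R E J q q_gt1 ps (kap ^+ A / 2) psq kA2.
have n2 : 1 <= (2 ^ n)%:R :> R by rewrite ler1n expn_gt0.
have [D [D1 nD n2D]] : exists D : R, [/\ 1 <= D, n%:R <= D & (2 ^ n)%:R * n%:R <= D].
  exists ((2 ^ n)%:R * n.+1%:R); split; rewrite -?natrM ?ler1n ?ler_nat ?muln_gt0 ?expn_gt0//.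
    by apply: leq_trans (leqnSn n) _; rewrite leq_pmull// expn_gt0.
  by rewrite leq_mul2l leqnSn orbT.
have D0 : 0 < D by lra.
have [e [e0 eD]] : exists e : R, 0 < e /\ 4 * (D * e) = h.
  by exists (h / (4 * D)); split; [rewrite divr_gt0// mulr_gt0|field; rewrite gt_eqF].
have [C2 C21 gd] := gdom_all psq e0.
(* Of the allowed drop [h / 2], the errors of monotonicity take at most [h / 4], and
   [J0%:R * (h / 4)] must exceed [(2 ^ n)%:R]. *)
have [J0 [J00 J0h]] := exists_nat_ge (8 * (2 ^ n)%:R / h).
pose C := C1 + C2.
have C0 : 1 <= C by rewrite /C; lra.
have C0' : 0 < C by lra.
(* Between consecutive terms there must be room for a grid [C] times larger than one and [C] times
   smaller than the next, up to a factor 2 for the rounding of its number of points. *)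
exists J0, (2 * C ^+ 2); split; first by nra.
move=> lam f chi V lam0 lamS V0 fu ff kV fV chi0 chiV chi1 fcont.
have lamp j : 0 < lam j.
  by elim: j => // j IH; apply: lt_le_trans (lamS j); rewrite mulr_gt0// mulr_gt0// exprn_gt0.
have laminc j : lam 0%N <= lam j.
  elim: j => // j IH; apply: le_trans IH _; apply: le_trans (lamS j).
  by rewrite ler_peMl// ?ltW//; nra.
have I0 : 0 < itg J f by apply: lt_le_trans kV; rewrite mulr_gt0.
pose mu := nrm f.
have mu2 : mu ^+ 2 = itg J f by rewrite nrm_sqr ipE; apply: itg_eq => x; exact: ff.
have mu0 : 0 < mu by rewrite lt_def nrm_ge0 andbT -sqrf_eq0 mu2 gt_eqF.
have fcl : cl mu f by split.
have [rho rhoP] : exists rho : R -> R, forall b, 0 < b -> 0 < rho b /\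
    forall w, `|w| <= rho b -> q%:R ^+ n * nrm (sh w f - f) <= b.
  have qn : 0 < q%:R ^+ n :> R by rewrite exprn_gt0// ltr0n ltnW.
  have /choice[rho rhoP] b : exists r : R, 0 < b -> 0 < r /\
      forall w, `|w| <= r -> q%:R ^+ n * nrm (sh w f - f) <= b.
    have [b0|] := ltP 0 b; last by move=> _; exists 0.
    have [r r0 rP] := fcont (b / q%:R ^+ n) (divr_gt0 b0 qn).
    by exists r => _; split => // w /rP; rewrite ler_pdivlMr// mulrC.
  by exists rho.
have rho0 b : 0 < b -> 0 < rho b by move=> /rhoP[].
have fm : modulus q n rho f by move=> b /rhoP[].
have q0 : 0 < q%:R :> R by rewrite ltr0n ltnW.
have [eta [eta0 etar eta1]] : exists eta : R, [/\ 0 < eta, q%:R * eta <= rho (mu / C) & eta <= lam 0%N / C].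
  have r0 : 0 < rho (mu / C) by apply: rho0; exact: divr_gt0.
  exists (Num.min (rho (mu / C) / q%:R) (lam 0%N / C)); split.
  - by rewrite lt_min !divr_gt0.
  - by rewrite mulrC -ler_pdivlMr// ge_min lexx.
  - by rewrite ge_min lexx orbT.
have eta_lam j : eta <= lam j.
  apply: le_trans eta1 _; apply: le_trans (laminc j); rewrite ler_pdivrMr// ler_peMr//; exact: ltW.
have /choice[K' K'P] j : exists K : nat, C * lam j <= K%:R * eta <= 2 * (C * lam j).
  have x0 : 0 <= C * lam j / eta by rewrite divr_ge0 ?mulr_ge0 ?ltW.
  exists (Num.truncn (C * lam j / eta)).+1.
  have /andP[t1 t2] := truncn_itv x0.
  rewrite -ler_pdivrMr// (ltW t2)/= -natr1 mulrDl mul1r.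
  have : (Num.truncn (C * lam j / eta))%:R * eta <= C * lam j by rewrite -ler_pdivlMr.
  have : eta <= C * lam j by apply: le_trans (eta_lam j) _; rewrite ler_peMl// ltW.
  lra.
(* The coarse grid at [lam j] is the fine grid at [lam j.+1], with one step [eta] for all; this is
   what lets the differences telescope. *)
pose K j := if j is i.+1 then K' i else 1%N.
have sc j : scales q C (lam j) rho mu eta (K j) (K j.+1).
  have /andP[k1 k2] := K'P j.
  have CK : C <= (K' j)%:R.
    rewrite -(ler_pM2r eta0); apply: le_trans k1; rewrite ler_pM2l//; exact: eta_lam.
  split => //.
  - case: j {k1 k2 CK} => // i; have /andP[k1 _] := K'P i; rewrite /= -(ltr_nat R) -(pmulr_lgt0 _ eta0).
    by apply: lt_le_trans k1; rewrite mulr_gt0.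
  - case: j {k1 k2 CK} => [|i] /=; first by rewrite mul1r.
    have /andP[_ k2] := K'P i; apply: le_trans k2 _; rewrite ler_pdivlMr//; apply: le_trans (lamS i).
    by rewrite le_eqVlt; apply/orP; left; apply/eqP; ring.
have K0 j : (0 < K j)%N by exact: sc_Km0 (sc j).
have gds j : each (gdom mu rho e eta (K j) (K j.+1)) ps.
  by apply: (gd C (lam j)) => //; rewrite /C; lra.
pose N (t : n.-tuple bool) j := cnt (typ eta (K j) ps t) f.
have st (t : n.-tuple bool) : size t = size ps by rewrite size_tuple.
have emu : 0 <= e * mu ^+ 2 by rewrite mulr_ge0 ?sqr_ge0// ltW.
have [j jJ jP] : exists2 j, (j < J0)%N & forall t, N t j - N t j.+1 <= h / 2 * mu ^+ 2.
  apply: (@pigeonhole_scale n J0 N (mu ^+ 2) (h / 2 * mu ^+ 2) (n%:R * (e * mu ^+ 2))).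
  - by move=> t j; rewrite mu2; apply: typ_cnt_bounds.
  - move=> t j; have := @cnt_dominated mu rho e n f [::] _ _ (ltW e0) (typ_dominated (st t) (gds j)).
    rewrite (_ : size (typ _ _ _ _) = n); last by rewrite size_map size_zip st minnn.
    apply => // X /=; rewrite mem_cat => /orP[] hX; exact: (qt_typ psq hX).
  - by rewrite mulr_ge0.
  have eD' : (2 ^ n)%:R * (n%:R * (e * mu ^+ 2)) <= h / 4 * mu ^+ 2.
    rewrite -eD (_ : 4 * (D * e) / 4 = D * e); last by field.
    rewrite [leLHS](_ : _ = (2 ^ n)%:R * n%:R * (e * mu ^+ 2)); last by rewrite mulrA.
    by rewrite -(mulrA D) ler_wpM2r.
  have h4 : (2 ^ n)%:R < J0%:R * (h / 4).
    move: J0h; rewrite ler_pdivrMr// mulrA; move: (J0%:R * h) => y.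
    by move: ((2 ^ n)%:R : R) n2 => z n2 zy; clear -n2 zy; lra.
  apply: lt_le_trans (_ : J0%:R * (h / 4) * mu ^+ 2 <= _).
    by rewrite ltr_pM2r// exprn_gt0.
  rewrite -mulrA ler_wpM2l//; move: eD'; lra.
have CC1 : C1 <= C by rewrite /C; lra.
have [sgs sims sgP] := hyb C (lam j) rho mu CC1 (lamp j) rho0 mu0.
have diag : `|cnt (sgs ++ [::]) f - cnt (full eta (K j) ps ++ [::]) f| <= kap ^+ A / 2 * mu ^+ 2.
  apply: (sgP eta (K j) (K j.+1) f n [::]) => //; first by rewrite addn0.
  move=> ps1 B ps2 Xs psE cXs; rewrite cats0.
  apply: le_trans (@diagonal_bound mu rho e n eta (K j) (K j.+1) f ps ps1 B ps2 Xs (h / 2 * mu ^+ 2)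
    (ltW e0) psq (gds j) (leqnn _) fcl fm psE cXs _) _.
    move=> t /eqP tn; exact: (jP (Tuple tn)).
  have : n%:R * (e * mu ^+ 2) <= h / 4 * mu ^+ 2.
    rewrite -eD (_ : 4 * (D * e) / 4 = D * e); last by field.
    by rewrite -(mulrA D) ler_wpM2r.
  by rewrite -/n; lra.
rewrite !cats0 in diag.
(* Jensen's bound is at least [V * kap ^+ A], and [mu ^+ 2], the integral of [f], is at most [V]. *)
have low : kap ^+ A * mu ^+ 2 <= cnt (full eta (K j) ps) f.
  have Kl : (K j)%:R * eta <= lam j.
    apply: le_trans (sc_Km (sc j)) _; rewrite ler_pdivrMr// ler_peMr//; exact: ltW.
  apply: le_trans (@cnt_full_lower ps eta (K j) (lam j) f chi V eta0 (K0 j) Kl V0 fu chi0 chiV _).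
    rewrite mulrC mu2; apply: ler_pM => //; first exact: ltW.
      by rewrite exprn_ge0// ltW.
    by rewrite lerXn2r ?nnegrE ?divr_ge0 ?(ltW V0) ?(ltW I0) ?(ltW kap0)// ler_pdivlMr.
  by move=> x w wl; exact: chi1 wl.
have pos : 0 < cnt sgs f.
  have : 0 < kap ^+ A * mu ^+ 2 by rewrite mulr_gt0// exprn_gt0.
  move: diag low; rewrite ler_norml => /andP[d _].
  rewrite (_ : kap ^+ A / 2 * mu ^+ 2 = kap ^+ A * mu ^+ 2 / 2) in d; last by field.
  by move: d; clear; lra.
exists j => //.
have qsgs : forall X, X \in sgs -> qt q X.
  by apply: (@all2P_qt _ _ q (sysP (lam j)) ps sgs psq _ sims) => B X; exact: qt_sys.
have [ss [x [hs hx]]] := cnt_gt0_ex (fun X hX => qt_okt (qsgs X hX)) pos.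
exists ss, x; split => //.
by apply: all2P_trans sims hs => B X s [_]; exact.
Qed.

End Core.

(** * Lebesgue measure *)

Section Lebesgue.
Variables (R : realType) (n : nat).
Local Open Scope ereal_scope.
Implicit Types (A B : set 'rV[R]_n) (a b : 'rV[R]_n) (w : 'rV[R]_n).

Definition bvol a b : R := (\prod_(i < n) (b 0 i - a 0 i))%R.

Lemma bvol_ge0 a b : (forall i, a 0 i <= b 0 i)%R -> (0 <= bvol a b)%R.
Proof. by move=> ab; apply: prodr_ge0 => i _; rewrite subr_ge0. Qed.

Lemma leb_cover (a b : nat -> 'rV[R]_n) A : (forall k i, a k 0 i <= b k 0 i)%R ->
  A `<=` \bigcup_k box (a k) (b k) -> leb A <= \sum_(0 <= k <oo) (bvol (a k) (b k))%:E.
Proof. by move=> ab Aab; apply: ereal_inf_lbound; exists a, b. Qed.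

Lemma leb_glb A (x : \bar R) : (forall (a b : nat -> 'rV[R]_n), (forall k i, a k 0 i <= b k 0 i)%R ->
  A `<=` \bigcup_k box (a k) (b k) -> x <= \sum_(0 <= k <oo) (bvol (a k) (b k))%:E) -> x <= leb A.
Proof. by move=> h; apply: le_ereal_inf_tmp => _ [a [b [ab Aab ->]]]; exact: h. Qed.

Lemma leb_ge0 A : 0 <= leb A.
Proof.
by apply: leb_glb => a b ab _; apply: nneseries_ge0 => k _ _; rewrite lee_fin bvol_ge0.
Qed.

Lemma le_leb : {homo @leb R n : A B / A `<=` B >-> A <= B}.
Proof.
by move=> A B AB; apply: leb_glb => a b ab Bab; apply: leb_cover => // x /AB /Bab.
Qed.

Lemma leb_adherent A (e : R) : (0 < e)%R -> leb A < +oo -> exists (a b : nat -> 'rV[R]_n),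
  [/\ forall k i, (a k 0 i <= b k 0 i)%R, A `<=` \bigcup_k box (a k) (b k) &
   \sum_(0 <= k <oo) (bvol (a k) (b k))%:E <= leb A + e%:E].
Proof.
move=> e0 Aoo; have Af : leb A \is a fin_num by rewrite ge0_fin_numE// leb_ge0.
by have [_ [a [b [ab Aab ->]]] /ltW h] := lb_ereal_inf_adherent e0 Af; exists a, b.
Qed.

Lemma leb_sigma_subadditive : sigma_subadditive (@leb R n).
Proof.
move=> A; have [[i Ai]|noo] := pselect (exists i, leb (A i) = +oo).
  by rewrite (eseries_pinfty _ _ Ai) ?leey// => k _; rewrite -ltNye (lt_le_trans _ (leb_ge0 _)).
have Aoo i : leb (A i) < +oo by rewrite ltey; apply/eqP => h; apply: noo; exists i.
apply/lee_addgt0Pr => e e0.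
apply: le_trans (epsilon_trick predT (fun k => leb_ge0 (A k)) (ltW e0)).
have P i : exists ab : (nat -> 'rV[R]_n) * (nat -> 'rV[R]_n),
    [/\ forall k j, (ab.1 k 0 j <= ab.2 k 0 j)%R, A i `<=` \bigcup_k box (ab.1 k) (ab.2 k) &
     \sum_(0 <= k <oo) (bvol (ab.1 k) (ab.2 k))%:E <= leb (A i) + (e / (2 ^ i.+1)%:R)%:E].
  have ei : (0 < e / (2 ^ i.+1)%:R)%R by rewrite divr_gt0// ltr0n expn_gt0.
  by have [a [b h]] := leb_adherent ei (Aoo i); exists (a, b).
have [ab abP] := choice P.
pose v (ij : nat * nat) : \bar R := (bvol ((ab ij.1).1 ij.2) ((ab ij.1).2 ij.2))%:E.
have v0 ij : 0 <= v ij by rewrite lee_fin bvol_ge0// => j; case: (abP ij.1).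
have /card_esym/ppcard_eqP[f] := card_nat2.
apply: (@le_trans _ _ (\sum_(0 <= k <oo) v (f k))).
  apply: (@leb_cover (fun k => (ab (f k).1).1 (f k).2) (fun k => (ab (f k).1).2 (f k).2)).
    by move=> k i; case: (abP (f k).1).
  move=> x [i _ Aix]; have [_ /(_ x Aix)[j _ xj] _] := abP i.
  by exists (f^-1%FUN (i, j)) => //=; rewrite invK// inE.
rewrite nneseries_esumT//.
have -> : \esum_(k in setT) v (f k) = \esum_(ij in setT) v ij.
  by rewrite (reindex_esum setT setT f)//.
have -> : \esum_(ij in setT) v ij = \esum_(i in setT) \esum_(j in setT) v (i, j).
  rewrite esum_esum//; have -> : [set: nat] `*`` (fun=> [set: nat]) = [set: nat * nat] by apply/seteqP; split.
  by apply: eq_esum => -[].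
rewrite -nneseries_esumT//; last by move=> i; exact: esum_ge0.
apply: lee_nneseries => i _; first by move=> _; exact: esum_ge0.
by rewrite -nneseries_esumT//; case: (abP i).
Qed.

Lemma series_head (v : nat -> \bar R) : (forall k, (0 < k)%N -> v k = 0) -> 0 <= v 0%N ->
  \sum_(0 <= k <oo) v k = v 0%N.
Proof.
move=> vk v0; rewrite nneseries_recl//; last first.
  by move=> [|k] _ //; rewrite vk.
by rewrite eseries0 ?adde0// => k k1 _; exact: vk.
Qed.

(** In dimension 0 every box has volume 1 and every cover infinite volume, even for the empty
    set. *)
Hypothesis n_gt0 : (0 < n)%N.

Lemma bvol0 a : bvol a a = 0%R.
Proof. by rewrite /bvol (bigD1 (Ordinal n_gt0))//= subrr mul0r. Qed.

Lemma leb_box a b : (forall i, a 0 i <= b 0 i)%R -> leb (box a b) <= (bvol a b)%:E.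
Proof.
move=> ab; pose b' k := if k is 0%N then b else a.
apply: le_trans (@leb_cover (fun=> a) b' _ _ _) _.
- by move=> [|k] i //=.
- by move=> x xab; exists 0%N.
by rewrite series_head//= ?lee_fin ?bvol_ge0// => -[|k] // _; rewrite /= bvol0.
Qed.

Lemma leb0 : leb (set0 : set 'rV[R]_n) = 0.
Proof.
apply/eqP; rewrite eq_le leb_ge0 andbT; apply: le_trans (@le_leb _ (box 0 0) _) _ => //.
by apply: le_trans (leb_box _) _ => //; rewrite bvol0.
Qed.

Definition lebo : {outer_measure set 'rV[R]_n -> \bar R} :=
  HB.pack (@leb R n) (isOuterMeasure.Build R _ (@leb R n) leb0 leb_ge0 le_leb leb_sigma_subadditive).

Lemma leb_translate_le w A : leb ((fun x => (x + w)%R) @^-1` A) <= leb A.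
Proof.
apply: leb_glb => a b ab Aab.
have -> : \sum_(0 <= k <oo) (bvol (a k) (b k))%:E =
    \sum_(0 <= k <oo) (bvol (a k - w) (b k - w))%:E.
  apply: eq_eseriesr => k _; congr (_%:E); apply: eq_bigr => i _; rewrite !mxE; ring.
apply: (@leb_cover (fun k => a k - w)%R (fun k => b k - w)%R) => [k i|x /= /Aab[k _ xk]].
  by rewrite !mxE lerB.
by exists k => // i; have := xk i; rewrite !mxE lerBlDr lerBrDr.
Qed.

Lemma leb_translate w A : leb ((fun x => (x + w)%R) @^-1` A) = leb A.
Proof.
apply/eqP; rewrite eq_le leb_translate_le/=.
apply: le_trans (leb_translate_le (- w) _); apply: le_leb => x Ax /=; by rewrite subrK.
Qed.

Lemma leb_dilate (c : R) A : (0 < c)%R ->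
  leb ((fun x => (c^-1 *: x)%R) @^-1` A) <= (c ^+ n)%:E * leb A.
Proof.
move=> c0; have cn : (0 < c ^+ n)%R by rewrite exprn_gt0.
rewrite -lee_pdivrMl//; apply: leb_glb => a b ab Aab; rewrite lee_pdivrMl//.
rewrite -nneseriesZl; last by move=> k _; rewrite lee_fin bvol_ge0.
have -> : \sum_(0 <= k <oo) (c ^+ n)%:E * (bvol (a k) (b k))%:E =
    \sum_(0 <= k <oo) (bvol (c *: a k) (c *: b k))%:E.
  apply: eq_eseriesr => k _; rewrite -EFinM; congr (_%:E); rewrite /bvol.
  under [RHS]eq_bigr do rewrite !mxE -mulrBr.
  by rewrite big_split/= prodr_const card_ord.
apply: (@leb_cover (fun k => c *: a k)%R (fun k => c *: b k)%R) => [k i|x /= /Aab[k _ xk]].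
  by rewrite !mxE ler_pM2l.
exists k => // i; have := xk i; rewrite !mxE.
by rewrite ler_pdivlMl// ler_pdivrMl.
Qed.

(** The hyperplane cuts each box of a cover into two boxes whose volumes add up. The two conditions
    cover open and closed half-spaces alike. *)
Lemma cara_half (i : 'I_n) (c : R) A : (forall x, A x -> x 0 i <= c)%R ->
  (forall x, ~ A x -> c <= x 0 i)%R -> leb_measurable A.
Proof.
move=> Ac cA; apply: (@le_caratheodory_measurable R _ lebo) => X.
apply: leb_glb => a b ab Xab.
pose cl k := (Num.max (a k 0 i) (Num.min (b k 0 i) c))%R.
have acl k : (a k 0 i <= cl k)%R by rewrite le_max lexx.
have clb k : (cl k <= b k 0 i)%R by rewrite ge_max ab ge_min lexx.
pose upd (u : 'rV[R]_n) (y : R) : 'rV[R]_n := (\row_j (if j == i then y else u 0 j))%R.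
have volE k : bvol (a k) (b k) = (bvol (a k) (upd (b k) (cl k)) + bvol (upd (a k) (cl k)) (b k))%R.
  rewrite /bvol !(bigD1 i (P := predT))//= !mxE eqxx.
  under [X in ((cl k - _) * X + _)%R]eq_bigr => j ji do rewrite !mxE (negPf ji).
  under [X in (_ + (_ - cl k) * X)%R]eq_bigr => j ji do rewrite !mxE (negPf ji).
  by rewrite -mulrDl; congr (_ * _)%R; ring.
have h1 k j : (a k 0 j <= upd (b k) (cl k) 0 j)%R by rewrite !mxE; case: eqP => [->|].
have h2 k j : (upd (a k) (cl k) 0 j <= b k 0 j)%R by rewrite !mxE; case: eqP => [->|].
under [leRHS]eq_eseriesr do rewrite volE EFinD.
rewrite nneseriesD; [|by move=> k _ _; rewrite lee_fin bvol_ge0..].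
apply: leeD.
  apply: (@leb_cover a (fun k => upd (b k) (cl k))) => // x [/Xab[k _ xk] Ax].
  exists k => // j; rewrite !mxE; have /andP[x1 x2] := xk j; rewrite x1/=.
  by case: eqP => // ji; rewrite /cl le_max le_min -ji x2/= [in X in (_ || X)]ji Ac ?orbT.
apply: (@leb_cover (fun k => upd (a k) (cl k)) b) => // x [/Xab[k _ xk] nAx].
exists k => // j; rewrite !mxE; have /andP[x1 x2] := xk j; rewrite x2 andbT.
by case: eqP => // ji; rewrite /cl ge_max ge_min -ji x1/= [in X in (_ || X)]ji cA ?orbT.
Qed.

Lemma cara_box a b : leb_measurable (box a b).
Proof.
have half i : leb_measurable [set x : 'rV[R]_n | a 0 i <= x 0 i <= b 0 i]%R.
  have -> : [set x : 'rV[R]_n | a 0 i <= x 0 i <= b 0 i]%R =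
     ~` [set x | x 0 i < a 0 i]%R `&` [set x | x 0 i <= b 0 i]%R.
    apply/seteqP; split => x /=; first by move=> /andP[x1 x2]; split => //; apply/negP; rewrite -leNgt.
    by move=> [/negP]; rewrite -leNgt => -> ->.
  apply: (@caratheodory_measurable_setI R _ lebo).
    apply: (@caratheodory_measurable_setC R _ lebo).
    have : leb_measurable [set x : 'rV[R]_n | x 0 i < a 0 i]%R.
      apply: (@cara_half i (a 0%R i)) => [x /ltW //|x].
      by move/negP; rewrite -leNgt.
    exact.
  suff : leb_measurable [set x : 'rV[R]_n | x 0 i <= b 0 i]%R by [].
  by apply: (@cara_half i (b 0%R i)) => x //= /negP; rewrite -ltNge => /ltW.
have -> : box a b = ~` \bigcup_k (if insub k is Some i then ~` [set x : 'rV[R]_n | a 0 i <= x 0 i <= b 0 i]%R else set0).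
  apply/seteqP; split => [x xab [k _]|x nx i].
    by case: insubP => // i _ _ /=; apply; exact: xab.
  by apply: contrapT => h; apply: nx; exists i => //; rewrite valK.
apply: (@caratheodory_measurable_setC R _ lebo); apply: (@caratheodory_measurable_bigcup R _ lebo) => k.
case: insubP => [i _ _|_]; last exact: (caratheodory_measurable_set0 lebo).
exact: (@caratheodory_measurable_setC R _ lebo _ (half i)).
Qed.

Lemma cara_translate w A : leb_measurable A -> leb_measurable ((fun x => (x + w)%R) @^-1` A).
Proof.
move=> mA X; have XE : X = (fun x => (x + w)%R) @^-1` ((fun x => (x - w)%R) @^-1` X).
  by apply/funext => x /=; rewrite addrK.
rewrite {1}XE leb_translate mA -(leb_translate w (_ `&` A)) -(leb_translate w (_ `&` ~` A)).
by rewrite !preimage_setI -XE.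
Qed.


(** The total volume is a polynomial in the amount of enlargement, hence continuous at 0. *)
Lemma enlarged_volume (a b : nat -> 'rV[R]_n) (K : nat) (e : R) : (0 < e)%R ->
  exists2 r : R, (0 < r)%R & (\sum_(0 <= k < K) bvol (a k - const_mx r) (b k + const_mx r) <=
    \sum_(0 <= k < K) bvol (a k) (b k) + e)%R.
Proof.
move=> e0; pose p : {poly R} := (\sum_(0 <= k < K) \prod_(i < n) ((b k 0%R i - a k 0%R i)%:P + 2%:P * 'X))%R.
have pE t : (p.[t] = \sum_(0 <= k < K) bvol (a k - const_mx t) (b k + const_mx t))%R.
  rewrite horner_sum; apply: eq_bigr => k _; rewrite horner_prod; apply: eq_bigr => i _.
  by rewrite !hornerE !mxE; ring.
have p0 : (p.[0] = \sum_(0 <= k < K) bvol (a k) (b k))%R.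
  rewrite pE; apply: eq_bigr => k _; apply: eq_bigr => i _; by rewrite !mxE; ring.
have /cvgrPdist_le/(_ _ e0) := @continuous_horner R p 0%R.
move=> /nbhs_ballP[d /= d0 hd].
exists (d / 2)%R; first by rewrite divr_gt0.
rewrite -pE -p0; have := hd (d / 2)%R; rewrite /ball /= sub0r normrN ger0_norm; last by rewrite divr_ge0// ltW.
by rewrite ltr_pdivrMr// ltr_pMr// ltr1n => /(_ isT); rewrite distrC => /ler_normlP[_]; rewrite lerBlDl.
Qed.

(* Both A and its translate are covered by finitely many slightly enlarged boxes of
   a cover of A, together with the tails of the cover and of its translate. *)
Lemma leb_translate_diff A (e : R) : leb_measurable A -> leb A < +oo -> (0 < e)%R ->
  exists2 r : R, (0 < r)%R & forall w, (`|w| <= r)%R ->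
    leb ((fun x => (x + w)%R) @^-1` A `\` A) <= e%:E.
Proof.
move=> mA Aoo e0; have e4 : (0 < e / 4)%R by rewrite divr_gt0.
have Af : leb A \is a fin_num by rewrite ge0_fin_numE// leb_ge0.
(* One quarter of [e] for the cover, one for the enlargement, and one for each of the two tails. *)
have [a [b [ab Aab hV]]] := leb_adherent e4 Aoo.
pose v k : \bar R := (bvol (a k) (b k))%:E.
have v0 k : 0 <= v k by rewrite lee_fin bvol_ge0.
have Voo : \sum_(0 <= k <oo) v k < +oo.
  by apply: le_lt_trans hV _; rewrite lte_add_pinfty// ltry.
have [K hK] : exists K, \sum_(K <= k <oo) v k <= (e / 4)%:E.
  have := @nneseries_tail_cvg R v predT Voo (fun k _ => v0 k).
  move=> /(_ [set y | y < (e / 4)%:E]) []; first by apply: open_ereal_lt'; rewrite lte_fin.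
  by move=> K _ hK; exists K; apply: ltW; apply: hK => /=.
have [r r0 hr] := enlarged_volume a b K e4.
exists r => // w wr.
have wi i : (- r <= w 0%R i <= r)%R.
  rewrite -ler_norml; apply: le_trans wr; rewrite [leRHS]mx_normrE.
  exact: (le_bigmax _ (fun ij => `|w ij.1 ij.2|%R) (0%R, i)).
pose D k := if (k < K)%N then box (a k - const_mx r) (b k + const_mx r)
  else box (a k) (b k) `|` box (a k - w) (b k - w).
pose Aw := (fun x => (x + w)%R) @^-1` A.
have sub : A `|` Aw `<=` \bigcup_k D k.
  move=> x [/Aab[k _ xk]|/Aab[k _ xk]]; exists k => //; rewrite /D; case: ifP => _.
  - move=> i; have /andP[x1 x2] := xk i; rewrite !mxE; apply/andP; split.
      by apply: le_trans x1; rewrite gerBl ltW.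
    by apply: le_trans x2 _; rewrite lerDl ltW.
  - by left.
  - move=> i; have /andP[x1 x2] := xk i; have /andP[w1 w2] := wi i; rewrite !mxE in x1 x2 *.
    by apply/andP; split; [move: x1 w2|move: x2 w1]; clear; lra.
  - by right=> i; have := xk i; rewrite !mxE lerBlDr lerBrDr.
have Dle k : leb (D k) <= if (k < K)%N then (bvol (a k - const_mx r) (b k + const_mx r))%:E else 2%:E * v k.
  rewrite /D; case: ifP => _.
    apply: leb_box => i; rewrite !mxE; have := ab k i; move: r0; clear; lra.
  apply: le_trans (outer_measureU2 lebo _ _) _.
  have -> : 2%:E * v k = v k + v k by rewrite -EFinM -EFinD mulr_natl mulr2n.
  apply: leeD; first exact: leb_box.
  rewrite /v (_ : bvol (a k) (b k) = bvol (a k - w) (b k - w)).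
    by apply: leb_box => i; rewrite !mxE lerB.
  by apply: eq_bigr => i _; rewrite !mxE; ring.
have main : leb (A `|` Aw) <= leb A + e%:E.
  apply: le_trans (le_leb sub) _; apply: le_trans (leb_sigma_subadditive _) _.
  apply: le_trans (lee_nneseries (fun k _ _ => leb_ge0 (D k)) (fun k _ => Dle k)) _.
  rewrite (nneseries_split _ K); last first.
    move=> k _; case: ifP => _; last by rewrite mule_ge0// lee_fin.
    by rewrite lee_fin bvol_ge0// => i; rewrite !mxE; have := ab k i; move: r0; clear; lra.
  rewrite add0n; have -> : \sum_(0 <= k < K) (if (k < K)%N then (bvol (a k - const_mx r) (b k + const_mx r))%:E else 2%:E * v k)
     = (\sum_(0 <= k < K) bvol (a k - const_mx r) (b k + const_mx r))%:E.
    by rewrite -sumEFin; apply: eq_big_nat => k /andP[_ ->].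
  have -> : \sum_(K <= k <oo) (if (k < K)%N then (bvol (a k - const_mx r) (b k + const_mx r))%:E else 2%:E * v k)
     = 2%:E * \sum_(K <= k <oo) v k.
    rewrite -nneseriesZl; last by move=> k _.
      rewrite [LHS]eseries_cond [RHS]eseries_cond; apply: eq_eseriesr => k /=.
    by rewrite leqNgt => /negPf ->.
  have sv : (\sum_(0 <= k < K) bvol (a k) (b k) <= fine (leb A) + e / 4)%R.
    rewrite -lee_fin EFinD (fineK Af); apply: le_trans hV; rewrite -sumEFin.
    by rewrite (nneseries_split _ K) ?add0n ?leeDl//; [apply: nneseries_ge0|] => k _; rewrite lee_fin bvol_ge0.
  apply: (@le_trans _ _ ((fine (leb A) + e / 4 + e / 4)%:E + 2%:E * (e / 4)%:E)).
    apply: leeD; last by rewrite lee_wpmul2l// lee_fin.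
    by rewrite lee_fin; apply: le_trans hr _; rewrite lerD2r.
  by rewrite -EFinM -EFinD -{2}(fineK Af) -EFinD lee_fin; clear; lra.
(* Measurability of [A], tested on the union, turns the bound for the union into one for the
   difference. *)
have mX := mA (A `|` Aw).
move: main; rewrite mX.
have -> : (A `|` Aw) `&` A = A by apply/seteqP; split => [x []//|x Ax]; split => //; left.
have -> : (A `|` Aw) `&` ~` A = Aw `\` A by apply/seteqP; split => [x [[//|]]|x [h1 h2]]; split => //; right.
by rewrite [(leb A + leb _)%R](_ : _ = leb A + leb (Aw `\` A))// leeD2lE.
Qed.

(** * The Lebesgue integral as a translation invariant integral *)

Let T := 'rV[R]_n.
Let U := caratheodory_type lebo.
Let m : {measure set U -> \bar R} := (lebo : set U -> \bar R).

(** Boundedness makes the domain closed under products. *)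
Definition ldom (f : T -> R) : Prop :=
  m.-integrable [set: U] (EFin \o f) /\ exists M : R, forall x, (`|f x| <= M)%R.

Definition litg (f : T -> R) : R := Rintegral m [set: U] f.

Lemma ldom0 : ldom (cst 0%R).
Proof. by split; [exact: integrable0|exists 0%R => x; rewrite normr0]. Qed.

Lemma ldom_lin (c : R) f g : ldom f -> ldom g -> ldom (fun x => c * f x + g x)%R.
Proof.
move=> [fi [M fM]] [gi [N gN]]; split.
  have := integrableD measurableT (integrableZl measurableT c fi) gi.
  by apply: eq_integrable => // x _ /=.
exists (`|c| * M + N)%R => x; apply: le_trans (ler_normD _ _) _; apply: lerD => //.
by rewrite normrM ler_wpM2l.
Qed.

Lemma ldomM f g : ldom f -> ldom g -> ldom (fun x => f x * g x)%R.
Proof.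
move=> [fi [M fM]] [gi [N gN]].
have M0 : (0 <= M)%R by apply: le_trans (fM 0%R).
split; last by exists (M * N)%R => x; rewrite normrM ler_pM.
apply: (@le_integrable _ U R m _ measurableT _ (fun x => M%:E * (EFin \o g) x)).
- apply/measurable_EFinP; apply: measurable_funM.
    exact/measurable_EFinP/(measurable_int _ fi).
  exact/measurable_EFinP/(measurable_int _ gi).
- move=> x _; change (`|(f x * g x)%:E| <= `|(M * g x)%:E|).
  by rewrite lee_fin !normrM ler_wpM2r// (ger0_norm M0).
- exact: integrableZl.
Qed.

Lemma measurable_translate w : measurable_fun [set: U] ((fun x => x + w)%R : U -> U).
Proof. by move=> _ A mA; rewrite setTI; exact: cara_translate. Qed.

Lemma pushforward_translate w : pushforward m ((fun x => x + w)%R : U -> U) = m :> (set U -> \bar R).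
Proof. by apply/funext => A; exact: leb_translate. Qed.

Lemma ldom_sh w f : ldom f -> ldom (fun x => f (x + w)%R).
Proof.
move=> [fi [M fM]]; split; last by exists M => x; exact: fM.
have mf := measurable_int _ fi.
apply/integrableP; split.
  exact: (measurableT_comp mf (measurable_translate w)).
have h := @ge0_integral_pushforward _ _ U U R _ (measurable_translate w) m setT
  (fun x => `|(f x)%:E|) measurableT (measurableT_comp (@abse_measurable _ _) mf) (fun x _ => abse_ge0 _).
rewrite pushforward_translate in h.
by rewrite -[X in X < _]h; case/integrableP : fi.
Qed.

Lemma litg_lin (c : R) f g : ldom f -> ldom g ->
  litg (fun x => c * f x + g x)%R = (c * litg f + litg g)%R.
Proof.
move=> [fi _] [gi _]; rewrite /litg RintegralD ?RintegralZl//.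
by have := integrableZl measurableT c fi; apply: eq_integrable.
Qed.

Lemma litg_ge0 f : ldom f -> (forall x, 0 <= f x)%R -> (0 <= litg f)%R.
Proof. by move=> _ f0; apply: Rintegral_ge0. Qed.

Lemma litg_sh w f : ldom f -> litg (fun x => f (x + w)%R) = litg f.
Proof.
move=> fd; have [fi _] := fd; have [fwi _] := ldom_sh w fd.
rewrite /litg /Rintegral; congr fine.
have := @integral_pushforward _ _ U U R _ (measurable_translate w) m setT (EFin \o f) (measurable_int _ fi) fwi measurableT.
by rewrite pushforward_translate => ->.
Qed.

Definition lint : invint R T :=
  Invint ldom0 ldom_lin ldomM ldom_sh litg_lin litg_ge0 litg_sh.

Lemma ldom_indic (A : set T) : leb_measurable A -> leb A < +oo -> ldom (\1_A : T -> R).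
Proof.
move=> mA Aoo; split; last first.
  by exists 1%R => x; rewrite indicE; case: (x \in A); rewrite ?normr1 ?normr0.
apply/integrableP; split.
  by apply/measurable_EFinP; apply: measurable_indic.
under eq_integral do rewrite /= indicE ger0_norm// -indicE.
by rewrite integral_indic// setIT.
Qed.

Lemma litg_indic (A : set T) : leb_measurable A -> litg (\1_A : T -> R) = fine (leb A).
Proof. by move=> mA; rewrite /litg /Rintegral integral_indic// setIT. Qed.

(** This provides the modulus [rho]: the squared difference of two indicator functions is the
    indicator function of the symmetric difference. *)
Lemma nrm_sh_indic (A : set T) (Ad : ldom (\1_A : T -> R)) (b : R) : leb_measurable A -> leb A < +oo ->
  (0 < b)%R -> exists2 r : R, (0 < r)%R & forall w, (`|w| <= r)%R ->
    (nrm (sh w (mkifun (J := lint) Ad) - mkifun (J := lint) Ad : ifun lint) <= b)%R.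
Proof.
move=> mA Aoo b0; have b2 : (0 < b ^+ 2 / 2)%R by rewrite divr_gt0// exprn_gt0.
have [r r0 hr] := leb_translate_diff mA Aoo b2.
exists r => // w wr; rewrite -ler_sqr ?nnegrE ?nrm_ge0 ?(ltW b0)// nrm_sqr ipE.
pose Aw := (fun x => x + w)%R @^-1` A.
have mAw : leb_measurable Aw by exact: cara_translate.
have m1 : leb_measurable (Aw `\` A) by exact: (@caratheodory_measurable_setD R _ lebo).
have m2 : leb_measurable (A `\` Aw) by exact: (@caratheodory_measurable_setD R _ lebo).
have h1 : leb (Aw `\` A) <= (b ^+ 2 / 2)%:E by exact: hr.
have h2 : leb (A `\` Aw) <= (b ^+ 2 / 2)%:E.
  rewrite -(leb_translate (- w)); apply: le_trans (hr (- w)%R _); last by rewrite normrN.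
  by apply: le_leb => x [h3 h4]; split => // h5; apply: h4; rewrite /Aw /= subrK.
have f1 : leb (Aw `\` A) < +oo by apply: le_lt_trans h1 _; rewrite ltry.
have f2 : leb (A `\` Aw) < +oo by apply: le_lt_trans h2 _; rewrite ltry.
have d1 := ldom_indic m1 f1; have d2 := ldom_indic m2 f2.
rewrite (@itg_eq _ _ lint _ (fun x => \1_(Aw `\` A) x + \1_(A `\` Aw) x)%R).
  rewrite itgD// /= !litg_indic//.
  have g1 : (fine (leb (Aw `\` A)) <= b ^+ 2 / 2)%R.
    by rewrite -lee_fin fineK// ge0_fin_numE// leb_ge0.
  have g2 : (fine (leb (A `\` Aw)) <= b ^+ 2 / 2)%R.
    by rewrite -lee_fin fineK// ge0_fin_numE// leb_ge0.
  by rewrite [leRHS](splitr (b ^+ 2)) lerD.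
move=> x; rewrite ivalB shE /= !indicE !in_setD.
have -> : (x \in Aw) = ((x + w)%R \in A) by apply/idP/idP; rewrite !inE.
by case: (x \in A); case: ((x + w)%R \in A) => /=; ring.
Qed.

End Lebesgue.

(** * Blocks of coordinates *)

Section Blocks.
Variables (R : realType) (d : nat) (n : 'I_d -> nat).
Let N := (\sum_(j < d) n j)%N.

Lemma enorm_dot m (u : 'rV[R]_m) : enorm u = Num.sqrt (dot u u).
Proof. by congr Num.sqrt; apply: eq_bigr => i _; rewrite expr2. Qed.

Lemma dot_blocks (x : 'rV[R]_N) : dot x x = \sum_j dot (submxrow x j) (submxrow x j).
Proof.
have : x *m x^T = (\sum_j dot (submxrow x j) (submxrow x j))%:M.
  rewrite -{1 2}(submxrowK x) tr_mxrow mul_mxrow_mxcol -scalemx1 scaler_suml.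
  by apply: eq_bigr => j _; rewrite dot_mx scalemx1.
rewrite dot_mx => /matrixP/(_ 0 0); by rewrite !mxE eqxx !mulr1n.
Qed.

Definition bemb_fun (j : 'I_d) (u : 'rV[R]_(n j)) : 'rV[R]_N :=
  \row_c \sum_a u 0 a * (c == tagnat.Rank j a)%:R.

Lemma bemb_linear j : linear (@bemb_fun j).
Proof.
move=> c u v; apply/rowP => k; rewrite !mxE mulr_sumr -big_split/=.
by apply: eq_bigr => a _; rewrite !mxE; ring.
Qed.

HB.instance Definition _ j := GRing.isLinear.Build R _ _ _ (@bemb_fun j) (@bemb_linear j).

Definition bemb j : {linear 'rV[R]_(n j) -> 'rV[R]_N} := @bemb_fun j.

Lemma Rank_eq j k (a : 'I_(n j)) (b : 'I_(n k)) :
  (tagnat.Rank j a == tagnat.Rank k b) = (Tagged (fun i => 'I_(n i)) a == Tagged (fun i => 'I_(n i)) b).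
Proof. exact: (inj_eq (@tagnat.rank_inj _ _)). Qed.

Lemma bemb_Rank j k (u : 'rV[R]_(n j)) (b : 'I_(n k)) : k != j -> bemb j u 0 (tagnat.Rank k b) = 0.
Proof.
move=> kj; rewrite mxE big1// => a _; rewrite Rank_eq.
case: eqP => [h|]; last by rewrite mulr0.
by move: kj; have := congr1 tag h => /= ->; rewrite eqxx.
Qed.

Lemma bemb_Rank_same j (u : 'rV[R]_(n j)) (b : 'I_(n j)) : bemb j u 0 (tagnat.Rank j b) = u 0 b.
Proof.
rewrite mxE (bigD1 b)//= eqxx mulr1 big1 ?addr0// => a ab.
by rewrite Rank_eq eq_Tagged/= eq_sym (negPf ab) mulr0.
Qed.

Lemma submxrow_bemb_sum (y : forall j, 'rV[R]_(n j)) k :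
  submxrow (\sum_j bemb j (y j)) k = y k.
Proof.
apply/rowP => b; rewrite mxE summxE (bigD1 k)//= bemb_Rank_same big1 ?addr0// => j jk.
by rewrite bemb_Rank// eq_sym.
Qed.

Lemma bemb_norm j (u : 'rV[R]_(n j)) : `|bemb j u| <= `|u|.
Proof.
apply: norm_le_coord => // c; rewrite -(tagnat.sig2K c).
have [e|ne] := eqVneq (tagnat.sig1 c) j; last by rewrite bemb_Rank// normr0.
by move: (tagnat.sig2 c); rewrite e => b; rewrite bemb_Rank_same coord_le_norm.
Qed.

Lemma isometric_copy_block (l : R) (D D' : forall j, set 'rV[R]_(n j)) : 0 <= l ->
  (forall j, isometric_copy l (D j) (D' j)) -> isometric_copy l (block_prod D) (block_prod D').
Proof.
move=> l0 h; pose phi j := sval (cid (h j)).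
have phiP j : set_bij (D j) (D' j) (phi j) /\
    forall v w, D j v -> D j w -> enorm (phi j v - phi j w) = l * enorm (v - w).
  exact: (svalP (cid (h j))).
pose Phi (x : 'rV[R]_N) : 'rV[R]_N := \mxrow_j phi j (submxrow x j).
exists Phi; split; first split.
- move=> x Dx j; rewrite mxrowK; have [[hf _ _] _] := phiP j.
  by apply: hf; exact: Dx.
- move=> x y; rewrite !inE => Dx Dy /mxrowP e; rewrite -(submxrowK x) -(submxrowK y).
  apply/eq_mxrowP => j; have [[_ hi _] _] := phiP j.
  by apply: hi; rewrite ?inE//; have := e j; rewrite !mxrowK.
- move=> y D'y.
  have ex j : exists x, D j x /\ phi j x = submxrow y j.
    by have [[_ _ hs] _] := phiP j; have [x Dx <-] := hs _ (D'y j); exists x.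
  exists (\mxrow_j sval (cid (ex j))); first by move=> j; rewrite mxrowK; case: (svalP (cid (ex j))).
  rewrite -[RHS]submxrowK; apply/eq_mxrowP => j; rewrite mxrowK.
  by case: (svalP (cid (ex j))).
move=> v w Dv Dw.
have sq j : dot (phi j (submxrow v j) - phi j (submxrow w j)) (phi j (submxrow v j) - phi j (submxrow w j))
    = l ^+ 2 * dot (submxrow v j - submxrow w j) (submxrow v j - submxrow w j).
  have [_ /(_ _ _ (Dv j) (Dw j))] := phiP j; rewrite !enorm_dot => /(congr1 (fun y => y ^+ 2)).
  by rewrite exprMn !sqr_sqrtr ?dot_ge0.
rewrite !enorm_dot !dot_blocks.
under eq_bigr do rewrite submxrowB !mxrowK sq.
under [in RHS]eq_bigr do rewrite submxrowB.
by rewrite -mulr_sumr sqrtrM ?sqr_ge0// sqrtr_sqr ger0_norm.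
Qed.

Lemma all2P_map_ex (I : eqType) (T U : Type) (P : T -> U -> Prop) (B : I -> T) js us :
  uniq js -> all2P P (map B js) us -> (0 < size us)%N ->
  exists g : I -> U, us = map g js /\ forall j, j \in js -> P (B j) (g j).
Proof.
elim: js us => [|j js IH] [|u us] //= /andP[jjs ujs] [Pu h] _.
case: us h => [|u' us] h.
  by case: js h {IH ujs jjs} => //= _; exists (fun=> u); split => // k; rewrite inE => /eqP ->.
have [g [-> gP]] := IH _ ujs h isT.
exists (fun k => if k == j then u else g k); rewrite eqxx; split.
  congr cons; apply/eq_in_map => k kjs; case: eqP => // kj; by move: jjs; rewrite -kj kjs.
by move=> k; rewrite inE; case: eqP => [->|_] //=; exact: gP.
Qed.

Lemma all2P_maps (I : eqType) (T U : Type) (P : T -> U -> Prop) (f : I -> T) (g : I -> U) js :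
  (forall j, j \in js -> P (f j) (g j)) -> all2P P (map f js) (map g js).
Proof.
elim: js => //= j js IH h; split; first by apply: h; rewrite mem_head.
by apply: IH => k kjs; apply: h; rewrite inE kjs orbT.
Qed.

Lemma similar_copy m (p : 'I_m -> 'rV[R]_m) (h : 'rV[R]_m -> 'rV[R]_m) (c : 'rV[R]_m) (l : R) :
  0 < l -> (forall x y, dot (h x - h y) (h x - h y) = dot (x - y) (x - y)) ->
  isometric_copy l (range p) (range (fun k => c + l *: h (p k))).
Proof.
move=> l0 hi; exists (fun x => c + l *: h x).
have dE x y : (c + l *: h x) - (c + l *: h y) = l *: (h x - h y).
  by rewrite opprD addrACA subrr add0r scalerBr.
split; first split.
- by move=> _ [k _ <-]; exists k.
- move=> x y _ _ e; have : dot (h x - h y) (h x - h y) == 0.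
    rewrite dot_eq0; have := dE x y; rewrite e subrr => /esym/eqP.
    by rewrite scaler_eq0 gt_eqF.
  by rewrite hi dot_eq0 subr_eq0 => /eqP.
- by move=> _ [k _ <-]; exists (p k) => //; exists k.
move=> x y _ _; rewrite dE !enorm_dot dotZl dotZr hi mulrA -expr2 sqrtrM ?sqr_ge0//.
by rewrite sqrtr_sqr ger0_norm// ltW.
Qed.

End Blocks.

(** * Copies inside sets of finite measure *)

Section Assembly.
Variables (R : realType) (d : nat) (n : 'I_d -> nat).
Let N := (\sum_(j < d) n j)%N.
Hypothesis d_gt0 : (0 < d)%N.
Hypothesis n_gt0 : forall j, (0 < n j)%N.
Variables (p : forall j, 'I_(n j) -> 'rV[R]_(n j)).
Hypothesis p_indep : forall j, affinely_independent (@p j).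

Lemma N_gt0 : (0 < N)%N.
Proof. by rewrite /N (bigD1 (Ordinal d_gt0))//= ltn_addr// n_gt0. Qed.

Definition pblock j : block 'rV[R]_N :=
  @Block R _ (n j) (bemb R n j) (@p j) (@bemb_norm R d n j) (n_gt0 j) (@p_indep j).

(** A pattern contains every sum of one vertex from each block, that is, the whole product. *)
Lemma copy_of_pattern (l : R) (S : set 'rV[R]_N) ss (x : 'rV[R]_N) : 0 < l ->
  all2P (fun B s => sim (bio B) (@bpt _ _ B) l s) [seq pblock j | j <- enum 'I_d] ss ->
  (forall ds, all2P (fun (s : seq 'rV[R]_N) e => e \in s) ss ds -> S (x + \sum_(e <- ds) e)) ->
  contains_product_copy (fun j => range (@p j)) l S.
Proof.
move=> l0 hss hx.
have sz : (0 < size ss)%N by rewrite -(all2P_size hss) size_map size_enum_ord.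
have [g [ssE gP]] := all2P_map_ex (enum_uniq _) hss sz.
have ex j : exists h : 'rV[R]_(n j) -> 'rV[R]_(n j),
    (forall x y, dot (h x - h y) (h x - h y) = dot (x - y) (x - y)) /\
    g j = [seq bemb R n j (l *: h (p k)) | k <- enum 'I_(n j)].
  by apply: gP; rewrite mem_enum.
pose h j := sval (cid (ex j)).
have hi j : forall x y, dot (h j x - h j y) (h j x - h j y) = dot (x - y) (x - y).
  by case: (svalP (cid (ex j))).
have hg j : g j = [seq bemb R n j (l *: h j (p k)) | k <- enum 'I_(n j)].
  by case: (svalP (cid (ex j))).
exists (fun j => range (fun k => submxrow x j + l *: h j (p k))); split.
- by move=> j; exact: similar_copy.
- by apply: isometric_copy_block; [exact: ltW|move=> j; exact: similar_copy].
move=> y yD.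
have ek j : exists k, submxrow x j + l *: h j (p k) = submxrow y j by have [k _ e] := yD j; exists k.
pose k j := sval (cid (ek j)).
have kE j : submxrow x j + l *: h j (p (k j)) = submxrow y j := svalP (cid (ek j)).
have -> : y = x + \sum_(e <- [seq bemb R n j (l *: h j (p (k j))) | j <- enum 'I_d]) e.
  rewrite big_map big_enum /=; apply/mxrowP => j; rewrite -kE submxrowD.
  by rewrite (submxrow_bemb_sum (fun j => l *: h j (p (k j)))).
apply: hx; rewrite ssE; apply: all2P_maps => j _; rewrite hg.
by apply/mapP; exists (k j) => //; rewrite mem_enum.
Qed.

(** [Q] contains the neighborhood of [S] that the tuples can reach, each of the [d] blocks moving a
    point by at most [lam j]; its indicator function is the [chi] of [many_scales]. *)
Lemma lacunary_copies (kap : R) : 0 < kap -> exists (J0 : nat) (C : R), 1 <= C /\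
  forall (lam : nat -> R) (S Q : set 'rV[R]_N) (V : R), 0 < lam 0%N ->
    (forall j, C * lam j <= lam j.+1) -> 0 < V -> leb_measurable S -> leb_measurable Q ->
    ((kap * V)%:E <= leb S)%E -> (leb S <= V%:E)%E -> (leb Q <= V%:E)%E ->
    (forall j x w, (j < J0)%N -> `|w| <= d%:R * lam j -> S (x + w) -> Q x) ->
  exists2 j, (j < J0)%N & contains_product_copy (fun j => range (@p j)) (lam j) S.
Proof.
move=> kap0; pose ps := [seq pblock j | j <- enum 'I_d]; pose q := N.+2.
have psq b : b \in [seq bdim B | B <- ps] -> (b <= q)%N.
  rewrite -map_comp => /mapP[j _ ->] /=; rewrite /q /N (bigD1 j)//=.
  by apply: leq_trans (leq_addr _ _) _; rewrite ltnW.
have [J0 [C [C1 main]]] := @many_scales R _ (lint R N_gt0) q isT ps kap psq kap0.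
exists J0, C; split => // lam S Q V lam0 lamS V0 mS mQ kV SV QV SQ.
have Soo : (leb S < +oo)%E by apply: le_lt_trans SV _; rewrite ltry.
have Qoo : (leb Q < +oo)%E by apply: le_lt_trans QV _; rewrite ltry.
have Sf : leb S \is a fin_num by rewrite ge0_fin_numE// leb_ge0.
have Qf : leb Q \is a fin_num by rewrite ge0_fin_numE// leb_ge0.
pose f := mkifun (J := lint R N_gt0) (ldom_indic N_gt0 mS Soo).
pose chi := mkifun (J := lint R N_gt0) (ldom_indic N_gt0 mQ Qoo).
have fE x : f x = (x \in S)%:R by rewrite /f /= indicE.
have cE x : chi x = (x \in Q)%:R by rewrite /chi /= indicE.
have If : itg (lint R N_gt0) f = fine (leb S) by exact: litg_indic.
have Ic : itg (lint R N_gt0) chi = fine (leb Q) by exact: litg_indic.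
have fS x : f x != 0 -> S x.
  by rewrite fE; case: (boolP (x \in S)) => [xS _|_]; [rewrite inE in xS|rewrite eqxx].
have lamp j : 0 < lam j.
  elim: j => // j IH; apply: lt_le_trans (lamS j); by rewrite mulr_gt0//; apply: lt_le_trans C1.
have [||||||||j jJ [ss [x [hs hx]]]] := main lam f chi V lam0 lamS V0.
- by move=> x; rewrite fE; case: (x \in S); rewrite /= ?lexx ?ler01.
- by move=> x; rewrite fE; case: (x \in S) => /=; rewrite ?mul0r ?mulr1.
- by rewrite If -lee_fin fineK.
- by rewrite If -lee_fin fineK.
- by move=> x; rewrite cE.
- by rewrite Ic -lee_fin fineK.
- move=> j x w jJ; rewrite size_map size_enum_ord => wl /fS Sxw.
  by have Qx := SQ j x w jJ wl Sxw; rewrite cE mem_set.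
- by move=> b b0; exact: (@nrm_sh_indic R _ N_gt0 S (ldom_indic N_gt0 mS Soo) b mS Soo b0).
exists j => //; apply: copy_of_pattern hs _ => // ds /hx; exact: fS.
Qed.

Lemma contains_mono (l : R) (S S' : set 'rV[R]_N) : S `<=` S' ->
  contains_product_copy (fun j => range (@p j)) l S ->
  contains_product_copy (fun j => range (@p j)) l S'.
Proof. by move=> SS' [D' [h1 h2 h3]]; exists D'; split => //; exact: subset_trans h3 SS'. Qed.

End Assembly.

(** * Density on cubes and lacunary sequences *)

Section Cubes.
Variables (R : realType) (m : nat).
Hypothesis m_gt0 : (0 < m)%N.

Lemma translate_preimage (t : 'rV[R]_m) (A : set 'rV[R]_m) :
  translate t A = (fun x => x + - t) @^-1` A.
Proof.
apply/seteqP; split => [_ [y Ay <-]|x /= Ax]; first by rewrite /= addrAC subrr add0r.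
by exists (x - t) => //; rewrite addrC subrK.
Qed.

Lemma cube_le (r : R) : 0 <= r -> (leb (@cube R m r) <= (r ^+ m)%:E)%E.
Proof.
move=> r0; apply: le_trans (leb_box m_gt0 _) _; first by move=> i; rewrite !mxE; lra.
rewrite lee_fin /bvol (eq_bigr (fun=> r)); first by rewrite prodr_const card_ord.
by move=> i _; rewrite !mxE; field.
Qed.

(** Comparing cubes by dilation spares a lower bound for the measure of a cube. *)
Lemma cube3_le (r : R) : (leb (@cube R m (3 * r)) <= (3 ^+ m)%:E * leb (@cube R m r))%E.
Proof.
apply: le_trans (leb_dilate _ _); last exact: ltr0n.
apply: le_leb => x xc i; have := xc i; rewrite !mxE => /andP[h1 h2].
by rewrite ler_pdivlMl// ler_pdivrMl//; apply/andP; split; lra.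
Qed.

End Cubes.

Lemma positive_density_cubes (R : realType) (m : nat) (m_gt0 : (0 < m)%N) (S : set 'rV[R]_m) :
  (0 < upper_banach_density S)%E -> exists2 kap : R, 0 < kap &
    forall r0 : R, exists r t, [/\ r0 <= r, (0 < leb (@cube R m r) < +oo)%E &
      (kap%:E * leb (@cube R m r) <= leb (S `&` translate t (cube r)))%E].
Proof.
rewrite /upper_banach_density; set g := fun r : R => ereal_sup _ => L0.
(* Without convergence [lim] takes its default value 0, which positivity excludes. *)
have [gc|/dvgP gd] := pselect (cvg (g r @[r --> +oo])); last by rewrite gd ltxx in L0.
have [kap kap0 kL] : exists2 kap : R, 0 < kap & (kap%:E < lim (g r @[r --> +oo%R]))%E.
  case: (lim _) L0 => [y|_|//]; last by exists 1; rewrite ?ltry.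
  by rewrite lte_fin => y0; exists (y / 2); rewrite ?lte_fin ?divr_gt0//; lra.
exists kap => // r0.
have [M [_ hM]] := gc [set y | kap%:E < y]%E (open_ereal_gt' kL).
pose r := Num.max (Num.max r0 1) (M + 1).
have rM : M < r by rewrite lt_max; apply/orP; right; lra.
have r0r : r0 <= r by rewrite !le_max lexx.
have r1 : 1 <= r by rewrite !le_max lexx orbT.
have /ereal_sup_gt[_ [t _ <-] ht] := hM r rM.
exists r, t.
have coo : (leb (@cube R m r) < +oo)%E by apply: le_lt_trans (cube_le m_gt0 _) _; [lra|exact: ltry].
have c0 : (0 < leb (@cube R m r))%E.
  (* On a cube of measure 0 the numerator vanishes as well, and the quotient would be 0. *)
  rewrite lt_neqAle leb_ge0 andbT; apply/negP => /eqP c0.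
  have s0 : leb (S `&` translate t (cube r)) = 0%E.
    apply/eqP; rewrite eq_le leb_ge0 andbT [leRHS]c0 -(leb_translate (- t) (cube r)) -translate_preimage.
    by apply: le_leb => x [].
  by move: ht; rewrite s0 mul0e lte_fin ltNge ltW.
split=> //; first by rewrite c0 coo.
have cf : leb (@cube R m r) \is a fin_num by rewrite ge0_fin_numE// leb_ge0.
move: ht; rewrite -{1}(fineK cf) inver; case: eqP => [z|/eqP z]; first by move: c0; rewrite -(fineK cf) z ltxx.
have fc0 : 0 < fine (leb (@cube R m r)) by rewrite -lte_fin fineK.
by rewrite lte_pdivlMr// fineK// => /ltW.
Qed.

Lemma lacunary_choice (R : realType) (P : R -> Prop) (C : R) : 1 <= C ->
  (forall l0 : R, 0 < l0 -> exists2 l, l0 <= l & P l) ->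
  exists lam : nat -> R, [/\ 0 < lam 0%N, forall j, C * lam j <= lam j.+1 & forall j, P (lam j)].
Proof.
move=> C1 h.
have /choice[F FP] l0 : exists l, 0 < l0 -> l0 <= l /\ P l.
  have [/h[l l0l Pl]|_] := ltP 0 l0; first by exists l.
  by exists 0.
pose lam := fix lam j := if j is i.+1 then F (C * lam i) else F 1.
have lam0 j : 0 < lam j.
  elim: j => [|j IH] /=; first by have [h1 _] := FP 1 ltr01; lra.
  have Cl : 0 < C * lam j by rewrite mulr_gt0//; lra.
  by have [h1 _] := FP _ Cl; apply: lt_le_trans h1.
exists lam; split => // [j|[|j]] /=.
- have Cl : 0 < C * lam j by rewrite mulr_gt0//; lra.
  by have [] := FP _ Cl.
- by have [] := FP 1 ltr01.
- have Cl : 0 < C * lam j by rewrite mulr_gt0//; lra.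
  by have [] := FP _ Cl.
Qed.

Theorem theorem1p2 (R : realType) (d : nat) (d_gt0 : (0 < d)%N)
    (n : 'I_d -> nat) (n_gt0 : forall j, (0 < n j)%N)
    (Delta : forall j, set 'rV[R]_(n j))
    (simplexDelta : forall j, nondegenerate_simplex (Delta j)) :
  (forall S : set 'rV[R]_(\sum_(j < d) n j),
     leb_measurable S -> (0 < upper_banach_density S)%E ->
     exists2 lambda0 : R, 0 < lambda0 &
       forall lambda : R, lambda0 <= lambda ->
         contains_product_copy Delta lambda S)
  /\
  (forall delta : R, 0 < delta <= 1 ->
     exists2 c : R, 0 < c &
       forall S : set 'rV[R]_(\sum_(j < d) n j),
         leb_measurable S ->
         S `<=` box (const_mx 0) (const_mx 1) ->
         (delta%:E <= leb S)%E ->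
         exists a b : R, [/\ 0 < a, c <= b - a &
           forall lambda : R, a <= lambda <= b ->
             contains_product_copy Delta lambda S]).
Proof.
pose N := (\sum_(j < d) n j)%N.
have N0 : (0 < N)%N := N_gt0 d_gt0 n_gt0.
pose p j := sval (cid (simplexDelta j)).
have pP j : affinely_independent (p j) /\ Delta j = range (p j) := svalP (cid (simplexDelta j)).
have DE : Delta = fun j => range (p j).
  by apply: functional_extensionality_dep => j; case: (pP j).
have pi j : affinely_independent (p j) by case: (pP j).
rewrite DE => {DE pP}.
have d0 : 0 < d%:R :> R by rewrite ltr0n.
have d1 : 1 <= d%:R :> R by rewrite ler1n.
have coord (w : 'rV[R]_N) i c : `|w| <= c -> - c <= w 0 i <= c.
  by move=> wc; rewrite -ler_norml; apply: le_trans (coord_le_norm w i) wc.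
have three : 0 < 3 ^+ N :> R by rewrite exprn_gt0.
have three1 : 1 <= 3 ^+ N :> R by rewrite exprn_ege1//; lra.
split => [S mS|delta /andP[del0 del1]].
  move=> /(positive_density_cubes N0)[kap kap0 hk]; apply: contrapT => hn.
  (* [V] is to be the measure of a cube of side [3 * r], which contains the neighborhood of the part
     of [S] in a cube of side [r]. *)
  have kap3 : 0 < kap / 3 ^+ N by exact: divr_gt0.
  have [J0 [C [C1 main]]] := lacunary_copies d_gt0 n_gt0 pi kap3.
  (* Without a threshold there are arbitrarily large bad factors, hence a lacunary sequence of them.
     Only then is the cube chosen, large compared with the first [J0] terms. *)
  have [|lam [lam0 lamS lamP]] := @lacunary_choice R
      (fun l => ~ contains_product_copy (fun j => range (p j)) l S) C C1.
    move=> l0 l00; apply: contrapT => h; apply: hn; exists l0 => // l l0l.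
    by apply: contrapT => hl; apply: h; exists l.
  have lamp j : 0 < lam j.
    by elim: j => // j IH; apply: lt_le_trans (lamS j); rewrite mulr_gt0//; lra.
  have laml j : (j < J0)%N -> lam j <= lam J0.
    move=> /ltnW /subnK <-; elim: (J0 - j)%N => //= i IH; apply: le_trans IH _.
    by apply: le_trans (lamS _); rewrite ler_peMl// ltW.
  have [r [t [rl /andP[c0 coo] hS]]] := hk (d%:R * lam J0).
  have cf : leb (@cube R N r) \is a fin_num by rewrite ge0_fin_numE// ltW.
  have fc0 : 0 < fine (leb (@cube R N r)) by rewrite -lte_fin fineK.
  have mT r' : leb_measurable (translate t (@cube R N r')).
    by rewrite translate_preimage; apply: cara_translate => //; exact: cara_box.
  have lT r' : leb (translate t (@cube R N r')) = leb (@cube R N r').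
    by rewrite translate_preimage leb_translate.
  pose S' := S `&` translate t (cube r).
  have [|||||||j jJ] := main lam S' (translate t (cube (3 * r))) (3 ^+ N * fine (leb (@cube R N r))) lam0 lamS.
  - by rewrite mulr_gt0.
  - exact: (@caratheodory_measurable_setI R _ (lebo R N0) _ _ mS (mT r)).
  - exact: mT.
  - rewrite mulrA divfK ?gt_eqF// EFinM fineK//.
  - apply: (@le_trans _ _ (leb (@cube R N r))).
      by rewrite -(lT r); apply: le_leb => x [].
    by rewrite -{1}(fineK cf) lee_fin ler_peMl// ltW.
  - by rewrite lT EFinM fineK//; exact: cube3_le.
  - move=> j x w jJ wl [_]; rewrite !translate_preimage /= => h i.
    have wr : `|w| <= r.
      apply: le_trans wl _; apply: le_trans rl; rewrite ler_pM2l//; exact: laml.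
    have /andP[w1 w2] := coord w i _ wr; have /andP[x1 x2] := h i.
    rewrite !mxE in x1 x2 *; apply/andP; split; lra.
  move=> /contains_mono h; apply: (lamP j); apply: h; exact: subIsetl.
have kap3 : 0 < delta / 3 ^+ N by exact: divr_gt0.
have [J0 [C [C1 main]]] := lacunary_copies d_gt0 n_gt0 pi kap3.
have C2 : 1 <= 2 * C by lra.
have C20 : 0 < 2 * C by lra.
(* With the ratio [2 * C], any choice of one point in each [[a j, 2 * a j]] is lacunary of ratio
   [C]. The denominator keeps the displacements at most 1, inside the box from -1 to 2. *)
pose a j := (2 * C) ^+ j / (2 * d%:R * (2 * C) ^+ J0).
have den : 0 < 2 * d%:R * (2 * C) ^+ J0 by rewrite mulr_gt0 ?exprn_gt0// mulr_gt0.
have a0 j : 0 < a j by rewrite divr_gt0 ?exprn_gt0.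
have aS j : a j.+1 = 2 * C * a j by rewrite /a exprS mulrA.
have aJ j : (j < J0)%N -> d%:R * (2 * a j) <= 1.
  move=> jJ; rewrite /a (_ : d%:R * (2 * _) = (2 * C) ^+ j * (2 * d%:R) / (2 * d%:R * (2 * C) ^+ J0)); last by ring.
  rewrite ler_pdivrMr// mul1r mulrC ler_pM2l ?mulr_gt0//.
  by rewrite ler_weXn2l// ltnW.
have a0j j : a 0%N <= a j.
  elim: j => // j IH; apply: le_trans IH _; rewrite aS ler_peMl// ltW//.
exists (a 0%N) => // S mS Sbox Sdel.
have [[j jJ hj]|hn] := pselect (exists2 j, (j < J0)%N & forall l, a j <= l <= 2 * a j ->
    contains_product_copy (fun j => range (p j)) l S).
  by exists (a j), (2 * a j); split => //; have := a0j j; lra.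
exfalso.
(* Otherwise each of the [J0] intervals contains a bad factor; beyond [J0] the value [a j] merely
   continues the sequence. *)
have /choice[lam lamP] j : exists l, a j <= l <= 2 * a j /\
    ((j < J0)%N -> ~ contains_product_copy (fun j => range (p j)) l S).
  have [jJ|jJ] := ltnP j J0; last by exists (a j); split=> //; rewrite lexx/=; have := a0 j; lra.
  apply: contrapT => h; apply: hn; exists j => // l al; apply: contrapT => hl; apply: h.
  by exists l.
have leS1 : (leb S <= 1%:E)%E.
  apply: le_trans (le_leb Sbox) _; apply: le_trans (leb_box N0 _) _; first by move=> i; rewrite !mxE.
  by rewrite lee_fin /bvol big1// => i _; rewrite !mxE subr0.
have [|||||||||j jJ] := main lam S (box (const_mx (-1)) (const_mx 2)) (3 ^+ N).
- by have [/andP[h _] _] := lamP 0%N; apply: lt_le_trans h.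
- move=> j; have [/andP[_ h] _] := lamP j; have [/andP[h' _] _] := lamP j.+1.
  by apply: le_trans h'; rewrite aS (_ : 2 * C * a j = C * (2 * a j)) ?ler_pM2l//; [lra|ring].
- by [].
- exact: mS.
- exact: cara_box.
- by rewrite divfK// gt_eqF.
- by apply: le_trans leS1 _; rewrite lee_fin.
- apply: le_trans (leb_box N0 _) _; first by move=> i; rewrite !mxE; lra.
  rewrite lee_fin /bvol (eq_bigr (fun=> 3)) ?prodr_const ?card_ord// => i _; by rewrite !mxE; lra.
- move=> j x w jJ wl /Sbox h i.
  have w1 : `|w| <= 1.
    apply: le_trans wl _; apply: le_trans (aJ j jJ); rewrite ler_pM2l//.
    by have [/andP[]] := lamP j.
  have /andP[v1 v2] := coord w i _ w1; have /andP[x1 x2] := h i.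
  rewrite !mxE in x1 x2 *; apply/andP; split; lra.
by have [_ h] := lamP j; exact: h.
Qed.
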